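(* For every $b\ge 2$, the problem $p\text{-}\#\mathrm{LOGREACH}_b$ is $\#\mathrm{para}_{\beta}\text{-}\mathrm{L}$-complete with respect to $\le^{\mathrm{plog}}_{\mathrm{pars}}$-reductions.
   Context: $p\text{-}\#\mathrm{LOGREACH}_b$ is the parameterised counting problem: given a directed graph $G=(V,E)$ of out-degree $b$ (every vertex has at most $b$ successors), vertices $s,t\in V$ and $a,k\in\mathbb N$, with parameter $k$, output the number of $s$-$t$-walks of length $a$ in $G$ if $a\le k\cdot\log|V|$, and $0$ otherwise. Machine model: inputs $(x,k)$ with parameter $k$; TMs with random access to the input; a nondeterministic TM is a deterministic TM with a read-only choice tape (not counted for space), a nondeterministic step being one where the choice-tape head visits a new cell; $\#\mathrm{acc}_M(x,k)$ is the number of accepting computation paths. A $\mathrm{para}\text{-}\mathrm{L}$-machine uses space $O(\log|x|+f(k))$ for a computable $f$; $k$-bounded means reading at most $f(k)\cdot\log|x|$ choice-tape bits for a computable $f$; read-once access means the choice-tape head moves only one way. $\#\mathrm{para}_{\beta}\text{-}\mathrm{L}$ is the class of functions $F:\{0,1\}^*\times\mathbb N\to\mathbb N$ such that $F=\#\mathrm{acc}_M$ for some $k$-bounded nondeterministic $\mathrm{para}\text{-}\mathrm{L}$-machine $M$ with read-once access to its nondeterministic bits. $F\le^{\mathrm{plog}}_{\mathrm{pars}}F'$ means there is a $\mathrm{para}\text{-}\mathrm{L}$ oracle TM (oracle tape exempt from space bounds) computing $F$ with oracle $F'$ that makes one oracle query, whose parameter is bounded by a computable function of the input parameter, and returns its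 answer. A problem is $\mathcal C$-complete w.r.t. a reducibility if it lies in $\mathcal C$ and every function in $\mathcal C$ reduces to it. *)

(* Defs.v *)
From mathcomp Require Import all_boot.

Set Implicit Arguments.
Unset Strict Implicit.
Unset Printing Implicit Defensive.

Inductive sym := S0 | S1 | Sep | Blank.
Inductive mv := ML | MS | MR.

(* A Turing machine with
   - random access to the (read-only) input: the input symbol read is the one
     at the address written in binary (little endian) on the index tape,
   - one work tape and one index tape (both counted for space),
   - a read-only choice tape (cell 0 is a left marker, cell p+1 holds bit c p),
   - a write-only one-way output tape (used as the oracle/query tape; not
     counted for space).
   Transition: (state, input sym, work sym, index sym, choice sym) ->
   (new state, work write, work move, index write, index move, choice move,
    optional output symbol). *)
Unset Implicit Arguments.
Record TM := MkTM {
  st : finType;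
  q0 : st;
  halting : pred st;
  accepting : pred st;
  delta : st -> sym -> sym -> sym -> sym ->
          st * sym * mv * sym * mv * mv * option sym }.
Set Implicit Arguments.

Record config (M : TM) := Config {
  cq : st M; wt : seq sym; wh : nat; itp : seq sym; ih : nat;
  chp : nat; out : seq sym }.

Definition bsym (b : bool) : sym := if b then S1 else S0.

Definition enc (x : seq bool) (k : nat) : seq sym :=
  map bsym x ++ Sep :: nseq k S1.

Definition move_head (m : mv) (h : nat) : nat :=
  match m with ML => h.-1 | MS => h | MR => h.+1 end.

Definition upd_tape (t : seq sym) (h : nat) (s : sym) (m : mv) : seq sym * nat :=
  let t' := set_nth Blank t h s in
  let h' := move_head m h in
  (t' ++ nseq (h'.+1 - size t') Blank, h').

Definition idx_val (t : seq sym) : nat :=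
  \sum_(i < size t) (if nth Blank t i is S1 then 2 ^ i else 0).

Definition choice_sym (c : nat -> bool) (p : nat) : sym :=
  if p is p'.+1 then bsym (c p') else Sep.

Definition step (M : TM) (x : seq bool) (k : nat) (c : nat -> bool)
  (C : config M) : config M :=
  let: Config q w wh_ it ih_ ch o := C in
  if halting M q then C else
  let: (q', ws, wm, is_, im, cm, os) :=
    delta M q (nth Blank (enc x k) (idx_val it)) (nth Blank w wh_)
            (nth Blank it ih_) (choice_sym c ch) in
  let: (w', wh') := upd_tape w wh_ ws wm in
  let: (it', ih') := upd_tape it ih_ is_ im in
  Config q' w' wh' it' ih' (move_head cm ch)
         (if os is Some s then rcons o s else o).

Definition init (M : TM) : config M :=
  Config (q0 M) [:: Blank] 0 [:: Blank] 0 0 [::].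

Definition run (M : TM) (x : seq bool) (k : nat) (c : nat -> bool) (n : nat)
  : config M := iter n (step x k c) (init M).

(* log |x| (base 2, made >= 1) *)
Definition lg (n : nat) : nat := (trunc_log 2 n).+1.

Definition computable (f : nat -> nat) : Prop :=
  exists M : TM, forall k c, exists n,
    halting M (cq (run M [::] k c n)) /\ out (run M [::] k c n) = nseq (f k) S1.

Definition space (M : TM) (C : config M) : nat := size (wt C) + size (itp C).

Definition paraL (M : TM) : Prop :=
  exists f, computable f /\ exists a, forall x k c n,
    space (run M x k c n) <= a * (lg (size x) + f k).

Definition k_bounded (M : TM) : Prop :=
  exists f, computable f /\ forall x k c n,
    chp (run M x k c n) <= f k * lg (size x).

Definition read_once (M : TM) : Prop :=
  forall x k c n, chp (run M x k c n) <= chp (run M x k c n.+1).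

Definition ext (w : seq bool) : nat -> bool := fun i => nth false w i.

(* w is an accepting computation path: the run with choice bits w visits
   exactly the choice cells 1..|w| and halts accepting. *)
Definition acc_path (M : TM) (x : seq bool) (k : nat) (w : seq bool) : Prop :=
  exists n,
    halting M (cq (run M x k (ext w) n)) /\ accepting M (cq (run M x k (ext w) n)) /\
    (forall m, m <= n -> chp (run M x k (ext w) m) <= size w) /\
    (exists m, m <= n /\ chp (run M x k (ext w) m) = size w).

Definition counts_acc (M : TM) (F : seq bool -> nat -> nat) : Prop :=
  forall x k, exists s : seq (seq bool),
    uniq s /\ (forall w, w \in s <-> acc_path M x k w) /\ F x k = size s.

Definition sharp_paraBeta_L (F : seq bool -> nat -> nat) : Prop :=
  exists M : TM, paraL M /\ k_bounded M /\ read_once M /\ counts_acc M F.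

(* F <=^plog_pars F' : a deterministic para-L machine (never reads the choice
   tape) writes a single query (y, k') on its oracle tape and returns the
   oracle's answer F' y k'; k' is bounded by a computable function of k. *)
Definition plog_pars_reduces (F F' : seq bool -> nat -> nat) : Prop :=
  exists M : TM, paraL M /\ (forall x k c n, chp (run M x k c n) = 0) /\
  exists h, computable h /\ forall x k, exists n y k',
    halting M (cq (run M x k (fun _ => false) n)) /\
    out (run M x k (fun _ => false) n) = enc y k' /\
    k' <= h k /\ F x k = F' y k'.

Definition complete (C : (seq bool -> nat -> nat) -> Prop)
  (red : (seq bool -> nat -> nat) -> (seq bool -> nat -> nat) -> Prop)
  (F : seq bool -> nat -> nat) : Prop :=
  C F /\ forall G, C G -> red G F.

(* x is a list of naturals, each written 1^m 0. *)
Fixpoint dec_nats (x : seq bool) (m : nat) : option (seq nat) :=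
  match x with
  | [::] => if m is 0 then Some [::] else None
  | true :: x' => dec_nats x' m.+1
  | false :: x' => omap (cons m) (dec_nats x' 0)
  end.

(* adjacency lists of v vertices: each as  d, succ_1, ..., succ_d *)
Fixpoint parse_adj (v : nat) (l : seq nat) : option (seq (seq nat)) :=
  match v with
  | 0 => if l is [::] then Some [::] else None
  | v'.+1 =>
    match l with
    | [::] => None
    | d :: l' =>
      if d <= size l' then omap (cons (take d l')) (parse_adj v' (drop d l'))
      else None
    end
  end.

Definition decode (b : nat) (x : seq bool)
  : option (nat * seq (seq nat) * nat * nat * nat) :=
  match dec_nats x 0 with
  | Some (n :: s :: t :: a :: rest) =>
    match parse_adj n rest with
    | Some adj =>
      if [&& s < n, t < n &
          all (fun l => [&& size l <= b, uniq l & all (fun v => v < n) l]) adj]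
      then Some (n, adj, s, t, a) else None
    | None => None
    end
  | _ => None
  end.

Fixpoint all_seqs (n m : nat) : seq (seq nat) :=
  match m with
  | 0 => [:: [::]]
  | m'.+1 => [seq i :: p | i <- iota 0 n, p <- all_seqs n m']
  end.

Definition edge (adj : seq (seq nat)) : rel nat := fun u v => v \in nth [::] adj u.

Definition is_walk (adj : seq (seq nat)) (s t a : nat) (p : seq nat) : bool :=
  if p is u :: q then [&& u == s, size q == a, last u q == t & path (edge adj) u q]
  else false.

Definition num_walks (n : nat) (adj : seq (seq nat)) (s t a : nat) : nat :=
  count (is_walk adj s t a) (all_seqs n a.+1).

(* a <= k * log2 |V|  <->  2^a <= |V|^k *)
Definition logreach (b : nat) (x : seq bool) (k : nat) : nat :=
  match decode b x with
  | Some (n, adj, s, t, a) => if 2 ^ a <= n ^ k then num_walks n adj s t a else 0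
  | None => 0
  end.

(* Main.v *)
(* Membership: a walk is guessed edge by edge, the i-th successor of a vertex being announced by
   the bits 1^i 0, so that accepting paths and walks correspond bijectively.  The delicate point is the test
   2^a <= n^k: n^k has too many bits to be stored, but with L = trunc_log n + 1 it is the sum over the
   e < L^k, read as k-tuples of bit positions of n, of powers of two, and adding these column by column
   only needs counters of size L^k, which is at most 2^(k^2) (2n)^4.

   Hardness: the vertices are the pairs (configuration that has just entered a new choice cell, bit in
   that cell), an edge being a maximal run without nondeterminism.  Carrying the bit in the vertex
   avoids parallel edges.  A looping target pads accepting paths to a common length.

   Both constructions are carried out on counters: a function computed by bounded recursion with all
   intermediate values polynomial in its arguments runs in space logarithmic in these, because the
   counters are stored in binary. *)
Require Import Defs.
From mathcomp Require Import all_boot zify.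

Set Implicit Arguments.
Unset Strict Implicit.
Unset Printing Implicit Defensive.

(** * Register machines as Turing machines *)

(** The exponent 4 in the bound on L^k: with l = log L and k <= l one has L^k <= 2^((l+1)l), and
    (l+1)l <= 4*2^l <= 4L, while 2^L <= 2n. In the hardness part the space bound and the bound on
    choice bits of the given machine are known only through machines that compute them. The
    reduction has to run these on the parameter, inside a space bound that must again be computable.
    Their running times therefore enter this bound, and they are computable because the simulation
    finds them by trial. Machines need not halt on rejecting paths, so the end of a deterministic
    run cannot be awaited. A map on N codes reaches a fixed point within N steps or never, and
    iterating it N times settles the matter. The vertices are all numbers below a bound, not just
    the codes of reachable configurations. This makes the graph easy to list, and vertices that the
    start does not reach add no walks. A walk uses one edge per choice bit and one more to enter the
    target; that extra edge raises the parameter of the query by one. *)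

Inductive opk := OInc | ODec | OTst.

Inductive instr :=
| IMark (l : nat)
| IOp (r : nat) (k : opk) (l0 l1 : nat)
| IIn (s : sym) (l0 l1 : nat)
| ICm (l : nat)
| ICh (l0 l1 : nat)
| IOut (s : sym) (l : nat)
| IHalt (b : bool).

Definition symn (s : sym) : nat :=
  match s with Blank => 0 | S0 => 1 | S1 => 2 | Sep => 3 end.

Definition isS1 (s : sym) : bool := if s is S1 then true else false.

(** Arithmetic from the least significant bit on: [None] hands the carry, the borrow or the search
    for a one to the next bit, [Some b] stops with answer [b]. A blank is the end of the number. *)
Definition act (k : opk) (s : sym) : sym * option bool :=
  match k, s with
  | OInc, S1 => (S0, None)
  | OInc, _ => (S1, Some true)
  | ODec, S1 => (S0, Some true)
  | ODec, S0 => (S1, None)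
  | OTst, S1 => (S1, Some true)
  | OTst, S0 => (S0, None)
  | _, _ => (s, Some false)
  end.

Section Machine.
Variables (R : nat) (code : seq instr).

(* A phase inl j asks for j moves to the right before the operation is applied, inr b for the way
   back to the left end with test result b. *)
Definition mst : finType := ('I_(size code).+1 * ('I_R.+1 + bool))%type.

Definition fetch (l : nat) : instr := nth (IHalt false) code l.

Definition start (l : nat) : mst :=
  (inord l, inl (inord (if fetch l is IOp r _ _ _ then r else 0))).

Definition mdelta (q : mst) (i w x ch : sym) :
    mst * sym * mv * sym * mv * mv * option sym :=
  let: (pc, ph) := q in
  match fetch pc with
  | IMark l => (start l, Sep, MS, x, MS, MS, None)
  | IOp r k l0 l1 =>
    match ph with
    | inl j =>
      if nat_of_ord j is j'.+1 then ((pc, inl (inord j')), w, MR, x, MS, MS, None)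
      else if r is 0 then
        match act k x with
        | (s', None) => ((pc, inl (inord 0)), w, MR, s', MR, MS, None)
        | (s', Some b) => ((pc, inr b), w, MS, s', MS, MS, None)
        end
      else
        match act k w with
        | (s', None) => ((pc, inl (inord R.-1)), s', MR, x, MS, MS, None)
        | (s', Some b) => ((pc, inr b), s', MS, x, MS, MS, None)
        end
    | inr b =>
      if w is Sep then (start (if b then l1 else l0), w, MS, x, MS, MS, None)
      else (q, w, ML, x, ML, MS, None)
    end
  | IIn s l0 l1 =>
    (start (if symn i == symn s then l1 else l0), w, MS, x, MS, MS, None)
  | ICm l => (start l, w, MS, x, MS, MR, None)
  | ICh l0 l1 => (start (if isS1 ch then l1 else l0), w, MS, x, MS, MS, None)
  | IOut s l => (start l, w, MS, x, MS, MS, Some s)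
  | IHalt _ => (q, w, MS, x, MS, MS, None)
  end.

Definition mhalt (q : mst) : bool := if fetch q.1 is IHalt _ then true else false.
Definition macc (q : mst) : bool := if fetch q.1 is IHalt true then true else false.

Definition machine : TM := MkTM mst (start 0) mhalt macc mdelta.

Lemma mdelta_ch q i w x ch :
  let: (_, _, _, _, _, cm, _) := mdelta q i w x ch in cm = MS \/ cm = MR.
Proof.
case: q => pc ph /=.
case: (fetch pc) => [l|r k l0 l1|s l0 l1|l|l0 l1|s l|b]; try by [left|right].
case: ph => [j|b]; last by case: w; left.
case: (nat_of_ord j) => [|j']; last by left.
by case: r => [|r]; case: act => s' [b|]; left.
Qed.

Lemma machine_read_once : read_once machine.
Proof.
move=> x k c n; rewrite /run iterS.
case: (iter n _ _) => q w wh_ it ih_ ch o /=.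
case: mhalt => //.
have := mdelta_ch q (nth Blank (enc x k) (idx_val it)) (nth Blank w wh_)
  (nth Blank it ih_) (choice_sym c ch).
case: mdelta => [[[[[[q' ws] wm] is_] im] cm] os] /=.
by case: (upd_tape w wh_ ws wm) => a b; case => -> /=.
Qed.

End Machine.

(** * Tapes as functions of the cell, and runs within a space bound *)

Definition tape_is (t : seq sym) (f : nat -> sym) := forall i, nth Blank t i = f i.

Definition updf {T : Type} (f : nat -> T) (h : nat) (s : T) : nat -> T :=
  fun i => if i == h then s else f i.

Lemma upd_tape_is t f h s m W : tape_is t f -> size t <= W -> h < W -> move_head m h < W ->
  tape_is (upd_tape t h s m).1 (updf f h s) /\ size (upd_tape t h s m).1 <= W.
Proof.
move=> tf sW hW mW; split=> [i|] /=.
  rewrite nth_cat size_set_nth nth_nseq /updf.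
  have tfi := tf i.
  case: ltnP => hi; first by rewrite nth_set_nth /= tfi.
  have ->: i == h = false by lia.
  rewrite -tfi nth_default ?if_same //; lia.
rewrite size_cat size_set_nth size_nseq; lia.
Qed.

Section Run.
Variables (M : TM) (x : seq bool) (k : nat) (c : nat -> bool).

Record descr := Descr { dq : st M; df : nat -> sym; dh : nat; dix : nat -> sym;
  di : nat; dp : nat; dout : seq sym }.

Definition at_ (W : nat) (D : descr) (C : config M) :=
  [/\ cq C = dq D, tape_is (wt C) (df D) /\ wh C = dh D,
      tape_is (itp C) (dix D) /\ ih C = di D,
      chp C = dp D /\ out C = dout D & size (wt C) <= W /\ size (itp C) <= W].

(** A description leaves the blank padding of the tapes open, so all configurations matching it are
    quantified over. [W] bounds each of the two tapes, hence the factor 2. *)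
Definition reach (W : nat) (D D' : descr) :=
  forall C, at_ W D C -> exists n, at_ W D' (iter n (step x k c) C) /\
    forall m, m <= n -> space (iter m (step x k c) C) <= 2 * W.

Lemma reach_trans W D1 D2 D3 : reach W D1 D2 -> reach W D2 D3 -> reach W D1 D3.
Proof.
move=> h1 h2 C /h1 [n [/h2 [n' [a' s']] s]]; exists (n' + n); split.
  by rewrite iterD.
move=> m hm; case: (leqP m n) => [/s //|nm].
rewrite -(subnK (ltnW nm)) iterD; apply: s'; lia.
Qed.

Lemma reach_refl W D : reach W D D.
Proof.
move=> C a; exists 0; split=> // m; rewrite leqn0 => /eqP -> /=.
case: a => _ _ _ _ []; rewrite /space; lia.
Qed.

Lemma reach_eqf W D q f f' h g g' i p o : f =1 f' -> g =1 g' ->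
  reach W D (Descr q f h g i p o) -> reach W D (Descr q f' h g' i p o).
Proof.
move=> e1 e2 hr C /hr [n [[a1 [a2 a2'] [a3 a3'] a4 a5] s]]; exists n; split=> //.
by split=> //; split=> // j; rewrite -?e1 -?e2 ?a2 ?a3.
Qed.

(** The transition is demanded for every tape [t] with contents [g], because the input symbol
    depends on the index tape as a whole, through [idx_val]. *)
Lemma reach_step W q f h g i p o q' ws wm is_ im cm os f' g' :
  h < W -> i < W -> move_head wm h < W -> move_head im i < W ->
  halting M q = false ->
  (forall t, tape_is t g ->
   delta M q (nth Blank (enc x k) (idx_val t)) (f h) (g i) (choice_sym c p)
   = (q', ws, wm, is_, im, cm, os)) ->
  updf f h ws =1 f' -> updf g i is_ =1 g' ->
  reach W (Descr q f h g i p o)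
    (Descr q' f' (move_head wm h) g' (move_head im i) (move_head cm p)
       (if os is Some s then rcons o s else o)).
Proof.
move=> hW iW hW' iW' nh dE e1 e2 [q1 w wh_ it ih_ ch o1] [/= -> [tf ->] [tg ->] [-> ->] [s1 s2]].
have [u1 u2] := upd_tape_is ws tf s1 hW hW'.
have [v1 v2] := upd_tape_is is_ tg s2 iW iW'.
exists 1; split=> [|m hm].
  rewrite /= nh tf tg dE //=.
  split=> //=; split=> //.
    by move=> j; rewrite -e1 -u1.
  by move=> j; rewrite -e2 -v1.
have {hm}: m = 0 \/ m = 1 by lia.
case=> -> /=; rewrite /space /=; first lia.
rewrite nh tf tg dE //=.
by move: u2 v2 => /=; lia.
Qed.

End Run.

(** * Binary registers on the tapes *)

Definition tsym (b : seq bool) (i : nat) : sym :=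
  if i < size b then bsym (nth false b i) else Blank.

Fixpoint bval (b : seq bool) : nat := if b is a :: s then a + 2 * bval s else 0.

Lemma bsym_S1 b : isS1 (bsym b) = b. Proof. by case: b. Qed.

Lemma tsym_S1 b i : isS1 (tsym b i) = nth false b i.
Proof. by rewrite /tsym; case: ltnP => h; [rewrite bsym_S1|rewrite nth_default]. Qed.

Lemma bval_sum b n : size b <= n -> \sum_(i < n) (nth false b i * 2 ^ i) = bval b.
Proof.
elim: b n => [|a s IH] n hn.
  by rewrite big1 // => i _; rewrite nth_nil.
case: n hn => // n hn; rewrite big_ord_recl /= muln1; congr (_ + _).
rewrite -(IH n) // big_distrr /=; apply: eq_bigr => i _.
by rewrite /= expnS mulnCA.
Qed.

Lemma idx_val_tsym t b : tape_is t (tsym b) -> idx_val t = bval b.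
Proof.
move=> tb; rewrite -(@bval_sum b (size t)).
  apply: eq_bigr => i _; rewrite tb -tsym_S1.
  by case: tsym; rewrite /= ?mul1n ?mul0n.
rewrite leqNgt; apply/negP => h; have := tb (size t).
by rewrite nth_default // /tsym h; case: nth.
Qed.

Fixpoint opf (k : opk) (b : seq bool) : seq bool * bool :=
  match b with
  | [::] => if k is OInc then ([:: true], true) else ([::], false)
  | a :: s =>
    match act k (bsym a) with
    | (s', None) => (isS1 s' :: (opf k s).1, (opf k s).2)
    | (s', Some f) => (isS1 s' :: s, f)
    end
  end.

Lemma opf_inc b : bval (opf OInc b).1 = (bval b).+1.
Proof. by elim: b => [|[] s IH] //=; rewrite ?IH; lia. Qed.

(** Leading zeros left by decrements are reused: the list grows only if all its bits are one, and
    then its value is already [2 ^ size b - 1]. *)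
Lemma opf_inc_size b L : size b <= L -> (bval b).+1 < 2 ^ L -> size (opf OInc b).1 <= L.
Proof.
elim: b L => [|[] s IH] [|L] //= h1 h2; rewrite expnS in h2; apply: IH => //; lia.
Qed.

Lemma opf_dec b : 0 < bval b -> bval (opf ODec b).1 = (bval b).-1.
Proof. by elim: b => [|[] s IH] //= h; rewrite ?IH; lia. Qed.

Lemma opf_dec_size b : size (opf ODec b).1 = size b.
Proof. by elim: b => [|[] s IH] //=; rewrite IH. Qed.

Lemma opf_tst b : opf OTst b = (b, 0 < bval b).
Proof. elim: b => [|[] s IH] //=; rewrite IH /=; congr pair; lia. Qed.

(* Cell 0 of the work tape marks the left end; bit i of register r, 1 <= r <= R, is in cell i * R + r.
   Register 0 is the index tape: during its operations the work head moves in lockstep, so that the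
   marker also detects the left end of the index tape. *)
Definition wcell (R : nat) (bt : nat -> seq bool) (j : nat) : sym :=
  if j is j'.+1 then tsym (bt (j' %% R).+1) (j' %/ R) else Sep.

Lemma wcell_cell R bt i r : 0 < r <= R -> wcell R bt (i * R + r) = tsym (bt r) i.
Proof.
case: r => // r hr; have R0 : 0 < R by lia.
by rewrite addnS /= modnMDl modn_small ?divnMDl ?divn_small ?addn0.
Qed.

Lemma wcell_notSep R bt j : 0 < j -> wcell R bt j <> Sep.
Proof. by case: j => // j _ /=; rewrite /tsym; case: ifP => // _; case: nth. Qed.

Lemma wcell_ext R bt bt' : (forall r, 0 < r <= R -> bt r = bt' r) -> 0 < R ->
  wcell R bt =1 wcell R bt'.
Proof. by move=> e R0 [|j] //=; rewrite e // ltn_mod. Qed.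

Lemma updf_id (T : Type) (f : nat -> T) h : updf f h (f h) =1 f.
Proof. by move=> i; rewrite /updf; case: eqP => // ->. Qed.

Lemma updf_eq (T : Type) (f : nat -> T) h s : updf f h s h = s.
Proof. by rewrite /updf eqxx. Qed.

Lemma updf_neq (T : Type) (f : nat -> T) h s i : i != h -> updf f h s i = f i.
Proof. by rewrite /updf => /negbTE ->. Qed.

Lemma wcell_upd R bt r pre suf s' suf' : 0 < r <= R ->
  updf (tsym (pre ++ suf)) (size pre) s' =1 tsym (pre ++ suf') ->
  updf (wcell R (updf bt r (pre ++ suf))) (size pre * R + r) s'
    =1 wcell R (updf bt r (pre ++ suf')).
Proof.
move=> hr e j; rewrite /updf; case: eqP => [->|hj].
  by rewrite wcell_cell // eqxx -e updf_eq.
case: j hj => [|j] hj //=; case: eqP => // er.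
rewrite -e updf_neq //; apply/eqP => ej; apply: hj.
by rewrite -ej -er addnS -divn_eq.
Qed.

Lemma tsym_upd pre a b s : updf (tsym (pre ++ a :: s)) (size pre) (bsym b) =1 tsym (pre ++ b :: s).
Proof.
move=> i; rewrite /updf /tsym !size_cat /=; case: eqP => [->|hi].
  by rewrite nth_cat ltnn subnn /= ifT //; lia.
case: ifP => // h; rewrite !nth_cat; case: ltnP => // h'.
by case e: (i - size pre) => [|m] //=; lia.
Qed.

Lemma tsym_upd_nil pre b : updf (tsym (pre ++ [::])) (size pre) (bsym b) =1 tsym (pre ++ [:: b]).
Proof.
move=> i; rewrite /updf /tsym !size_cat /=; case: eqP => [->|hi].
  by rewrite nth_cat ltnn subnn /= ifT //; lia.
rewrite addn0 addn1 ltnS cats0; case: ltnP => h; last by rewrite ifF //; lia.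
by rewrite ltnW // nth_cat h.
Qed.

Lemma tsym_upd_blank pre : updf (tsym (pre ++ [::])) (size pre) Blank =1 tsym (pre ++ [::]).
Proof.
by move=> i; rewrite /updf /tsym cats0; case: eqP => // ->; rewrite ltnn.
Qed.

Lemma tsym_at pre s : tsym (pre ++ s) (size pre) = if s is a :: _ then bsym a else Blank.
Proof.
rewrite /tsym size_cat nth_cat ltnn subnn; case: s => [|a s] /=; first by rewrite addn0 ltnn.
by rewrite ifT //; lia.
Qed.

Section Ops.
Variables (R : nat) (code : seq instr) (x : seq bool) (k : nat) (c : nat -> bool) (W : nat).
Hypothesis R0 : 0 < R.
Notation M := (machine R code).
Notation reachM := (@reach M x k c W).
Notation D := (@Descr M).

Section OneOp.
Variables (pc : 'I_(size code).+1) (r : nat) (kd : opk) (l0 l1 : nat).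
Hypothesis fpc : fetch code pc = IOp r kd l0 l1.
Variables (p : nat) (o : seq sym).

Lemma walk j f h g i : j <= R -> h + j < W -> i < W ->
  reachM (D (pc, inl (inord j)) f h g i p o) (D (pc, inl (inord 0)) f (h + j) g i p o).
Proof.
elim: j h => [|j IH] h hj hW iW; first by rewrite addn0; apply: reach_refl.
rewrite addnS -addSn; apply: (@reach_trans _ _ _ _ _ _ (D (pc, inl (inord j)) f h.+1 g i p o)).
  apply: (@reach_step M x k c W _ f h g i p o _ (f h) MR (g i) MS MS None) => //=; try lia.
  - by rewrite /mhalt /= fpc.
  - by move=> t tg; rewrite fpc inordK ?ltnS.
  - exact: updf_id.
  - exact: updf_id.
by apply: IH; lia.
Qed.

(** [pre] holds the bits already passed, so that the induction on the remaining ones keeps the whole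
    register in view. Getting from one bit of the register to the next takes [R] moves, one with the
    operation and [R.-1] in a phase [inl]. *)
Lemma loop_work suf pre bt g : 0 < r <= R -> (size pre + size suf).+1 * R + r < W ->
  exists2 h', h' < W &
  reachM (D (pc, inl (inord 0)) (wcell R (updf bt r (pre ++ suf))) (size pre * R + r) g 0 p o)
    (D (pc, inr (opf kd suf).2) (wcell R (updf bt r (pre ++ (opf kd suf).1))) h' g 0 p o).
Proof.
move=> hr; elim: suf pre => [|a s IH] pre hW.
  exists (size pre * R + r); first by move: hW; rewrite /= addn0 mulSn; lia.
  apply: (@reach_step M x k c W _ _ _ g 0 p o _ (if kd is OInc then S1 else Blank) MS (g 0) MS MS None) => //=; try lia.
  - by rewrite /mhalt /= fpc.
  - move=> t tg; rewrite fpc inordK ?ltnS //= wcell_cell // updf_eq tsym_at.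
    by case: (r) hr => //; case: (kd).
  - case: (kd) => /=.
    + by apply: wcell_upd => //; apply: (tsym_upd_nil pre true).
    + by apply: wcell_upd => //; exact: tsym_upd_blank.
    + by apply: wcell_upd => //; exact: tsym_upd_blank.
  - exact: updf_id.
have rW : size pre * R + r < W by move: hW; rewrite /= addnS !mulSn mulnDl; lia.
have rW' : (size pre * R + r).+1 + R.-1 < W.
  by move: hW; rewrite /= addnS !mulSn mulnDl; lia.
case ea: (act kd (bsym a)) => [s' [b|]].
  rewrite /= ea; exists (size pre * R + r) => //.
  have es' : s' = bsym (isS1 s') by case: (kd) (a) ea => [] [] [] <-.
  apply: (@reach_step M x k c W _ _ _ g 0 p o _ s' MS (g 0) MS MS None) => //=; try lia.
  - by rewrite /mhalt /= fpc.
  - move=> t tg; rewrite fpc inordK ?ltnS //= wcell_cell // updf_eq tsym_at ea.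
    by case: (r) hr.
  - by apply: wcell_upd => //; rewrite {1}es'; apply: tsym_upd.
  - exact: updf_id.
have es' : s' = bsym (isS1 s') by case: (kd) (a) ea => [] [] [] // <-.
have [|h' h'W IH'] := IH (rcons pre (isS1 s')).
  by rewrite size_rcons /= addSnnS.
rewrite !cat_rcons size_rcons in IH'.
exists h' => //; rewrite /= ea /=.
apply: reach_trans IH'.
apply: (@reach_trans _ _ _ _ _ _ (D (pc, inl (inord R.-1)) (wcell R (updf bt r (pre ++ isS1 s' :: s))) (size pre * R + r).+1 g 0 p o)).
  apply: (@reach_step M x k c W _ _ _ g 0 p o _ s' MR (g 0) MS MS None) => //=; try lia.
  - by rewrite /mhalt /= fpc.
  - move=> t tg; rewrite fpc inordK ?ltnS //= wcell_cell // updf_eq tsym_at ea.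
    by case: (r) hr.
  - by apply: wcell_upd => //; rewrite {1}es'; apply: tsym_upd.
  - exact: updf_id.
have -> : (size pre).+1 * R + r = (size pre * R + r).+1 + R.-1 by rewrite mulSn; lia.
by apply: walk; lia.
Qed.

Lemma loop_index suf pre bt : r = 0 -> size pre + size suf < W.-1 ->
  exists2 h', h' < W &
  reachM (D (pc, inl (inord 0)) (wcell R bt) (size pre) (tsym (pre ++ suf)) (size pre) p o)
    (D (pc, inr (opf kd suf).2) (wcell R bt) h' (tsym (pre ++ (opf kd suf).1)) h' p o).
Proof.
move=> hr; elim: suf pre => [|a s IH] pre hW.
  exists (size pre); first by move: hW => /=; lia.
  apply: (@reach_step M x k c W _ _ _ _ _ p o _ _ MS (if kd is OInc then S1 else Blank) MS MS None) => //=; try (move: hW => /=; lia).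
  - by rewrite /mhalt /= fpc.
  - move=> t tg; rewrite fpc inordK ?ltnS //= hr /= tsym_at.
    by case: (kd).
  - exact: updf_id.
  - case: (kd) => /=.
    + by apply: (tsym_upd_nil pre true).
    + exact: tsym_upd_blank.
    + exact: tsym_upd_blank.
case ea: (act kd (bsym a)) => [s' [b|]].
  rewrite /= ea; exists (size pre) => //; first by move: hW => /=; lia.
  have es' : s' = bsym (isS1 s') by case: (kd) (a) ea => [] [] [] <-.
  apply: (@reach_step M x k c W _ _ _ _ _ p o _ _ MS s' MS MS None) => //=; try (move: hW => /=; lia).
  - by rewrite /mhalt /= fpc.
  - by move=> t tg; rewrite fpc inordK ?ltnS //= hr tsym_at ea.
  - exact: updf_id.
  - by rewrite {1}es'; apply: tsym_upd.
have es' : s' = bsym (isS1 s') by case: (kd) (a) ea => [] [] [] // <-.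
have [|h' h'W IH'] := IH (rcons pre (isS1 s')).
  by rewrite size_rcons /= addSnnS.
rewrite !cat_rcons size_rcons in IH'.
exists h' => //; rewrite /= ea /=.
apply: reach_trans IH'.
apply: (@reach_step M x k c W _ _ _ _ _ p o _ _ MR s' MR MS None) => //=; try (move: hW => /=; lia).
- by rewrite /mhalt /= fpc.
- by move=> t tg; rewrite fpc inordK ?ltnS //= hr tsym_at ea.
- exact: updf_id.
- by rewrite {1}es'; apply: tsym_upd.
Qed.

(** A left move at cell 0 stays there; hence [i <= h] ensures that the index head is at 0 by the
    time the work head meets the marker. *)
Lemma back b bt g h i : h < W -> i <= h ->
  reachM (D (pc, inr b) (wcell R bt) h g i p o)
    (D (start R code (if b then l1 else l0)) (wcell R bt) 0 g 0 p o).
Proof.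
elim: h i => [|h IH] i hW hi.
  have -> : i = 0 by lia.
  apply: (@reach_step M x k c W _ _ _ _ _ p o _ Sep MS (g 0) MS MS None) => //=.
  - by rewrite /mhalt /= fpc.
  - by move=> t tg; rewrite fpc.
  - exact: (updf_id (wcell R bt) 0).
  - exact: updf_id.
apply: reach_trans (IH i.-1 _ _); try lia.
apply: (@reach_step M x k c W _ _ _ _ _ p o _ (wcell R bt h.+1) ML (g i) ML MS None) => //=; try lia.
- by rewrite /mhalt /= fpc.
- move=> t tg; rewrite fpc.
  have /= := @wcell_notSep R bt h.+1 (ltn0Sn _).
  by case: tsym.
- exact: (updf_id (wcell R bt) h.+1).
- exact: updf_id.
Qed.

Lemma op_ok bt : r <= R -> (size (bt r)).+2 * R + r < W ->
  reachM (D (pc, inl (inord r)) (wcell R bt) 0 (tsym (bt 0)) 0 p o)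
    (D (start R code (if (opf kd (bt r)).2 then l1 else l0))
      (wcell R (updf bt r (opf kd (bt r)).1)) 0
      (tsym (updf bt r (opf kd (bt r)).1 0)) 0 p o).
Proof.
move=> rR hW; case: (posnP r) => r0.
  have [|h' h'W /= hl] := @loop_index (bt r) [::] bt r0.
    by move: hW; rewrite r0 /= addn0 mulSn; move: R0; case: R => // R' _; rewrite mulnS; lia.
  have [bt0 _] : (opf kd (bt r)).1 = updf bt r (opf kd (bt r)).1 0 /\ true by rewrite r0.
  apply: (@reach_eqf _ _ _ _ _ _ _ (wcell R bt) _ _ (tsym (opf kd (bt r)).1)).
  - apply: wcell_ext => // r' hr'; rewrite updf_neq //; lia.
  - by rewrite -bt0.
  have {1}-> : bt 0 = bt r by rewrite r0.
  rewrite {1}r0; apply: reach_trans hl _.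
  by apply: back.
have rr : 0 < r <= R by lia.
have [|h' h'W /= hl] := @loop_work (bt r) [::] bt (tsym (bt 0)) rr.
  by move: hW; rewrite /= !mulSn; lia.
have -> : updf bt r (opf kd (bt r)).1 0 = bt 0 by rewrite updf_neq //; lia.
apply: (reach_trans (@walk r _ 0 _ 0 _ _ _)); try (move: hW; lia).
have hb := @back (opf kd (bt r)).2 (updf bt r (opf kd (bt r)).1) (tsym (bt 0)) h' 0 h'W (leq0n h').
apply: reach_trans hb; apply: reach_trans hl.
move=> C hC; have := @reach_refl M x k c W _ C.
move=> h0; apply: h0; case: hC => a1 [a2 a2'] a3 a4 a5.
by split=> //; split=> // j; rewrite a2; apply: wcell_ext => // r' _; rewrite /updf; case: eqP => [->|].
Qed.

End OneOp.
End Ops.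

(** * Structured commands and their compilation *)

Inductive cmd :=
| Skip
| Inc (r : nat)
| Dec (r : nat)
| Seq (a b : cmd)
| If (r : nat) (a b : cmd)
| While (r : nat) (a : cmd)
| CaseIn (s : sym) (a b : cmd)
| Guess (a b : cmd)
| Out (s : sym).

(** [B] bounds the register values and thereby the space; only [Inc] can violate it, so only [EInc]
    has a premise on it. [p] is the number of choice cells entered so far: cell [p.+1], which
    [Guess] enters, holds the bit [ch p]. *)
Inductive exec (inp : nat -> sym) (ch : nat -> bool) (B : nat) :
  cmd -> (nat -> nat) -> nat -> seq sym -> (nat -> nat) -> nat -> seq sym -> Prop :=
| ESkip rho p o : exec inp ch B Skip rho p o rho p o
| EInc r rho p o : rho r < B ->
    exec inp ch B (Inc r) rho p o (updf rho r (rho r).+1) p o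
| EDec r rho p o : exec inp ch B (Dec r) rho p o (updf rho r (rho r).-1) p o
| ESeq a b rho p o rho1 p1 o1 rho2 p2 o2 :
    exec inp ch B a rho p o rho1 p1 o1 -> exec inp ch B b rho1 p1 o1 rho2 p2 o2 ->
    exec inp ch B (Seq a b) rho p o rho2 p2 o2
| EIf r a b rho p o rho1 p1 o1 :
    exec inp ch B (if 0 < rho r then a else b) rho p o rho1 p1 o1 ->
    exec inp ch B (If r a b) rho p o rho1 p1 o1
| EWhile0 r a rho p o : rho r = 0 -> exec inp ch B (While r a) rho p o rho p o
| EWhile r a rho p o rho1 p1 o1 rho2 p2 o2 : 0 < rho r ->
    exec inp ch B a rho p o rho1 p1 o1 ->
    exec inp ch B (While r a) rho1 p1 o1 rho2 p2 o2 ->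
    exec inp ch B (While r a) rho p o rho2 p2 o2
| ECase s a b rho p o rho1 p1 o1 :
    exec inp ch B (if symn (inp (rho 0)) == symn s then a else b) rho p o rho1 p1 o1 ->
    exec inp ch B (CaseIn s a b) rho p o rho1 p1 o1
| EGuess a b rho p o rho1 p1 o1 :
    exec inp ch B (if ch p then a else b) rho p.+1 o rho1 p1 o1 ->
    exec inp ch B (Guess a b) rho p o rho1 p1 o1
| EOut s rho p o : exec inp ch B (Out s) rho p o rho p (rcons o s).

Lemma exec_le inp ch B c rho p o rho' p' o' : exec inp ch B c rho p o rho' p' o' ->
  (forall r, rho r <= B) -> forall r, rho' r <= B.
Proof.
elim=> {c rho p o rho' p' o'} //; try by move=> *; auto.
- by move=> r rho p o h hr r'; rewrite /updf; case: eqP.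
- move=> r rho p o hr r'; rewrite /updf; case: eqP => // _.
  exact: leq_trans (leq_pred _) (hr r).
Qed.

Fixpoint maxreg (c : cmd) : nat :=
  match c with
  | Skip => 0 | Inc r => r | Dec r => r
  | Seq a b => maxn (maxreg a) (maxreg b)
  | If r a b => maxn r (maxn (maxreg a) (maxreg b))
  | While r a => maxn r (maxreg a)
  | CaseIn _ a b => maxn (maxreg a) (maxreg b)
  | Guess a b => maxn (maxreg a) (maxreg b)
  | Out _ => 0
  end.

(** Labels are absolute, [l] being the address of the first instruction. An unconditional jump is an
    [ICh] with equal targets. [Dec] tests first, since a borrow running through a zero register
    would turn its bits into ones. *)
Fixpoint comp (c : cmd) (l : nat) : seq instr :=
  let branch i l a b :=
    let A := comp a l.+1 in
    let B := comp b (l.+2 + size A) in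
    i (l.+2 + size A) l.+1 ::
    (A ++ ICh (l.+2 + size A + size B) (l.+2 + size A + size B) :: B) in
  match c with
  | Skip => [::]
  | Inc r => [:: IOp r OInc l.+1 l.+1]
  | Dec r => [:: IOp r OTst l.+2 l.+1; IOp r ODec l.+2 l.+2]
  | Seq a b => let A := comp a l in A ++ comp b (l + size A)
  | If r a b => branch (IOp r OTst) l a b
  | While r a =>
    let A := comp a l.+1 in IOp r OTst (l.+2 + size A) l.+1 :: rcons A (ICh l l)
  | CaseIn s a b => branch (IIn s) l a b
  | Guess a b => ICm l.+1 :: branch ICh l.+1 a b
  | Out s => [:: IOut s l.+1]
  end.

Section Comp.
Variables (R : nat) (code : seq instr) (x : seq bool) (k : nat) (c : nat -> bool) (B Lb : nat).
Hypothesis R0 : 0 < R.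
Hypothesis BL : B < 2 ^ Lb.
Let W := Lb.+4 * R.
Notation M := (machine R code).
Notation reachM := (@reach M x k c W).
Notation D := (@Descr M).
Let inp := nth Blank (enc x k).

Definition code_at l L := exists pre post, code = pre ++ L ++ post /\ size pre = l.

Lemma code_at_cat l A A' : code_at l (A ++ A') -> code_at l A /\ code_at (l + size A) A'.
Proof.
case=> pre [post [e <-]]; split; first by exists pre, (A' ++ post); rewrite e !catA.
by exists (pre ++ A), post; rewrite e size_cat !catA.
Qed.

Lemma code_at_cons l i L : code_at l (i :: L) -> fetch code l = i /\ l < size code /\ code_at l.+1 L.
Proof.
case=> pre [post [e <-]]; split; first by rewrite /fetch e nth_cat ltnn subnn.
split; first by rewrite e size_cat /= addnS ltnS leq_addr.
by exists (rcons pre i), post; rewrite e size_rcons cat_rcons.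
Qed.

Definition repr (rho : nat -> nat) (bt : nat -> seq bool) :=
  forall r, r <= R -> bval (bt r) = rho r /\ size (bt r) <= Lb.

Definition D' l bt p o := D (start R code l) (wcell R bt) 0 (tsym (bt 0)) 0 p o.

Lemma W0 : 0 < W. Proof. by rewrite /W muln_gt0. Qed.

Lemma fetch_inord l : l < size code -> fetch code (inord l : 'I_(size code).+1) = fetch code l.
Proof. by move=> h; rewrite inordK // ltnS ltnW. Qed.

Lemma op_reach l r kd l0 l1 bt p o : l < size code -> fetch code l = IOp r kd l0 l1 ->
  r <= R -> size (bt r) <= Lb ->
  reachM (D' l bt p o)
   (D' (if (opf kd (bt r)).2 then l1 else l0) (updf bt r (opf kd (bt r)).1) p o).
Proof.
move=> hl fl rR sb; rewrite {1}/D' {1}/start fl.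
apply: op_ok => //; first by rewrite fetch_inord.
by rewrite /W !mulSn; have : size (bt r) * R <= Lb * R := leq_mul sb (leqnn R); lia.
Qed.

Lemma simple_reach l bt p o l' cm os :
  l < size code -> halting M (start R code l) = false ->
  (forall t, tape_is t (tsym (bt 0)) ->
   mdelta (start R code l) (inp (bval (bt 0))) Sep (tsym (bt 0) 0) (choice_sym c p)
   = (start R code l', Sep, MS, tsym (bt 0) 0, MS, cm, os)) ->
  reachM (D' l bt p o) (D' l' bt (move_head cm p) (if os is Some s then rcons o s else o)).
Proof.
move=> hl nh dE.
apply: (@reach_step M x k c W _ _ 0 _ 0 p o _ Sep MS (tsym (bt 0) 0) MS cm os) => //=.
- exact: W0.
- exact: W0.
- exact: W0.
- exact: W0.
- by move=> t tg; rewrite (idx_val_tsym tg); exact: dE tg.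
- exact: (updf_id (wcell R bt) 0).
- exact: updf_id.
Qed.

Lemma jmp_reach l l' bt p o : l < size code -> fetch code l = ICh l' l' ->
  reachM (D' l bt p o) (D' l' bt p o).
Proof.
move=> hl fl; apply: (@simple_reach l bt p o l' MS None) => //=.
  by rewrite /mhalt /= fetch_inord // fl.
by move=> t tg; rewrite fetch_inord // fl if_same.
Qed.

Lemma repr_upd rho bt r b v : repr rho bt -> bval b = v -> size b <= Lb ->
  repr (updf rho r v) (updf bt r b).
Proof. by move=> h hv hs i iR; rewrite /updf; case: eqP => // _; apply: h. Qed.

Lemma D'_ext l bt bt' p o D1 : bt =1 bt' -> reachM D1 (D' l bt p o) -> reachM D1 (D' l bt' p o).
Proof.
move=> e; rewrite /D' -e; apply: reach_eqf => //.
by apply: wcell_ext.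
Qed.

Lemma tst_reach l r l0 l1 bt p o rho : l < size code -> fetch code l = IOp r OTst l0 l1 ->
  r <= R -> repr rho bt ->
  reachM (D' l bt p o) (D' (if 0 < rho r then l1 else l0) bt p o).
Proof.
move=> hl fl rR hb; have [e s] := hb _ rR.
have := @op_reach _ _ _ _ _ _ p o hl fl rR s; rewrite opf_tst /= e.
by apply: D'_ext => i; rewrite /updf; case: eqP => // ->.
Qed.

(** The induction is on the execution, not on the command: after its body a [While] executes the
    same code at the same address. The bit lists [bt'] are existential because values do not
    determine the leading zeros. *)
Lemma comp_ok cm rho p o rho' p' o' : exec inp c B cm rho p o rho' p' o' ->
  forall l bt, code_at l (comp cm l) -> maxreg cm <= R -> repr rho bt ->
  exists bt', repr rho' bt' /\
    reachM (D' l bt p o) (D' (l + size (comp cm l)) bt' p' o').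
Proof.
elim=> {cm rho p o rho' p' o'}.
- move=> rho p o l bt _ _ hb; exists bt; split=> //; rewrite addn0; exact: reach_refl.
- move=> r rho p o rB l bt /code_at_cons [fl [hl _]] /= rR hb.
  have [e s] := hb _ rR.
  exists (updf bt r (opf OInc (bt r)).1); split.
    apply: repr_upd => //; first by rewrite opf_inc e.
    by apply: opf_inc_size => //; rewrite e; lia.
  by have := @op_reach _ _ _ _ _ _ p o hl fl rR s; rewrite addn1; case: ifP.
- move=> r rho p o l bt /code_at_cons [fl [hl /code_at_cons [fl' [hl' _]]]] /= rR hb.
  have [e s] := hb _ rR.
  have ht := @tst_reach _ _ _ _ _ p o _ hl fl rR hb; rewrite addn2.
  case: posnP ht => r0 ht.
    exists bt; split=> // i iR; rewrite /updf; case: eqP => [->|_]; last exact: hb.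
    by rewrite r0; case: (hb _ rR) => ->.
  exists (updf bt r (opf ODec (bt r)).1); split.
    apply: repr_upd => //; first by rewrite opf_dec e.
    by rewrite opf_dec_size.
  apply: reach_trans ht _.
  by have := @op_reach _ _ _ _ _ _ p o hl' fl' rR s; case: ifP.
- move=> a b rho p o rho1 p1 o1 rho2 p2 o2 _ IHa _ IHb l bt /= /code_at_cat [ha hb'].
  rewrite geq_max => /andP [ra rb] hb.
  have [bt1 [h1 r1]] := IHa _ _ ha ra hb.
  have [bt2 [h2 r2]] := IHb _ _ hb' rb h1.
  exists bt2; split=> //; rewrite size_cat addnA.
  exact: reach_trans r1 r2.
- move=> r a b rho p o rho1 p1 o1 _ IH l bt /= /code_at_cons [fl [hl /code_at_cat [ha /code_at_cons [fj [hj hb']]]]].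
  rewrite !geq_max => /and3P [rR ra rb] hb.
  have ht := @tst_reach _ _ _ _ _ p o _ hl fl rR hb.
  have es : l + (size (comp a l.+1 ++ ICh (l.+2 + size (comp a l.+1) + size (comp b (l.+2 + size (comp a l.+1)))) (l.+2 + size (comp a l.+1) + size (comp b (l.+2 + size (comp a l.+1))))
     :: comp b (l.+2 + size (comp a l.+1)))).+1
    = l.+2 + size (comp a l.+1) + size (comp b (l.+2 + size (comp a l.+1))).
    by rewrite size_cat /=; lia.
  rewrite es; case: posnP IH ht => r0 IH ht.
    rewrite addSn in hb'.
    have [bt1 [h1 r1]] := IH _ _ hb' rb hb.
    exists bt1; split=> //; exact: reach_trans ht r1.
  have [bt1 [h1 r1]] := IH _ _ ha ra hb.
  exists bt1; split=> //; apply: reach_trans ht _; apply: reach_trans r1 _.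
  exact: jmp_reach.
- by move=> r a rho p o r0 l bt /= /code_at_cons [fl [hl _]]; rewrite geq_max => /andP [rR ra] hb;
  exists bt; split=> //; have := @tst_reach _ _ _ _ _ p o _ hl fl rR hb; rewrite r0 size_rcons addnS addSn addnS.
- move=> r a rho p o rho1 p1 o1 rho2 p2 o2 r0 _ IHa _ IHw l bt hw hm hb.
  move: (hw) (hm) => /= /code_at_cons [fl [hl]]; rewrite -cats1 => /code_at_cat [ha /code_at_cons [fj [hj _]]].
  rewrite geq_max => /andP [rR ra].
  have ht := @tst_reach _ _ _ _ _ p o _ hl fl rR hb; rewrite r0 in ht.
  have [bt1 [h1 r1]] := IHa _ _ ha ra hb.
  have [bt2 [h2 r2]] := IHw _ _ hw hm h1.
  exists bt2; split=> //; apply: reach_trans ht _; apply: reach_trans r1 _.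
  apply: reach_trans (@jmp_reach _ l bt1 p1 o1 hj fj) _.
  by rewrite cats1; exact: r2.
- move=> s a b rho p o rho1 p1 o1 _ IH l bt /= /code_at_cons [fl [hl /code_at_cat [ha /code_at_cons [fj [hj hb']]]]].
  rewrite !geq_max => /andP [ra rb] hb.
  have [e0 _] := hb 0 (leq0n R).
  have ht : reachM (D' l bt p o) (D' (if symn (inp (rho 0)) == symn s then l.+1 else l.+2 + size (comp a l.+1)) bt p o).
    rewrite -e0; apply: (@simple_reach l bt p o _ MS None) => //=.
      by rewrite /mhalt /= fetch_inord // fl.
    by move=> t tg; rewrite fetch_inord // fl.
  have es : l + (size (comp a l.+1 ++ ICh (l.+2 + size (comp a l.+1) + size (comp b (l.+2 + size (comp a l.+1)))) (l.+2 + size (comp a l.+1) + size (comp b (l.+2 + size (comp a l.+1))))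
     :: comp b (l.+2 + size (comp a l.+1)))).+1
    = l.+2 + size (comp a l.+1) + size (comp b (l.+2 + size (comp a l.+1))).
    by rewrite size_cat /=; lia.
  rewrite es; case: ifP IH ht => r0 IH ht; last first.
    rewrite addSn in hb'.
    have [bt1 [h1 r1]] := IH _ _ hb' rb hb.
    exists bt1; split=> //; exact: reach_trans ht r1.
  have [bt1 [h1 r1]] := IH _ _ ha ra hb.
  exists bt1; split=> //; apply: reach_trans ht _; apply: reach_trans r1 _.
  exact: jmp_reach.
- move=> a b rho p o rho1 p1 o1 _ IH l bt /= /code_at_cons [fm [hm /code_at_cons [fl [hl /code_at_cat [ha /code_at_cons [fj [hj hb']]]]]]].
  rewrite !geq_max => /andP [ra rb] hb.
  have h0 : reachM (D' l bt p o) (D' l.+1 bt p.+1 o).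
    by apply: (@simple_reach l bt p o l.+1 MR None) => //; rewrite /= ?/mhalt /= fetch_inord // fm.
  have {h0} ht : reachM (D' l bt p o) (D' (if c p then l.+2 else l.+3 + size (comp a l.+2)) bt p.+1 o).
    apply: reach_trans h0 _.
    apply: (@simple_reach l.+1 bt p.+1 o _ MS None) => //; rewrite /= ?/mhalt /= fetch_inord // fl //.
    by move=> t tg; rewrite bsym_S1.
  set jl := _ + size (comp b _) in fj *.
  have es : l + (size (comp a l.+2 ++ ICh jl jl :: comp b (l.+3 + size (comp a l.+2)))).+2 = jl.
    by rewrite /jl size_cat /=; lia.
  rewrite es; case: ifP IH ht => r0 IH ht; last first.
    rewrite addSn in hb'.
    have [bt1 [h1 r1]] := IH _ _ hb' rb hb.
    exists bt1; split=> //; exact: reach_trans ht r1.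
  have [bt1 [h1 r1]] := IH _ _ ha ra hb.
  exists bt1; split=> //; apply: reach_trans ht _; apply: reach_trans r1 _.
  exact: jmp_reach.
- move=> s rho p o l bt /code_at_cons [fl [hl _]] _ hb.
  exists bt; split=> //; rewrite addn1.
  apply: (@simple_reach l bt p o _ MS (Some s)) => //; rewrite /= ?/mhalt /= fetch_inord // fl //.
Qed.

End Comp.

(** * Halting runs and the machine of a command *)

Lemma step_halt (M : TM) x k c (C : config M) : halting M (cq C) -> step x k c C = C.
Proof. by case: C => q w wh_ it ih_ ch o /= ->. Qed.

Lemma run_halt (M : TM) x k c n m : halting M (cq (run M x k c n)) -> n <= m ->
  run M x k c m = run M x k c n.
Proof.
move=> h /subnK <-; elim: (m - n) => // d IH.
by rewrite addSn {1}/run iterS -/(run _ _ _ _ _) IH step_halt.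
Qed.

Lemma run_chp_le (M : TM) x k c n m : read_once M -> n <= m ->
  chp (run M x k c n) <= chp (run M x k c m).
Proof.
move=> ro /subnK <-; elim: (m - n) => // d IH.
by rewrite addSn; apply: leq_trans IH (ro _ _ _ _).
Qed.

(** The choice head never moves back, so the furthest cell visited is the one under the head at the
    end, and the conditions on visited cells shrink to one equality. *)
Lemma acc_path_halt (M : TM) x k w n : read_once M ->
  halting M (cq (run M x k (ext w) n)) ->
  acc_path M x k w <->
  accepting M (cq (run M x k (ext w) n)) /\ chp (run M x k (ext w) n) = size w.
Proof.
move=> ro hn; split.
  case=> n' [h' [a' [hle [m [mn' hm]]]]].
  have en : run M x k (ext w) n' = run M x k (ext w) n.
    by case: (leqP n n') => [/run_halt -> //|/ltnW/run_halt ->].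
  rewrite -en; split=> //; apply/eqP; rewrite eqn_leq hle //= -hm.
  exact: run_chp_le.
case=> a e; exists n; split=> //; split=> //; split; last by exists n.
by move=> m hm; rewrite -e; apply: run_chp_le.
Qed.

(** Register 1 carries the verdict; the successor in the machine's number of registers guarantees
    that it exists. *)
Definition full (cm : cmd) : seq instr :=
  let l := (size (comp cm 1)).+1 in
  IMark 1 :: comp cm 1 ++ [:: IOp 1 OTst l.+1 l.+2; IHalt false; IHalt true].

Definition cmdTM (cm : cmd) : TM := machine (maxreg cm).+1 (full cm).

Theorem cmdTM_ok cm x k c B rho' p' o' :
  exec (nth Blank (enc x k)) c B cm (fun _ => 0) 0 [::] rho' p' o' ->
  exists n, let C := run (cmdTM cm) x k c n in
    [/\ halting _ (cq C), accepting _ (cq C) = (0 < rho' 1), chp C = p', out C = o' &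
     forall m, space (run (cmdTM cm) x k c m) <= 10 * (maxreg cm).+1 * (trunc_log 2 B).+1].
Proof.
set R := (maxreg cm).+1; set Lb := (trunc_log 2 B).+1 => hex.
have BL : B < 2 ^ Lb by apply: trunc_log_ltn.
have R0 : 0 < R by [].
have W0 := W0 Lb R0.
have := erefl (Lb.+4 * R); set W := {1}(Lb.+4 * R) => eW; rewrite -eW in W0.
set l := (size (comp cm 1)).+1.
have h0 : code_at (full cm) 0 (IMark 1 :: comp cm 1 ++ [:: IOp 1 OTst l.+1 l.+2; IHalt false; IHalt true]) by exists [::], [::]; rewrite cats0.
case/code_at_cons: (h0) => fm [hm /code_at_cat [hc /code_at_cons [ft [ht /code_at_cons [f0 [hl0 /code_at_cons [f1 [hl1 _]]]]]]]].
pose bt := fun _ : nat => [::] : seq bool.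
have rb : repr R Lb (fun _ => 0) bt by [].
have [bt' [rb' r1]] := comp_ok R0 BL hex hc (leqnSn _) rb.
have r0 : reach x k c W (@Descr (cmdTM cm) (start R (full cm) 0) (fun _ => Blank) 0 (fun _ => Blank) 0 0 [::])
   (D' R (full cm) 1 bt 0 [::]).
  apply: (@reach_step (cmdTM cm) x k c W _ _ 0 _ 0 0 [::] _ Sep MS Blank MS MS None) => //=.
  - by rewrite /mhalt /= inordK.
  - by move=> t tg; rewrite inordK.
  - by case=> [|i] //; rewrite /updf /= /bt /tsym /=.
  - by move=> i; rewrite /updf /tsym /=; case: eqP.
have r2 := @tst_reach R (full cm) x k c B Lb R0 BL _ _ _ _ bt' p' o' rho' ht ft isT rb'.
rewrite -eW in r1 r2.
have r3 := reach_trans (reach_trans r0 r1) r2.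
have a0 : at_ W (@Descr (cmdTM cm) (start R (full cm) 0) (fun _ => Blank) 0 (fun _ => Blank) 0 0 [::]) (init (cmdTM cm)).
  by split=> //; split=> // -[|[|i]].
have {r0 r1 r2 r3 a0} [n [a s]] := r3 _ a0.
case: a => a1 _ _ [a4 a5] _; rewrite -/(run (cmdTM cm) x k c n) in a1 a4 a5.
rewrite add1n -/l in f0 f1 hl0 hl1.
have hn : halting (cmdTM cm) (cq (run (cmdTM cm) x k c n)).
  rewrite a1 /= /mhalt /=; case: ifP => _; rewrite inordK ?f0 ?f1 //; exact: ltnW.
exists n; split=> //.
  rewrite a1 /= /macc /=; case: ifP => _; rewrite inordK ?f0 ?f1 //; exact: ltnW.
move=> m; case: (leqP m n) => mn.
  (* [2 * W = 2 * (Lb + 4) * R] is at most [10 * R * Lb], as [Lb] is positive. *)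
  apply: leq_trans (s m mn) _; rewrite /W /Lb; nia.
rewrite (run_halt hn (ltnW mn)); apply: leq_trans (s n (leqnn n)) _; rewrite /W /Lb; nia.
Qed.

(** * Functions with polynomially bounded intermediate values *)

(** Total correctness of commands that neither guess nor write. *)
Variant runs (inp : nat -> sym) (B : nat) (c : cmd) (rho : nat -> nat)
    (Q : (nat -> nat) -> Prop) : Prop :=
  Runs of (forall r, rho r <= B) -> forall ch p o,
    exists rho', exec inp ch B c rho p o rho' p o /\ Q rho'.

Section Runs.
Variables (inp : nat -> sym) (B : nat).
Notation runs := (runs inp B).

Lemma runs_seq a b rho Q : runs a rho (fun rho1 => runs b rho1 Q) -> runs (Seq a b) rho Q.
Proof.
case=> h; split=> le ch p o; have [rho1 [e1 [h1]]] := h le ch p o.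
have [rho2 [e2 h2]] := h1 (exec_le e1 le) ch p o.
by exists rho2; split=> //; exact: ESeq e1 e2.
Qed.

Lemma runs_conseq a rho (Q Q' : (nat -> nat) -> Prop) :
  runs a rho Q' -> (forall rho', Q' rho' -> Q rho') -> runs a rho Q.
Proof. by case=> h hQ; split=> le ch p o; have [r [e h']] := h le ch p o; exists r; split; auto. Qed.

Lemma runs_le a rho Q : ((forall r, rho r <= B) -> runs a rho Q) -> runs a rho Q.
Proof. by move=> h; split=> le; case: (h le); apply. Qed.

Lemma runs_inc r rho (Q : (nat -> nat) -> Prop) :
  rho r < B -> Q (updf rho r (rho r).+1) -> runs (Inc r) rho Q.
Proof. by move=> h q; split=> le ch p o; eexists; split; [exact: EInc|]. Qed.

Lemma runs_dec r rho (Q : (nat -> nat) -> Prop) :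
  Q (updf rho r (rho r).-1) -> runs (Dec r) rho Q.
Proof. by move=> q; split=> le ch p o; eexists; split; [exact: EDec|]. Qed.

Lemma runs_skip rho (Q : (nat -> nat) -> Prop) : Q rho -> runs Skip rho Q.
Proof. by move=> q; split=> le ch p o; eexists; split; [exact: ESkip|]. Qed.

Lemma runs_case s a b rho Q :
  runs (if symn (inp (rho 0)) == symn s then a else b) rho Q -> runs (CaseIn s a b) rho Q.
Proof.
case=> h; split=> le ch p o; have [r [e q]] := h le ch p o.
by exists r; split=> //; apply: ECase.
Qed.

(** The index of the invariant counts the iterations still to come and so serves as the variant. *)
Lemma runs_while r a (I : nat -> (nat -> nat) -> Prop) :
  (forall rho, I 0 rho -> rho r = 0) ->
  (forall n rho, I n.+1 rho -> 0 < rho r /\ runs a rho (I n)) ->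
  forall n rho, I n rho -> runs (While r a) rho (I 0).
Proof.
move=> h0 hS; elim=> [|n IH] rho hI; split=> le ch p o.
  by exists rho; split=> //; apply: EWhile0; exact: h0.
have [r0 [h1]] := hS _ _ hI; have [rho1 [e1 q1]] := h1 le ch p o.
have [h2] := IH _ q1; have [rho2 [e2 q2]] := h2 (exec_le e1 le) ch p o.
by exists rho2; split=> //; exact: EWhile e1 e2.
Qed.

Definition clear r := While r (Dec r).

Lemma runs_clear r rho :
  runs (clear r) rho (fun rho' => forall i, rho' i = if i == r then 0 else rho i).
Proof.
apply: (@runs_while r _ (fun n rho' => forall i, rho' i = if i == r then n else rho i) _ _ (rho r)).
- by move=> rho' h; rewrite h eqxx.
- move=> n rho' h; rewrite h eqxx; split=> //.
  by apply: runs_dec => i; rewrite /updf; case: eqP => [_|/eqP/negbTE hi]; rewrite !h ?eqxx ?hi.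
- by move=> i; case: eqP => // ->.
Qed.

Definition move r d := Seq (clear d) (While r (Seq (Dec r) (Inc d))).

Ltac upd_auto h := move=> i; rewrite /updf !h;
  repeat (case: eqP => [?|?]; subst); try lia; congruence.

Lemma runs_move r d rho : r != d ->
  runs (move r d) rho (fun rho' =>
    forall i, rho' i = if i == d then rho r else if i == r then 0 else rho i).
Proof.
move=> rd; apply: runs_le => le; apply: runs_seq; apply: (runs_conseq (runs_clear _ _)) => rho1 h1.
apply: runs_conseq; first
  apply: (@runs_while r _ (fun n rho' => n <= rho r /\ forall i, rho' i =
    if i == d then rho r - n else if i == r then n else rho i) _ _ (rho r)).
- by move=> rho' [_ h]; rewrite h (negbTE rd) eqxx.
- move=> n rho' [hn h]; rewrite h (negbTE rd) eqxx; split=> //.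
  apply: runs_seq; apply: runs_dec; apply: runs_inc.
    by have := le r; rewrite /updf eq_sym (negbTE rd) h eqxx; lia.
  by split; [lia|]; upd_auto h.
- by split=> // i; rewrite h1; repeat (case: eqP => [?|?]; subst); lia.
- by move=> rho' [_ h] i; rewrite h subn0.
Qed.

(** Loops consume their counter; the second copy in [t] is there to restore [r]. *)
Definition copy r d t :=
  Seq (clear d) (Seq (clear t) (Seq (While r (Seq (Dec r) (Seq (Inc d) (Inc t))))
    (While t (Seq (Dec t) (Inc r))))).

Lemma runs_copy r d t rho : r != d -> r != t -> d != t ->
  runs (copy r d t) rho (fun rho' =>
    forall i, rho' i = if i == d then rho r else if i == t then 0 else rho i).
Proof.
move=> rd rt dt; apply: runs_le => le.
apply: runs_seq; apply: (runs_conseq (runs_clear _ _)) => rho1 h1.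
apply: runs_seq; apply: (runs_conseq (runs_clear _ _)) => rho2 h2.
apply: runs_seq; apply: runs_conseq; first
  apply: (@runs_while r _ (fun n rho' => n <= rho r /\ forall i, rho' i =
    if i == d then rho r - n else if i == t then rho r - n else if i == r then n else rho i) _ _ (rho r)).
- by move=> rho' [_ h]; rewrite h (negbTE rd) (negbTE rt) eqxx.
- move=> n rho' [hn h]; rewrite h (negbTE rd) (negbTE rt) eqxx; split=> //.
  have ler := le r.
  apply: runs_seq; apply: runs_dec; apply: runs_seq; apply: runs_inc.
    by rewrite /updf eq_sym (negbTE rd) h eqxx; lia.
  apply: runs_inc.
    by rewrite /updf ![t == _]eq_sym (negbTE rt) (negbTE dt) h eq_sym (negbTE dt) eqxx; lia.
  by split; [lia|]; upd_auto h.
- by split=> // i; rewrite h2 h1; repeat (case: eqP => [?|?]; subst); lia.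
move=> rho3 [_ h3]; apply: runs_conseq; first
  apply: (@runs_while t _ (fun n rho' => n <= rho r /\ forall i, rho' i =
    if i == d then rho r else if i == t then n else if i == r then rho r - n else rho i) _ _ (rho r)).
- by move=> rho' [_ h]; rewrite h eq_sym (negbTE dt) eqxx.
- move=> n rho' [hn h]; rewrite h eq_sym (negbTE dt) eqxx; split=> //.
  have ler := le r.
  apply: runs_seq; apply: runs_dec; apply: runs_inc.
    by rewrite /updf (negbTE rt) h (negbTE rd) (negbTE rt) eqxx; lia.
  by split; [lia|]; upd_auto h.
- by split=> // i; rewrite h3 !subn0 subnn; repeat (case: eqP => [?|?]; subst); lia.
- by move=> rho' [_ h] i; rewrite h subn0; repeat (case: eqP => [?|?]; subst).
Qed.

End Runs.

(** * The class of polynomially bounded register functions *)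

Definition mx (v : seq nat) : nat := foldr maxn 0 v.

Lemma leq_expl m n e : m <= n -> m ^ e <= n ^ e.
Proof. by move=> h; elim: e => // e IH; rewrite !expnS leq_mul. Qed.

Definition fn := (nat -> sym) -> seq nat -> nat.

(* The arguments are in the registers regs, the result goes to register top, registers above top are
   scratch; register 0 is the input address. *)
Definition computes (f : fn) (code : seq nat -> nat -> cmd) (e : nat) :=
  forall inp B regs top rho,
    all (fun r => 0 < r < top) regs -> 0 < top ->
    (mx [seq rho r | r <- regs]).+2 ^ e <= B ->
    runs inp B (code regs top) rho (fun rho' =>
      rho' top = f inp [seq rho r | r <- regs] /\ forall r, 0 < r < top -> rho' r = rho r).

(** Composition needs a bound on the values as well, since they become arguments. The base
    [(mx v).+2] is at least 2, so exponents may be enlarged and constants absorbed. *)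
Definition L (f : fn) : Prop :=
  exists code e, (forall inp v, f inp v <= (mx v).+2 ^ e) /\ computes f code e.

Lemma computes_up f code e e' : e <= e' -> computes f code e -> computes f code e'.
Proof.
move=> ee h inp B regs top rho hr ht hB; apply: h => //.
by apply: leq_trans hB; rewrite leq_exp2l.
Qed.

Lemma L_ext f g : (forall inp v, f inp v = g inp v) -> L f -> L g.
Proof.
move=> e [code [n [hb h]]]; exists code, n; split=> [inp v|]; first by rewrite -e.
move=> inp B regs top rho hr ht hB; apply: (runs_conseq (h _ _ _ _ _ hr ht hB)).
by move=> rho' [-> ?].
Qed.

Lemma mx_nth v i : nth 0 v i <= mx v.
Proof. by elim: v i => [|a v IH] [|i] //=; rewrite leq_max ?leqnn // IH orbT. Qed.

Lemma mx_behead v : mx (behead v) <= mx v.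
Proof. by case: v => //= a v; rewrite leq_max leqnn orbT. Qed.

Lemma L_proj i : L (fun _ v => nth 0 v i).
Proof.
exists (fun regs top => if i < size regs then copy (nth 0 regs i) top top.+1 else clear top), 1.
split=> [inp v|inp B regs top rho hr ht hB].
  by rewrite expn1; have := mx_nth v i; lia.
case: ltnP => hi.
  have /andP [h1 h2] := all_nthP 0 hr i hi.
  apply: runs_conseq; first by apply: runs_copy; lia.
  move=> rho' h; rewrite h eqxx (nth_map 0) //; split=> // r hr'.
  by rewrite h !ifF //; lia.
apply: (runs_conseq (runs_clear _ _ _ _)) => rho' h.
rewrite h eqxx nth_default ?size_map //; split=> // r hr'.
by rewrite h ifF //; lia.
Qed.

Lemma L_succ f : L f -> L (fun inp v => (f inp v).+1).
Proof.
case=> code [e [hb hf]].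
exists (fun regs top => Seq (code regs top) (Inc top)), e.+1.
have hb' inp v : f inp v < (mx v).+2 ^ e.+1.
  apply: leq_ltn_trans (hb inp v) _; rewrite expnS; have := expn_gt0 (mx v).+2 e; nia.
split=> [inp v|inp B regs top rho hr ht hB]; first exact: hb'.
apply: runs_seq; move: (computes_up (leqnSn e) hf) => {}hf; apply: (runs_conseq (hf _ _ _ _ _ hr ht hB)) => rho' [h1 h2].
apply: runs_inc; first by rewrite h1; exact: leq_trans (hb' _ _) hB.
rewrite updf_eq h1; split=> // r hr'; rewrite updf_neq ?h2 //; lia.
Qed.

Lemma L_pred f : L f -> L (fun inp v => (f inp v).-1).
Proof.
case=> code [e [hb hf]].
exists (fun regs top => Seq (code regs top) (Dec top)), e.
split=> [inp v|inp B regs top rho hr ht hB]; first exact: leq_trans (leq_pred _) (hb inp v).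
apply: runs_seq; apply: (runs_conseq (hf _ _ _ _ _ hr ht hB)) => rho' [h1 h2].
apply: runs_dec; rewrite updf_eq h1; split=> // r hr'; rewrite updf_neq ?h2 //; lia.
Qed.

Lemma L_const n : L (fun _ _ => n).
Proof.
elim: n => [|n IH]; last exact: L_succ IH.
exists (fun regs top => clear top), 0; split=> // inp B regs top rho hr ht hB.
apply: (runs_conseq (runs_clear _ _ _ _)) => rho' h; rewrite h eqxx; split=> // r hr'.
by rewrite h ifF //; lia.
Qed.

Lemma L_behead f : L f -> L (fun inp v => f inp (behead v)).
Proof.
case=> code [e [hb hf]]; exists (fun regs => code (behead regs)), e.
split=> [inp v|inp B regs top rho hr ht hB].
  apply: leq_trans (hb _ _) _; apply: leq_expl => //=.
  by have := mx_behead v; lia.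
rewrite behead_map; apply: hf => //; first by case: (regs) hr => //= a s /andP [].
apply: leq_trans hB; rewrite -behead_map; apply: leq_expl => //.
have := mx_behead [seq rho r | r <- regs]; lia.
Qed.

(** Moving the value to register 0 puts it on the index tape, where it addresses the input. The
    exponent grows by 2 to make room for the symbol numbers up to 3. *)
Lemma L_inp f : L f -> L (fun inp v => symn (inp (f inp v))).
Proof.
case=> code [e [hb hf]].
exists (fun regs top => Seq (code regs top) (Seq (move top 0) (Seq (clear top)
  (CaseIn Blank Skip (Seq (Inc top) (CaseIn S0 Skip (Seq (Inc top) (CaseIn S1 Skip (Inc top))))))))), e.+2.
split=> [inp v|inp B regs top rho hr ht hB].
  have : symn (inp (f inp v)) <= 2 ^ 2 by case: (inp _).
  move/leq_trans; apply; rewrite !expnS mulnA.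
  by have := expn_gt0 (mx v).+2 e; nia.
have B3 : 3 < B.
  apply: leq_trans hB; rewrite !expnS mulnA.
  by have := expn_gt0 (mx [seq rho r | r <- regs]).+2 e; nia.
apply: runs_seq; move: (computes_up (leq_addl 2 e) hf) => {}hf; apply: (runs_conseq (hf _ _ _ _ _ hr ht hB)) => rho1 [h1 h1'].
apply: runs_seq; apply: runs_conseq; first by apply: runs_move; lia.
move=> rho2 h2; apply: runs_seq; apply: (runs_conseq (runs_clear _ _ _ _)) => rho3 h3.
have e0 : rho3 0 = f inp [seq rho r | r <- regs] by rewrite h3 ifF ?h2 ?h1 //; lia.
have et : rho3 top = 0 by rewrite h3 eqxx.
have er r : 0 < r < top -> rho3 r = rho r.
  by move=> hr'; rewrite h3 h2 !ifF ?h1' //; lia.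
have ne m : updf rho3 top m 0 = rho3 0 by rewrite updf_neq //; lia.
have fin m : m = symn (inp (rho3 0)) ->
  (forall g, g =1 updf rho3 top m -> g top = symn (inp (f inp [seq rho r | r <- regs])) /\ forall r, 0 < r < top -> g r = rho r).
  move=> -> g eg; rewrite eg updf_eq -e0; split=> // r hr'; rewrite eg updf_neq ?er //; lia.
apply: runs_case; case: eqP => e1.
  by apply: runs_skip; apply: (fin 0) => //; rewrite -et => i; rewrite updf_id.
apply: runs_seq; apply: runs_inc; rewrite et; first lia.
apply: runs_case; rewrite ne; case: eqP => e2.
  by apply: runs_skip; apply: (fin 1).
apply: runs_seq; apply: runs_inc; rewrite updf_eq; first lia.
apply: runs_case; rewrite updf_neq ?ne; last lia.
case: eqP => e3.
  apply: runs_skip; apply: (fin 2) => // i.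
  by rewrite /updf; case: eqP.
apply: runs_inc; first by rewrite updf_eq; lia.
apply: (fin 3).
  by move: e1 e2 e3; case: (inp _).
by move=> i; rewrite /updf eqxx; case: eqP.
Qed.

Fixpoint allL (fs : seq fn) : Prop := if fs is f :: fs' then L f /\ allL fs' else True.

Lemma mx_leP v M : (forall i, nth 0 v i <= M) -> mx v <= M.
Proof.
elim: v => //= a v IH h; rewrite geq_max (h 0) /=; apply: IH => i; exact: (h i.+1).
Qed.

Lemma L_list fs : allL fs -> exists code e,
  (forall inp v, mx [seq f inp v | f <- fs] <= (mx v).+2 ^ e) /\
  forall inp B regs top rho,
    all (fun r => 0 < r < top) regs -> 0 < top ->
    (mx [seq rho r | r <- regs]).+2 ^ e <= B ->
    runs inp B (code regs top) rho (fun rho' =>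
      [seq rho' r | r <- iota top (size fs)] = [seq f inp [seq rho r | r <- regs] | f <- fs]
      /\ forall r, 0 < r < top -> rho' r = rho r).
Proof.
elim: fs => [_|f fs IH [[code [e [hb hf]]] /IH [codes [es [hbs hfs]]]]].
  exists (fun _ _ => Skip), 0; split=> // *; exact: runs_skip.
exists (fun regs top => Seq (code regs top) (codes regs top.+1)), (maxn e es).
split=> [inp v|inp B regs top rho hr ht hB].
  rewrite /= geq_max; apply/andP; split.
    by apply: leq_trans (hb _ _) _; rewrite leq_exp2l // leq_maxl.
  by apply: leq_trans (hbs _ _) _; rewrite leq_exp2l // leq_maxr.
apply: runs_seq; move: (computes_up (leq_maxl e es) hf) => {}hf; apply: (runs_conseq (hf _ _ _ _ _ hr ht hB)) => rho1 [h1 h1'].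
have er : [seq rho1 r | r <- regs] = [seq rho r | r <- regs].
  by apply/eq_in_map => r rr; apply: h1'; exact: (allP hr).
have hr' : all (fun r => 0 < r < top.+1) regs.
  by apply: sub_all hr => r; lia.
have hB' : (mx [seq rho1 r | r <- regs]).+2 ^ es <= B.
  by rewrite er; apply: leq_trans hB; rewrite leq_exp2l // leq_maxr.
apply: (runs_conseq (hfs _ _ _ _ _ hr' (ltn0Sn _) hB')) => rho2 [h2 h2'].
split=> [|r hr0]; first by rewrite /= h2 er h2' ?h1 //; lia.
rewrite h2' ?h1' //; lia.
Qed.

Lemma mx_exp_exp m e1 e2 n : n <= m.+2 ^ e1 -> n.+2 ^ e2 <= m.+2 ^ (e1.+2 * e2).
Proof.
move=> h; rewrite expnM; apply: leq_expl => //.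
rewrite !expnS; have := expn_gt0 m.+2 e1; nia.
Qed.

Lemma L_comp g fs : L g -> allL fs -> L (fun inp v => g inp [seq f inp v | f <- fs]).
Proof.
case=> code [e [hb hg]] /L_list [codes [es [hbs hfs]]].
exists (fun regs top => Seq (codes regs top)
  (Seq (code (iota top (size fs)) (top + size fs).+1) (move (top + size fs).+1 top))), (es + es.+2 * e).
split=> [inp v|inp B regs top rho hr ht hB].
  apply: leq_trans (hb _ _) _; apply: leq_trans (mx_exp_exp _ (hbs _ _)) _.
  by rewrite leq_exp2l // leq_addl.
apply: runs_seq; apply: runs_conseq.
  apply: hfs hr ht _; apply: leq_trans hB; by rewrite leq_exp2l // leq_addr.
move=> rho1 [h1 h1']; apply: runs_seq; apply: runs_conseq.
  apply: hg => //.
    by apply/allP => r; rewrite mem_iota; lia.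
  rewrite h1; apply: leq_trans (mx_exp_exp _ (hbs _ _)) _; apply: leq_trans hB.
  by rewrite leq_exp2l // leq_addl.
move=> rho2 [h2 h2']; apply: runs_conseq; first by apply: runs_move; lia.
move=> rho3 h3; rewrite h3 eqxx h2 h1; split=> // r hr'.
rewrite h3 !ifF ?h2' ?h1' //; lia.
Qed.

Definition PB (f : fn) := exists e, forall inp v, f inp v <= (mx v).+2 ^ e.

Lemma L_PB f : L f -> PB f.
Proof. by case=> code [e [h _]]; exists e. Qed.

(** The bound [bd] has to be polynomial but not computable: it serves the estimate of the registers
    and does not occur in the code. Register [top] counts down, [top.+1] counts up, [top.+2] holds
    the value of the recursion. *)
Lemma L_rec (cnt z s bd : fn) (F : (nat -> sym) -> seq nat -> nat -> nat) :
  L cnt -> L z -> L s -> PB bd ->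
  (forall inp v, F inp v 0 = z inp v) ->
  (forall inp v i, F inp v i.+1 = s inp [:: F inp v i, i & v]) ->
  (forall inp v i, i <= cnt inp v -> F inp v i <= bd inp v) ->
  L (fun inp v => F inp v (cnt inp v)).
Proof.
case=> cc [ec [hbc hc]] [cz [ez [hbz hz]]] [cs [es [hbs hs]]] [eb hbb] F0 FS Fb.
pose E := ec + eb.
exists (fun regs top => Seq (cc regs top) (Seq (clear top.+1) (Seq (cz regs top.+2)
  (Seq (While top (Seq (cs [:: top.+2, top.+1 & regs] top.+3)
     (Seq (move top.+3 top.+2) (Seq (Inc top.+1) (Dec top)))))
   (move top.+2 top))))), (ec + ez + eb + E.+3 * es).
split=> [inp v|inp B regs top rho hr ht hB].
  apply: leq_trans (Fb _ _ _ (leqnn _)) _; apply: leq_trans (hbb _ _) _.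
  rewrite leq_exp2l //; lia.
have hB' e : e <= ec + ez + eb + E.+3 * es -> (mx [seq rho r | r <- regs]).+2 ^ e <= B.
  by move=> he; apply: leq_trans hB; rewrite leq_exp2l.
set v := [seq rho r | r <- regs] in hB hB' *.
have eqv rho' : (forall r, 0 < r < top -> rho' r = rho r) -> [seq rho' r | r <- regs] = v.
  by move=> h; apply/eq_in_map => r rr; apply: h; exact: (allP hr).
set N := cnt inp v.
have NB : N <= B by apply: leq_trans (hbc _ _) _; apply: hB'; lia.
apply: runs_seq; apply: runs_conseq.
  apply: hc => //; apply: hB'; lia.
move=> rho1 [h1 h1']; apply: runs_seq; apply: (runs_conseq (runs_clear _ _ _ _)) => rho2 h2.
have e2 r : 0 < r < top -> rho2 r = rho r by move=> hr'; rewrite h2 ifF ?h1' //; lia.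
apply: runs_seq; apply: runs_conseq.
  apply: hz => //; first by apply: sub_all hr => r; lia.
  by rewrite eqv //; apply: hB'; lia.
rewrite eqv // => rho3 [h3 h3'].
apply: runs_seq; apply: runs_conseq; first
  apply: (@runs_while inp B top _ (fun n rho' => n <= N /\ rho' top = n /\ rho' top.+1 = N - n /\
     rho' top.+2 = F inp v (N - n) /\ forall r, 0 < r < top -> rho' r = rho r) _ _ N).
- by move=> rho' [_ [-> _]].
- move=> n rho' [nN [r0 [r1 [r2 rr]]]]; split; first by rewrite r0.
  have em : [seq rho' r | r <- [:: top.+2, top.+1 & regs]] = [:: F inp v (N - n.+1), N - n.+1 & v].
    by rewrite /= r1 r2 eqv.
  apply: runs_seq; apply: runs_conseq.
    apply: hs => //.
      by rewrite /= !ltnS leqnn leqnSn /=; apply: sub_all hr => r; lia.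
    rewrite em; have : mx [:: F inp v (N - n.+1), N - n.+1 & v] <= (mx v).+2 ^ E.+1.
      rewrite /= !geq_max; apply/and3P; split.
      + apply: leq_trans (Fb _ _ _ (leq_subr _ _)) _; apply: leq_trans (hbb _ _) _.
        by rewrite leq_exp2l // /E; lia.
      + apply: leq_trans (leq_subr _ _) _; apply: leq_trans (hbc _ _) _.
        by rewrite leq_exp2l // /E; lia.
      + by rewrite expnS; have := expn_gt0 (mx v).+2 E; nia.
    move/mx_exp_exp => h; apply: leq_trans (h es) _; apply: hB'; lia.
  rewrite em -FS; move=> rho4 [h4 h4'].
  have -> : N - n = (N - n.+1).+1 by lia.
  apply: runs_seq; apply: runs_conseq; first by apply: runs_move; lia.
  move=> rho5 h5.
  have e51 : rho5 top.+1 = N - n.+1 by rewrite h5 !ifF ?h4' //; lia.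
  apply: runs_seq; apply: runs_inc; first by rewrite e51; lia.
  apply: runs_dec; split; first exact: ltnW.
  have e50 : rho5 top = n.+1 by rewrite h5 !ifF ?h4' //; lia.
  rewrite updf_eq updf_neq; last lia.
  rewrite e50; split=> //; split.
    by rewrite updf_neq ?updf_eq ?e51 //; lia.
  split.
    by rewrite !updf_neq; try lia; rewrite h5 eqxx.
  by move=> r hr'; rewrite !updf_neq; try lia; rewrite h5 !ifF ?h4' ?rr //; lia.
- split=> //; split; first by rewrite h3' ?h2 ?ifF ?h1 //; lia.
  split; first by rewrite h3' ?h2 ?eqxx ?subnn //; lia.
  split; first by rewrite h3 subnn F0.
  by move=> r hr'; rewrite h3' ?e2 //; lia.
move=> rho4 [_ [r0 [r1 [r2 rr]]]]; apply: runs_conseq; first by apply: runs_move; lia.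
move=> rho5 h5; rewrite h5 eqxx r2 subn0; split=> // r hr'.
by rewrite h5 !ifF ?rr //; lia.
Qed.

Local Notation "v # i" := (nth 0 v i) (at level 2, i at level 1, format "v # i").

(** * Closure under arithmetic, tests, bounded sums and bounded quantifiers *)

Lemma PB_mul f g : PB f -> PB g -> PB (fun inp v => f inp v * g inp v).
Proof.
by move=> [e he] [e' he']; exists (e + e') => inp v; rewrite expnD leq_mul.
Qed.

Lemma PB_add f g : PB f -> PB g -> PB (fun inp v => f inp v + g inp v).
Proof.
move=> [e he] [e' he']; exists (e + e').+1 => inp v; rewrite expnS expnD.
have := he inp v; have := he' inp v.
have := expn_gt0 (mx v).+2 e; have := expn_gt0 (mx v).+2 e'.
rewrite /=; move: (_ ^ e) (_ ^ e') => a b; nia.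
Qed.

Lemma PB_const n : PB (fun _ _ => n).
Proof. exact/L_PB/L_const. Qed.

Lemma PB_mx : PB (fun _ v => mx v).
Proof. by exists 1 => inp v; rewrite expn1; lia. Qed.

Lemma PB_exp f e : PB f -> PB (fun inp v => (f inp v).+2 ^ e).
Proof.
by move=> [e' he']; exists (e'.+2 * e) => inp v; apply: mx_exp_exp.
Qed.

Create HintDb L.
Ltac L_tac := auto 40 with L nocore.

#[export] Hint Extern 1 (L (fun _ v => nth 0 v _)) => (exact: L_proj) : L.
#[export] Hint Extern 4 (L (fun _ _ => _)) => (exact: L_const) : L.
#[export] Hint Extern 1 (L _) => assumption : L.
#[export] Hint Resolve L_succ L_pred L_inp : L.

Lemma L_add f g : L f -> L g -> L (fun inp v => f inp v + g inp v).
Proof.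
move=> hf hg.
apply: (@L_rec g f (fun _ w => (w#0).+1) (fun inp v => f inp v + g inp v)
  (fun inp v i => f inp v + i)) => //; L_tac.
- by apply: PB_add; apply: L_PB.
- by move=> inp v; rewrite addn0.
- by move=> inp v i; rewrite addnS.
- by move=> inp v i hi; rewrite leq_add2l.
Qed.
#[export] Hint Resolve L_add : L.

Lemma L_sub f g : L f -> L g -> L (fun inp v => f inp v - g inp v).
Proof.
move=> hf hg.
apply: (@L_rec g f (fun _ w => (w#0).-1) f (fun inp v i => f inp v - i)) => //; L_tac.
- exact: L_PB.
- by move=> inp v; rewrite subn0.
- by move=> inp v i; rewrite /= subnS.
- by move=> inp v i hi; rewrite leq_subr.
Qed.
#[export] Hint Resolve L_sub : L.

Lemma L_behead2 f : L f -> L (fun inp v => f inp (behead (behead v))).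
Proof. by move=> h; apply: (@L_behead (fun inp v => f inp (behead v))); apply: L_behead. Qed.
#[export] Hint Extern 2 (L (fun inp v => _ inp (behead (behead v)))) => (apply: L_behead2) : L.
#[export] Hint Extern 2 (L (fun inp v => _ inp (behead v))) => (apply: L_behead) : L.

#[export] Hint Extern 2 (L (fun _ v => nth 0 (behead v) _)) =>
  (exact: (L_behead (L_proj _))) : L.
#[export] Hint Extern 2 (L (fun _ v => nth 0 (behead (behead v)) _)) =>
  (exact: (L_behead2 (L_proj _))) : L.
#[export] Hint Extern 2 (L (fun _ v => nth 0 (behead (behead (behead v))) _)) =>
  (exact: (L_behead (L_behead2 (L_proj _)))) : L.

Lemma L_mul f g : L f -> L g -> L (fun inp v => f inp v * g inp v).
Proof.
move=> hf hg.
apply: (@L_rec g (fun _ _ => 0) (fun inp w => w#0 + f inp (behead (behead w))) (fun inp v => f inp v * g inp v)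
  (fun inp v i => f inp v * i)) => //; L_tac.
- by apply: PB_mul; apply: L_PB.
- by move=> inp v; rewrite muln0.
- by move=> inp v i; rewrite mulnSr.
- by move=> inp v i hi; rewrite leq_mul2l hi orbT.
Qed.
#[export] Hint Resolve L_mul : L.

Lemma L_leq f g : L f -> L g -> L (fun inp v => nat_of_bool (f inp v <= g inp v)).
Proof.
move=> hf hg; apply: (@L_ext (fun inp v => 1 - (f inp v - g inp v))); last by L_tac.
by move=> inp v; case: leqP; lia.
Qed.
#[export] Hint Resolve L_leq : L.

Lemma L_eq f g : L f -> L g -> L (fun inp v => nat_of_bool (f inp v == g inp v)).
Proof.
move=> hf hg; apply: (@L_ext (fun inp v => (f inp v <= g inp v) * (g inp v <= f inp v))); last by L_tac.
by move=> inp v; lia.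
Qed.
#[export] Hint Resolve L_eq : L.

Definition bfn := (nat -> sym) -> seq nat -> bool.
Notation LB f := (L (fun inp v => nat_of_bool (f inp v))).

Lemma L_neg (f : bfn) : LB f -> L (fun inp v => nat_of_bool (~~ f inp v)).
Proof.
move=> hf; apply: (@L_ext (fun inp v => 1 - f inp v)); last by L_tac.
by move=> inp v; case: (f inp v).
Qed.
#[export] Hint Resolve L_neg : L.

Lemma L_and (f g : bfn) : LB f -> LB g -> L (fun inp v => nat_of_bool (f inp v && g inp v)).
Proof.
move=> hf hg; apply: (@L_ext (fun inp v => f inp v * g inp v)); last by L_tac.
by move=> inp v; case: (f inp v); case: (g inp v).
Qed.
#[export] Hint Resolve L_and : L.

Lemma L_or (f g : bfn) : LB f -> LB g -> L (fun inp v => nat_of_bool (f inp v || g inp v)).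
Proof.
move=> hf hg; apply: (@L_ext (fun inp v => 1 <= f inp v + g inp v)); last by L_tac.
by move=> inp v; case: (f inp v); case: (g inp v).
Qed.
#[export] Hint Resolve L_or : L.

Lemma L_if (c : bfn) f g : LB c -> L f -> L g ->
  L (fun inp v => if c inp v then f inp v else g inp v).
Proof.
move=> hc hf hg.
apply: (@L_ext (fun inp v => c inp v * f inp v + (~~ c inp v) * g inp v)); last by L_tac.
by move=> inp v; case: (c inp v); rewrite /= ?mul1n ?mul0n ?addn0.
Qed.
#[export] Hint Resolve L_if : L.

Lemma L_ifb (c f g : bfn) : LB c -> LB f -> LB g ->
  L (fun inp v => nat_of_bool (if c inp v then f inp v else g inp v)).
Proof.
move=> hc hf hg; apply: (@L_ext (fun inp v => if c inp v then nat_of_bool (f inp v) else nat_of_bool (g inp v))); last by L_tac.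
by move=> inp v; case: (c inp v).
Qed.
#[export] Hint Resolve L_ifb : L.

Lemma L_sum cnt b : L cnt -> L b -> L (fun inp v => \sum_(i < cnt inp v) b inp (nat_of_ord i :: v)).
Proof.
move=> hc hb; have [eb Pb] := L_PB hb; have [ec Pc] := L_PB hc.
apply: (@L_rec cnt (fun _ _ => 0) (fun inp w => w#0 + b inp (behead w))
  (fun inp v => cnt inp v * (cnt inp v + mx v).+2 ^ eb)
  (fun inp v n => \sum_(i < n) b inp (nat_of_ord i :: v))) => //; L_tac.
- apply: PB_mul; first exact: L_PB.
  by apply: PB_exp; apply: PB_add; [exact: L_PB|exact: PB_mx].
- by move=> inp v; rewrite big_ord0.
- by move=> inp v i; rewrite big_ord_recr.
- move=> inp v i hi; apply: (@leq_trans (\sum_(j < i) (cnt inp v + mx v).+2 ^ eb)).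
    apply: leq_sum => j _; apply: leq_trans (Pb _ _) _; apply: leq_expl => /=.
    by have := ltn_ord j; lia.
  by rewrite sum_nat_const card_ord leq_mul2r hi orbT.
Qed.

Lemma has_sum (P : pred nat) n : nat_of_bool (has P (iota 0 n)) = (1 <= \sum_(i < n) P i).
Proof.
elim: n => [|n IH]; first by rewrite big_ord0.
rewrite -addn1 iotaD has_cat add0n /= orbF addn1 big_ord_recr /=.
by move: IH; case: has => /=; case: (P n) => /=; lia.
Qed.

Lemma L_has cnt (b : bfn) : L cnt -> LB b ->
  L (fun inp v => nat_of_bool (has (fun i => b inp (i :: v)) (iota 0 (cnt inp v)))).
Proof.
move=> hc hb; apply: L_ext; first by move=> inp v; rewrite has_sum.
apply: L_leq; first exact: L_const.
by apply: (@L_sum cnt (fun inp v => nat_of_bool (b inp v))).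
Qed.

Lemma L_all cnt (b : bfn) : L cnt -> LB b ->
  L (fun inp v => nat_of_bool (all (fun i => b inp (i :: v)) (iota 0 (cnt inp v)))).
Proof.
move=> hc hb; apply: (@L_ext (fun inp v => nat_of_bool (~~ has (fun i => ~~ b inp (i :: v)) (iota 0 (cnt inp v))))).
  by move=> inp v; rewrite has_predC negbK.
by apply: L_neg; apply: (@L_has cnt (fun inp v => ~~ b inp v)) => //; apply: L_neg.
Qed.

(** The quotient counts the positive multiples of [d] up to [m], which turns division into a bounded
    sum; the test [0 < d] matches division by zero giving 0. *)
Lemma divn_sum m d : m %/ d = \sum_(i < m) ((0 < d) && (i.+1 * d <= m)).
Proof.
case: (posnP d) => [->|d0]; first by rewrite divn0 big1.
rewrite (eq_bigr (fun i : 'I_m => nat_of_bool (i < m %/ d))); last first.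
  by move=> i _; rewrite /= -leq_divRL.
have := leq_div m d; move: (m %/ d) => q.
elim: m => [|m IH] hq; first by rewrite big_ord0; lia.
rewrite big_ord_recr /=; case: (leqP q m) => h; first by rewrite -IH // addn0.
have -> : q = m.+1 by lia.
rewrite (eq_bigr (fun _ => 1)); first by rewrite sum1_card card_ord; lia.
by move=> i _; have := ltn_ord i; lia.
Qed.

Lemma L_div f g : L f -> L g -> L (fun inp v => f inp v %/ g inp v).
Proof.
move=> hf hg.
(* [L_sum] prepends its index to the argument list, so the operands are first made projections, and
   [L_comp] substitutes the given functions afterwards. The same device recurs below. *)
have h : L (fun inp v => v#0 %/ v#1).
  apply: L_ext; first by move=> inp v; rewrite divn_sum.
  apply: (@L_sum (fun _ v => v#0) (fun _ v => (0 < v#2) && ((v#0).+1 * v#2 <= v#1))); L_tac.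
exact: (L_comp h (conj hf (conj hg I)) (fs := [:: f; g])).
Qed.
#[export] Hint Resolve L_div : L.

Lemma L_mod f g : L f -> L g -> L (fun inp v => f inp v %% g inp v).
Proof.
move=> hf hg; apply: (@L_ext (fun inp v => f inp v - f inp v %/ g inp v * g inp v)); last by L_tac.
by move=> inp v; rewrite {1}(divn_eq (f inp v) (g inp v)) addKn.
Qed.
#[export] Hint Resolve L_mod : L.

Lemma L_min f g : L f -> L g -> L (fun inp v => minn (f inp v) (g inp v)).
Proof.
move=> hf hg; apply: (@L_ext (fun inp v => f inp v - (f inp v - g inp v))); last by L_tac.
by move=> inp v; rewrite minnE.
Qed.
#[export] Hint Resolve L_min : L.

Lemma L_max f g : L f -> L g -> L (fun inp v => maxn (f inp v) (g inp v)).
Proof.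
move=> hf hg; apply: (@L_ext (fun inp v => f inp v + (g inp v - f inp v))); last by L_tac.
by move=> inp v; rewrite maxnE.
Qed.
#[export] Hint Resolve L_max : L.

Lemma L_table (t : seq nat) f : L f -> L (fun inp v => nth 0 t (f inp v)).
Proof.
elim: t f => [|a t IH] f hf.
  by apply: (@L_ext (fun _ _ => 0)); [move=> inp v; rewrite nth_nil|exact: L_const].
apply: (@L_ext (fun inp v => if f inp v == 0 then a else nth 0 t (f inp v).-1)).
  by move=> inp v; case: (f inp v).
by apply: L_if; L_tac.
Qed.

(** Powers are not polynomially bounded. Truncating at [T] after each multiplication keeps the
    recursion within the class and loses nothing while the power is at most [T]. *)
Fixpoint cpow (T b n : nat) : nat := if n is m.+1 then minn (cpow T b m * b) T else 1.

Lemma cpow_le T b n : cpow T b n <= T.+1.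
Proof. by case: n => //= n; apply: leq_trans (geq_minr _ _) _. Qed.

Lemma cpowE T b n : 0 < b -> b ^ n <= T -> cpow T b n = b ^ n.
Proof.
move=> b0; elim: n => //= n IH hn; rewrite IH.
  by rewrite -expnSr; apply/minn_idPl.
by apply: leq_trans hn; rewrite leq_pexp2l.
Qed.

Lemma L_cpow T b n : L T -> L b -> L n -> L (fun inp v => cpow (T inp v) (b inp v) (n inp v)).
Proof.
move=> hT hb hn.
apply: (@L_rec n (fun _ _ => 1) (fun inp w => minn (w#0 * b inp (behead (behead w))) (T inp (behead (behead w))))
  (fun inp v => T inp v + 1) (fun inp v n => cpow (T inp v) (b inp v) n)) => //; L_tac.
- by apply: PB_add; [exact: L_PB|exact: PB_const].
- by move=> inp v i _; rewrite addn1 cpow_le.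
Qed.
#[export] Hint Resolve L_cpow : L.

(** * Programs over these functions *)

Inductive prog :=
| PSkip
| PAsg (r : nat) (f : fn)
| PSeq (a b : prog)
| PIf (r : nat) (a b : prog)
| PWhile (r : nat) (a : prog)
| PGuess (r : nat)
| POut (s : sym).

Fixpoint wf (m : nat) (P : prog) : Prop :=
  match P with
  | PSkip => True
  | PAsg r f => r < m /\ L f
  | PSeq a b => wf m a /\ wf m b
  | PIf r a b => r < m /\ wf m a /\ wf m b
  | PWhile r a => r < m /\ wf m a
  | PGuess r => r < m
  | POut _ => True
  end.

Section Pexec.
Variables (inp : nat -> sym) (ch : nat -> bool) (V : nat).

(** [V] bounds the values assigned. Unlike in [L], it need not be polynomial in the arguments, and
    this is how quantities exponential in the parameter become available. *)
Inductive pexec : prog -> seq nat -> nat -> seq sym -> seq nat -> nat -> seq sym -> Prop :=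
| XSkip v p o : pexec PSkip v p o v p o
| XAsg r f v p o : f inp v <= V -> pexec (PAsg r f) v p o (set_nth 0 v r (f inp v)) p o
| XSeq a b v p o v1 p1 o1 v2 p2 o2 :
    pexec a v p o v1 p1 o1 -> pexec b v1 p1 o1 v2 p2 o2 -> pexec (PSeq a b) v p o v2 p2 o2
| XIf r a b v p o v1 p1 o1 :
    pexec (if 0 < nth 0 v r then a else b) v p o v1 p1 o1 -> pexec (PIf r a b) v p o v1 p1 o1
| XWhile0 r a v p o : nth 0 v r = 0 -> pexec (PWhile r a) v p o v p o
| XWhile r a v p o v1 p1 o1 v2 p2 o2 : 0 < nth 0 v r ->
    pexec a v p o v1 p1 o1 -> pexec (PWhile r a) v1 p1 o1 v2 p2 o2 ->
    pexec (PWhile r a) v p o v2 p2 o2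
| XGuess r v p o : pexec (PGuess r) v p o (set_nth 0 v r (ch p)) p.+1 o
| XOut s v p o : pexec (POut s) v p o v p (rcons o s).

Lemma pexec_inv P v p o v' p' o' : pexec P v p o v' p' o' ->
  match P with
  | PSeq a b => exists v1 p1 o1, pexec a v p o v1 p1 o1 /\ pexec b v1 p1 o1 v' p' o'
  | PIf r a b => pexec (if 0 < nth 0 v r then a else b) v p o v' p' o'
  | _ => True
  end.
Proof.
by case=> // a b {}v {}p {}o v1 p1 o1 v2 p2 o2 h1 h2; exists v1, p1, o1.
Qed.

Lemma XWhile_n r a n (v : nat -> seq nat) (p : nat -> nat) (o : nat -> seq sym) :
  (forall i, i < n -> 0 < nth 0 (v i) r /\ pexec a (v i) (p i) (o i) (v i.+1) (p i.+1) (o i.+1)) ->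
  nth 0 (v n) r = 0 ->
  pexec (PWhile r a) (v 0) (p 0) (o 0) (v n) (p n) (o n).
Proof.
elim: n v p o => [|n IH] v p o h h0; first exact: XWhile0.
have [r0 ex] := h 0 (ltn0Sn _).
apply: XWhile r0 ex _.
by apply: (IH (fun i => v i.+1) (fun i => p i.+1) (fun i => o i.+1)) => // i hi; apply: h.
Qed.

Lemma pexec_size m P v p o v' p' o' : pexec P v p o v' p' o' -> wf m P -> size v = m -> size v' = m.
Proof.
elim=> {P v p o v' p' o'} //=.
- by move=> r f v p o _ [rm _] sv; rewrite size_set_nth sv; apply/maxn_idPr.
- by move=> a b v p o v1 p1 o1 v2 p2 o2 _ IHa _ IHb [wa wb] /(IHa wa)/(IHb wb).
- by move=> r a b v p o v1 p1 o1 _ IH [_ [wa wb]]; apply: IH; case: ifP.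
- by move=> r a v p o v1 p1 o1 v2 p2 o2 _ _ IHa _ IHw w /(IHa w.2)/(IHw w).
- by move=> r v p o rm sv; rewrite size_set_nth sv; apply/maxn_idPr.
Qed.

Lemma mx_set_nth v r a M : r < size v -> mx v <= M -> a <= M -> mx (set_nth 0 v r a) <= M.
Proof.
move=> rv hv ha; apply: mx_leP => i; rewrite nth_set_nth /=; case: eqP => // _.
exact: leq_trans (mx_nth _ _) hv.
Qed.

Lemma pexec_mx m P v p o v' p' o' : pexec P v p o v' p' o' -> 0 < V ->
  wf m P -> size v = m -> mx v <= V -> mx v' <= V.
Proof.
move=> h V0; elim: h => {P v p o v' p' o'} //=.
- by move=> r f v p o fV [rm _] sv hv; apply: mx_set_nth; rewrite ?sv.
- move=> a b v p o v1 p1 o1 v2 p2 o2 ha IHa _ IHb [wa wb] sv /(IHa wa sv).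
  by apply: IHb => //; apply: pexec_size ha wa sv.
- by move=> r a b v p o v1 p1 o1 _ IH [_ [wa wb]]; apply: IH; case: ifP.
- move=> r a v p o v1 p1 o1 v2 p2 o2 _ ha IHa _ IHw w sv /(IHa w.2 sv).
  by apply: IHw => //; apply: pexec_size ha w.2 sv.
- by move=> r v p o rm sv hv; apply: mx_set_nth; rewrite ?sv //; apply: leq_trans V0; case: ch.
Qed.

End Pexec.

Lemma map_iota_set_nth (rho rho' : nat -> nat) m r a v : r < m ->
  [seq rho r | r <- iota 1 m] = v -> rho' r.+1 = a ->
  (forall i, 0 < i <= m -> i != r.+1 -> rho' i = rho i) ->
  [seq rho' r | r <- iota 1 m] = set_nth 0 v r a.
Proof.
move=> rm <- ra h; apply: (@eq_from_nth _ 0).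
  by rewrite size_set_nth !size_map size_iota; apply/esym/maxn_idPr.
move=> i; rewrite size_map size_iota => im.
rewrite nth_set_nth /= !(nth_map 0) ?size_iota // nth_iota //.
by case: eqP => [->|/eqP ir]; rewrite add1n ?ra // h //; lia.
Qed.

Lemma prog_cmd m P : wf m P -> exists cm e, forall inp ch V B v p o v' p' o',
  pexec inp ch V P v p o v' p' o' -> 0 < V -> size v = m -> mx v <= V -> V.+2 ^ e <= B ->
  forall rho, (forall r, rho r <= B) -> [seq rho r | r <- iota 1 m] = v ->
  exists rho', exec inp ch B cm rho p o rho' p' o' /\ [seq rho' r | r <- iota 1 m] = v'.
Proof.
have weak (V e1 e2 B : nat) : V.+2 ^ maxn e1 e2 <= B -> V.+2 ^ e1 <= B /\ V.+2 ^ e2 <= B.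
  by move=> h; split; apply: leq_trans h; rewrite leq_exp2l // leq_max leqnn ?orbT.
elim: P => [|r f|a IHa b IHb|r a IHa b IHb|r a IHa|r|s].
- move=> _; exists Skip, 0 => inp ch V B v p o v' p' o' h; inversion h; subst=> _ _ _ _ rho _ hr.
  by exists rho; split=> //; apply: ESkip.
- move=> [rm [code [e [hb hf]]]].
  exists (Seq (code (iota 1 m) m.+1) (move m.+1 r.+1)), e.
  move=> inp ch V B v p o v' p' o' h; inversion h; subst => V0 sv hv hB rho rB hr.
  have R : runs inp B (Seq (code (iota 1 m) m.+1) (move m.+1 r.+1)) rho
     (fun rho' => [seq rho' r | r <- iota 1 m] = set_nth 0 v r (f inp v)).
    apply: runs_seq; apply: runs_conseq.
      apply: hf => //.
        by apply/allP => i; rewrite mem_iota; lia.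
      by rewrite hr; apply: leq_trans hB; apply: leq_expl; lia.
    rewrite hr => rho1 [h1 h1']; apply: runs_conseq; first by apply: runs_move; lia.
    move=> rho2 h2; apply: (@map_iota_set_nth rho) => //.
      by rewrite h2 eqxx h1.
    by move=> i im ir; rewrite h2 (negbTE ir) ifF ?h1' //; lia.
  case: R => R; have [rho' [e1 q1]] := R rB ch p' o'.
  by exists rho'.
- move=> [wa wb]; have [ca [ea ha]] := IHa wa; have [cb [eb hb]] := IHb wb.
  exists (Seq ca cb), (maxn ea eb) => inp ch V B v p o v' p' o' /pexec_inv [v1 [p1 [o1 [H2 H6]]]].
  move=> V0 sv hv /weak [Ba Bb] rho rB hr.
  have [rho1 [e1 q1]] := ha _ _ _ _ _ _ _ _ _ _ H2 V0 sv hv Ba rho rB hr.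
  have [rho2 [e2 q2]] := hb _ _ _ _ _ _ _ _ _ _ H6 V0 (pexec_size H2 wa sv)
    (pexec_mx H2 V0 wa sv hv) Bb rho1 (exec_le e1 rB) q1.
  by exists rho2; split=> //; apply: ESeq e1 e2.
- move=> [rm [wa wb]]; have [ca [ea ha]] := IHa wa; have [cb [eb hb]] := IHb wb.
  exists (If r.+1 ca cb), (maxn ea eb) => inp ch V B v p o v' p' o' /pexec_inv H6.
  move=> V0 sv hv /weak [Ba Bb] rho rB hr.
  have er : rho r.+1 = nth 0 v r by rewrite -hr (nth_map 0) ?size_iota // nth_iota.
  rewrite -er in H6.
  case: posnP H6 => r0 hx.
    have [rho1 [e1 q1]] := hb _ _ _ _ _ _ _ _ _ _ hx V0 sv hv Bb rho rB hr.
    by exists rho1; split=> //; apply: EIf; rewrite r0.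
  have [rho1 [e1 q1]] := ha _ _ _ _ _ _ _ _ _ _ hx V0 sv hv Ba rho rB hr.
  by exists rho1; split=> //; apply: EIf; rewrite r0.
- move=> [rm wa]; have [ca [ea ha]] := IHa wa.
  exists (While r.+1 ca), ea => inp ch V B v p o v' p' o'.
  move eQ : (PWhile r a) => Q h.
  elim: h eQ => {Q v p o v' p' o'} //.
  + move=> r1 a1 v p o r0 [e1 e2] V0 sv hv hB rho rB hr; subst r1 a1.
    have er : rho r.+1 = nth 0 v r by rewrite -hr (nth_map 0) ?size_iota // nth_iota.
    by exists rho; split=> //; apply: EWhile0; rewrite er.
  + move=> r1 a1 v p o v1 p1 o1 v2 p2 o2 r0 hx _ _ IHw [e1 e2] V0 sv hv hB rho rB hr; subst r1 a1.
    have er : rho r.+1 = nth 0 v r by rewrite -hr (nth_map 0) ?size_iota // nth_iota.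
    have [rho1 [e1 q1]] := ha _ _ _ _ _ _ _ _ _ _ hx V0 sv hv hB rho rB hr.
    have [rho2 [e2 q2]] := IHw erefl V0 (pexec_size hx wa sv)
      (pexec_mx hx V0 wa sv hv) hB rho1 (exec_le e1 rB) q1.
    by exists rho2; split=> //; apply: EWhile e1 e2; rewrite er.
- move=> rm; exists (Guess (Seq (clear r.+1) (Inc r.+1)) (clear r.+1)), 0.
  move=> inp ch V B v p o v' p' o' h; inversion h; subst => V0 sv hv hB rho rB hr.
  have R : runs inp B (if ch p then Seq (clear r.+1) (Inc r.+1) else clear r.+1) rho
     (fun rho' => [seq rho' r | r <- iota 1 m] = set_nth 0 v r (ch p)).
    case: (ch p); last first.
      apply: (runs_conseq (runs_clear _ _ _ _)) => rho1 h1.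
      apply: (@map_iota_set_nth rho) => //; first by rewrite h1 eqxx.
      by move=> i im ir; rewrite h1 (negbTE ir).
    apply: runs_seq; apply: (runs_conseq (runs_clear _ _ _ _)) => rho1 h1.
    apply: runs_inc; first by rewrite h1 eqxx.
    apply: (@map_iota_set_nth rho) => //; first by rewrite updf_eq h1 eqxx.
    by move=> i im ir; rewrite updf_neq // h1 (negbTE ir).
  case: R => R; have [rho' [e1 q1]] := R rB ch p.+1 o'.
  by exists rho'; split=> //; apply: EGuess.
- move=> _; exists (Out s), 0 => inp ch V B v p o v' p' o' h; inversion h; subst=> _ _ _ _ rho _ hr.
  by exists rho; split=> //; apply: EOut.
Qed.

(** The exponent of the polynomial bound becomes a factor of its logarithm and disappears in [K]. *)
Theorem prog_TM m P : wf m P -> 0 < m -> exists (M : TM) K, read_once M /\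
  forall x k c V v' p' o', 0 < V ->
  pexec (nth Blank (enc x k)) c V P (nseq m 0) 0 [::] v' p' o' ->
  exists n, let C := run M x k c n in
    [/\ halting M (cq C), accepting M (cq C) = (0 < nth 0 v' 0), chp C = p', out C = o' &
     forall n', space (run M x k c n') <= K * (trunc_log 2 V.+2).+1].
Proof.
move=> /prog_cmd [cm [e he]] m0.
exists (cmdTM cm), (10 * (maxreg cm).+1 * e.+1); split; first exact: machine_read_once.
move=> x k c V v' p' o' V0 hx.
have h0 : mx (nseq m 0) <= V by elim: (m) => //= m1; rewrite geq_max.
have hm : [seq 0 | _ <- iota 1 m] = nseq m 0.
  by apply: (@eq_from_nth _ 0); rewrite ?size_map size_iota ?size_nseq // => i im; rewrite (nth_map 0) ?size_iota // nth_nseq im.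
have [rho' [ex hr]] := he _ _ _ (V.+2 ^ e) _ _ _ _ _ _ hx V0 (size_nseq _ _) h0 (leqnn _) (fun _ => 0) (fun _ => leq0n _) hm.
have [n [h1 h2 h3 h4 h5]] := cmdTM_ok ex.
exists n; split=> //.
  by rewrite h2 -hr (nth_map 0) ?size_iota // nth_iota.
move=> n'; apply: leq_trans (h5 n') _; rewrite -[X in _ <= X]mulnA leq_mul2l; apply/orP; right.
have h : (trunc_log 2 V.+2).+1 * e.+1 > trunc_log 2 (V.+2 ^ e).
  have hV : V.+2 < 2 ^ (trunc_log 2 V.+2).+1 by apply: trunc_log_ltn.
  have hl : 2 ^ trunc_log 2 (V.+2 ^ e) <= V.+2 ^ e by apply: trunc_logP => //; rewrite expn_gt0.
  have hle : V.+2 ^ e <= 2 ^ ((trunc_log 2 V.+2).+1 * e) by rewrite expnM; apply: leq_expl; exact: ltnW.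
  have := leq_trans hl hle; rewrite leq_exp2l // => hh; apply: leq_ltn_trans hh _.
  by rewrite ltn_mul2l ltnSn andbT.
by rewrite mulnC.
Qed.

(** * Membership *)

Definition zer (g : nat -> bool) (p : nat) : nat := \sum_(j < p) ~~ g j.

(** A one belongs to the number whose index is the count of zeros before it. This gives direct
    access to entry [j] of the list, without a parser. *)
Definition num (g : nat -> bool) (len j : nat) : nat :=
  \sum_(p < len) (g p && (zer g p == j)).

Lemma zer_cons a g p : zer (fun i => if i is i'.+1 then g i' else a) p.+1 = ~~ a + zer g p.
Proof. by rewrite /zer big_ord_recl. Qed.

Lemma num_cons a g len j :
  num (fun i => if i is i'.+1 then g i' else a) len.+1 j =
  (a && (j == 0)) + \sum_(p < len) (g p && (~~ a + zer g p == j)).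
Proof.
rewrite /num big_ord_recl /=; congr (_ + _).
  by rewrite /zer big_ord0 eq_sym.
by apply: eq_bigr => p _; rewrite -zer_cons.
Qed.

Lemma num_ext g g' len j : g =1 g' -> num g len j = num g' len j.
Proof.
move=> e; apply: eq_bigr => p _; rewrite e; congr (_ && (_ == _)).
by apply: eq_bigr => q _; rewrite e.
Qed.

Lemma nth_cons_fun (a : bool) x :
  nth false (a :: x) =1 (fun i => if i is i'.+1 then nth false x i' else a).
Proof. by case. Qed.

Lemma zer_ext g g' p : g =1 g' -> zer g p = zer g' p.
Proof. by move=> e; apply: eq_bigr => i _; rewrite e. Qed.

(** Decoding fails only if the last number lacks its closing zero; the ones already collected in [m]
    belong to entry 0. *)
Lemma dec_nats_aux x m : dec_nats x m =
  if (if x is [::] then m == 0 else ~~ last true x)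
  then Some [seq num (nth false x) (size x) j + (if j == 0 then m else 0)
            | j <- iota 0 (zer (nth false x) (size x))]
  else None.
Proof.
elim: x m => [|[] x IH] m.
- by rewrite /zer big_ord0; case: m.
- rewrite /= IH; have -> : (if x is [::] then m.+1 == 0 else ~~ last true x) = ~~ last true x by case: x {IH}.
  case: ifP => // _; congr Some.
  rewrite (zer_ext _ (nth_cons_fun true x)) zer_cons; apply: eq_map => j.
  rewrite (num_ext _ _ (nth_cons_fun true x)) num_cons -/(num (nth false x) (size x) j) andTb; case: (j == 0); lia.
rewrite /= IH; have -> : (if x is [::] then 0 == 0 else ~~ last true x) = ~~ last false x by case: x {IH}.
case: ifP => // _ /=; congr Some.
rewrite (zer_ext _ (nth_cons_fun false x)) zer_cons (_ : ~~ false + _ = (zer (nth false x) (size x)).+1) //=; congr cons.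
  rewrite (num_ext _ _ (nth_cons_fun false x)) num_cons /= big1 //.
  by move=> i _; rewrite add1n andbF.
rewrite -[1]addn0 iotaDl -map_comp; apply: eq_map => j /=.
by rewrite (num_ext _ _ (nth_cons_fun false x)) num_cons /= addn0 if_same addn0.
Qed.

Lemma dec_natsE x : dec_nats x 0 =
  if (size x == 0) || ~~ nth false x (size x).-1
  then Some [seq num (nth false x) (size x) j | j <- iota 0 (zer (nth false x) (size x))]
  else None.
Proof.
rewrite dec_nats_aux; have -> : (if x is [::] then 0 == 0 else ~~ last true x) = ((size x == 0) || ~~ nth false x (size x).-1).
  by case: x => //= a x; rewrite (last_nth true) /= (set_nth_default true).
by case: ifP => // _; congr Some; apply: eq_map => j; rewrite if_same addn0.
Qed.

(** The index of the degree entry of vertex [u]: the adjacency part follows the four entries for the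
    number of vertices, the endpoints and the length, and a degree [d] is followed by [d]
    entries. *)
Definition qpos (f : nat -> nat) (u : nat) : nat := iter u (fun q => q + (f q).+1) 4.

Definition succs (f : nat -> nat) (u : nat) : seq nat :=
  [seq f ((qpos f u).+1 + i) | i <- iota 0 (f (qpos f u))].

(** Jumps go strictly forward, so an overrun never comes back to [c], and a single equality at the
    end decides whether the list is well formed. *)
Lemma parse_adj_aux f c n q : q <= c ->
  parse_adj n [seq f j | j <- iota q (c - q)] =
  if iter n (fun q => q + (f q).+1) q == c
  then Some [seq [seq f ((iter u (fun q => q + (f q).+1) q).+1 + i) | i <- iota 0 (f (iter u (fun q => q + (f q).+1) q))]
            | u <- iota 0 n]
  else None.
Proof.
elim: n q => [|n IH] q qc.
  by rewrite /=; case: eqP => [->|h]; [rewrite subnn|case e: (c - q) => //; lia].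
have ge m : forall q, q <= iter m (fun q => q + (f q).+1) q.
  by elim: m => //= m IHm q1; apply: leq_trans (IHm q1) _; rewrite leq_addr.
have itS m : iter m.+1 (fun q => q + (f q).+1) q = iter m (fun q => q + (f q).+1) (q + (f q).+1).
  by rewrite iterSr.
case e: (c - q) => [|d].
  have -> : iter n.+1 (fun q => q + (f q).+1) q == c = false by rewrite itS; have := ge n (q + (f q).+1); lia.
  by [].
rewrite [iota q _]/= [map _ _]/= [parse_adj _ _]/= size_map size_iota; case: leqP => h; last first.
  have -> // : iter n.+1 (fun q => q + (f q).+1) q == c = false by rewrite itS; have := ge n (q + (f q).+1); lia.
rewrite -map_drop drop_iota -map_take take_iota (minn_idPl h).
have -> : q.+1 + f q = q + (f q).+1 by lia.
have -> : d - f q = c - (q + (f q).+1) by lia.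
rewrite IH; last lia.
rewrite itS; case: ifP => //= _; congr Some; congr cons.
  by rewrite -[q.+1]addn0 iotaDl -map_comp; apply: eq_map => i /=; rewrite addn0.
rewrite -[1]addn0 iotaDl -map_comp; apply: eq_map => u.
by rewrite -itS.
Qed.

Fixpoint wk (adj : nat -> seq nat) (t u r : nat) : nat :=
  if r is r'.+1 then \sum_(v <- adj u) wk adj t v r' else u == t.

(** [is_walk] tests membership in adjacency lists, [wk] sums along them; the counts agree because
    the lists have no repetitions and stay below [n]. *)
Lemma num_walks_wk n adj s t a : s < n ->
  (forall u, u < n -> uniq (nth [::] adj u) && all (fun v => v < n) (nth [::] adj u)) ->
  num_walks n adj s t a = wk (nth [::] adj) t s a.
Proof.
move=> sn hadj; rewrite /num_walks /=.
have cnt1 (P : nat -> seq nat -> bool) (X : seq (seq nat)) m l :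
  count (fun w => if w is u :: q then P u q else false) [seq i :: p | i <- iota l m, p <- X]
  = \sum_(i <- iota l m) count (P i) X.
  elim: m l => [|m IH] l /=; first by rewrite big_nil.
  by rewrite big_cons count_cat IH count_map.
transitivity (count (fun q => (last s q == t) && path (edge adj) s q) (all_seqs n a)).
  rewrite /is_walk cnt1 (bigD1_seq s) ?iota_uniq ?mem_iota //= big1 => [|i /negbTE si]; last first.
    by rewrite (eq_count (a2 := pred0)) ?count_pred0 // => q /=; rewrite si.
  rewrite addn0; apply: eq_in_count => q; rewrite eqxx /= => hq.
  have -> //: size q == a.
  elim: (a) q hq => [|m IH] q /=; first by rewrite inE => /eqP ->.
  by case/allpairsP => -[i p] [/= _ hp ->] /=; rewrite eqSS IH.
elim: a s sn => [|a IH] s sn /=; first by rewrite !addn0 andbT.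
transitivity (count (fun w => if w is u :: q then edge adj s u && ((last u q == t) && path (edge adj) u q) else false)
   [seq i :: p | i <- iota 0 n, p <- all_seqs n a]).
  apply: eq_in_count => q /allpairsP [[i p] [/= _ _ ->]] /=.
  by rewrite andbCA.
rewrite (cnt1 (fun u q => edge adj s u && ((last u q == t) && path (edge adj) u q))).
have /andP [un al] := hadj s sn.
rewrite (bigID (fun i => i \in nth [::] adj s)) /= [X in _ + X]big1 ?addn0; last first.
  move=> i /negbTE hi; rewrite (eq_count (a2 := pred0)) ?count_pred0 // => q /=.
  by rewrite /edge hi.
rewrite -big_filter (perm_big (nth [::] adj s)) /=.
  rewrite big_seq [RHS]big_seq; apply: eq_bigr => i hi.
  rewrite -IH; last exact: (allP al).
  by apply: eq_count => q /=; rewrite /edge hi.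
apply: uniq_perm; rewrite ?filter_uniq ?iota_uniq // => i.
rewrite mem_filter mem_iota /= add0n; case: (boolP (i \in _)) => //= hi.
exact: (allP al).
Qed.

(** The success of [decode], phrased with bounded quantifiers over positions so that it falls into
    the class [L]. *)
Definition logx (g : nat -> bool) (len b : nat) : bool :=
  let f := num g len in
  [&& (len == 0) || ~~ g len.-1, 4 <= zer g len, qpos f (f 0) == zer g len,
      f 1 < f 0, f 2 < f 0 &
      all (fun u => [&& f (qpos f u) <= b,
        all (fun i => all (fun j => (i == j) || (f ((qpos f u).+1 + i) != f ((qpos f u).+1 + j)))
              (iota 0 (f (qpos f u)))) (iota 0 (f (qpos f u))) &
        all (fun i => f ((qpos f u).+1 + i) < f 0) (iota 0 (f (qpos f u)))]) (iota 0 (f 0))].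

Lemma uniq_map_iota (h : nat -> nat) d :
  uniq [seq h i | i <- iota 0 d] =
  all (fun i => all (fun j => (i == j) || (h i != h j)) (iota 0 d)) (iota 0 d).
Proof.
apply/idP/idP => [hu|ha].
  apply/allP => i; rewrite mem_iota /= add0n => id; apply/allP => j; rewrite mem_iota /= add0n => jd.
  case: eqP => //= ij; apply/negP => /eqP hh; apply: ij.
  have := nth_uniq 0 _ _ hu; move/(_ i j); rewrite size_map size_iota => /(_ id jd).
  by rewrite !(nth_map 0) ?size_iota // !nth_iota // !add0n hh eqxx => /esym/eqP.
rewrite map_inj_in_uniq ?iota_uniq // => i j hi hj hh.
by have := allP (allP ha i hi) j hj; rewrite hh eqxx orbF => /eqP.
Qed.

Lemma decode_logx b x : let f := num (nth false x) (size x) in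
  decode b x = if logx (nth false x) (size x) b
    then Some (f 0, [seq succs f u | u <- iota 0 (f 0)], f 1, f 2, f 3) else None.
Proof.
move=> f; rewrite /decode dec_natsE /logx -/f.
case: (_ || _) => //=.
set c := zer _ _; case: (leqP 4 c) => [c4|]; last by case: c => [|[|[|[|]]]].
have -> : iota 0 c = [:: 0, 1, 2, 3 & iota 4 (c - 4)].
  by rewrite -{1}(subnKC c4) iotaD.
rewrite /= parse_adj_aux // -/(qpos f (f 0)); case: ifP => //= _.
rewrite -/(map _ _) (_ : [seq [seq _ | i <- _] | u <- iota 0 (f 0)] = [seq succs f u | u <- iota 0 (f 0)]) //.
do 2 case: ltnP => //=.
move=> _ _; congr (if _ then _ else _).
rewrite all_map; congr (_ && _); apply: eq_all => u /=; rewrite /succs size_map size_iota uniq_map_iota all_map.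
by [].
Qed.

Lemma logreachE b x k : let f := num (nth false x) (size x) in
  logreach b x k = if logx (nth false x) (size x) b && (2 ^ f 3 <= f 0 ^ k)
    then wk (succs f) (f 2) (f 1) (f 3) else 0.
Proof.
move=> f; rewrite /logreach decode_logx -/f; case: (boolP (logx _ _ _)) => //= hl.
case: ifP => // _; move: hl; rewrite /logx -/f => /and5P [_ _ _ s1 /andP [t1 al]].
have nthE u : u < f 0 -> nth [::] [seq succs f u | u <- iota 0 (f 0)] u = succs f u.
  by move=> hu; rewrite (nth_map 0) ?size_iota // nth_iota.
have sl u : u < f 0 -> [&& size (succs f u) <= b, uniq (succs f u) & all (fun v => v < f 0) (succs f u)].
  move=> hu; have /(_ u) := allP al; rewrite mem_iota => /(_ hu).
  by rewrite /succs size_map size_iota uniq_map_iota all_map.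
rewrite num_walks_wk //; last first.
  by move=> u hu; rewrite nthE //; case/and3P: (sl u hu) => _ -> ->.
elim: (f 3) (f 1) s1 => //= r IH u hu.
rewrite nthE //; apply: eq_big_seq => v hv; apply: IH.
by case/and3P: (sl u hu) => _ _ /allP; apply.
Qed.

(** * The threshold test by column addition *)

Lemma sum_ord_mul M Lg (F : nat -> nat) :
  \sum_(e < M * Lg) F e = \sum_(q < M) \sum_(i < Lg) F (q * Lg + i).
Proof.
elim: M => [|M IH]; first by rewrite mul0n !big_ord0.
rewrite big_ord_recr /= -IH mulSnr big_split_ord /=; congr (_ + _).
Qed.

Definition dig (Lg j e : nat) : nat := (e %/ Lg ^ j) %% Lg.

Definition bit (n i : nat) : nat := (n %/ 2 ^ i) %% 2.

Lemma bits_sum Lg n : n < 2 ^ Lg -> n = \sum_(i < Lg) bit n i * 2 ^ i.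
Proof.
elim: Lg n => [|Lg IH] n; first by rewrite big_ord0; case: n.
rewrite expnS => hn; rewrite big_ord_recl /bit expn0 divn1 muln1 {1}(divn_eq n 2) addnC.
congr (_ + _); rewrite {1}(IH (n %/ 2)); last by rewrite ltn_divLR // mulnC.
rewrite big_distrl; apply: eq_bigr => i _ /=.
by rewrite /bit /bump /= add1n -divnMA -expnS -mulnA -expnSr.
Qed.

(** Induction on [k] splits off the least significant base [Lg] digit of [e], which selects a bit of
    the additional factor [n]. *)
Lemma pow_sum Lg n k : n < 2 ^ Lg ->
  n ^ k = \sum_(e < Lg ^ k) (\prod_(j < k) bit n (dig Lg j e)) * 2 ^ (\sum_(j < k) dig Lg j e).
Proof.
move=> hn.
elim: k => [|k IH]; first by rewrite expn0 big_ord_recl !big_ord0.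
rewrite [in RHS]expnSr (sum_ord_mul _ _ (fun e => (\prod_(j < k.+1) bit n (dig Lg j e)) * 2 ^ (\sum_(j < k.+1) dig Lg j e))) expnSr {}IH big_distrl; apply: eq_bigr => q _ /=.
rewrite [X in _ * X = _](bits_sum hn) big_distrr; apply: eq_bigr => i _ /=.
have Lg0 : 0 < Lg := leq_ltn_trans (leq0n _) (ltn_ord i).
have d0 : dig Lg 0 (q * Lg + i) = i by rewrite /dig expn0 divn1 modnMDl modn_small.
have dS j : dig Lg j.+1 (q * Lg + i) = dig Lg j q.
  by rewrite /dig expnS divnMA divnMDl // (divn_small (ltn_ord i)) addn0.
have e1 : \prod_(j < k) bit n (dig Lg (lift ord0 j) (q * Lg + i)) = \prod_(j < k) bit n (dig Lg j q).
  by apply: eq_bigr => j _; rewrite lift0 dS.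
have e2 : \sum_(j < k) dig Lg (lift ord0 j) (q * Lg + i) = \sum_(j < k) dig Lg j q.
  by apply: eq_bigr => j _; rewrite lift0 dS.
rewrite !big_ord_recl d0 expnD e1 e2.
by rewrite mulnACA [_ * bit n i]mulnC [_ * 2 ^ i]mulnC.
Qed.

Section Carry.
Variables (M : nat) (w : nat -> bool) (s : nat -> nat).

Definition col (p : nat) : nat := \sum_(e < M) (w e && (s e == p)).

Definition carry (a : nat) : nat := iteri a (fun p c => (c + col p) %/ 2) 0.

(** Dropping low bits commutes with adding the next column: [(y %/ 2 ^ a + c) %/ 2] equals
    [(y + c * 2 ^ a) %/ 2 ^ a.+1]. *)
Lemma carryE a : carry a = (\sum_(e < M | s e < a) w e * 2 ^ s e) %/ 2 ^ a.
Proof.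
elim: a => [|a IH]; first by rewrite big_pred0.
rewrite /carry iteriS -/(carry a) {}IH.
have -> : \sum_(e < M | s e < a.+1) w e * 2 ^ s e
  = \sum_(e < M | s e < a) w e * 2 ^ s e + col a * 2 ^ a.
  rewrite /col big_distrl big_mkcond [in RHS]big_mkcond -big_split; apply: eq_bigr => e _ /=.
  by rewrite ltnS; case: ltngtP => [h|h|->]; rewrite ?andbF ?andbT ?addn0.
rewrite expnSr divnMA [in RHS]addnC divnMDl ?expn_gt0 //; congr (_ %/ _); lia.
Qed.

(** A column has at most [M] entries, and halving [c + col p <= 2 * M] leads back to at most [M]. *)
Lemma carry_le a : carry a <= M.
Proof.
elim: a => // a IH; rewrite /carry iteriS -/(carry a).
have : col a <= M.
  rewrite -[X in _ <= X]card_ord -sum1_card; apply: leq_sum => i _; exact: leq_b1.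
by move=> h; rewrite -[X in _ <= X](mulnK M (isT : 0 < 2)); apply: leq_div2r; lia.
Qed.

(** A term with exponent at least [a] reaches the threshold alone. Without such a term everything
    lies below column [a], and the carry out of these columns decides. *)
Lemma carry_thr a : (2 ^ a <= \sum_(e < M) w e * 2 ^ s e) =
  (0 < carry a) || has (fun e => w e && (a <= s e)) (iota 0 M).
Proof.
rewrite carryE divn_gt0 ?expn_gt0 //.
case: (boolP (has _ _)) => [/hasP [e]|hn].
  rewrite mem_iota add0n /= => eM /andP [we ae]; rewrite orbT.
  rewrite (bigD1 (Ordinal eM)) //= we mul1n.
  apply: leq_trans (leq_addr _ _); by rewrite leq_exp2l.
rewrite orbF; congr (_ <= _).
rewrite [in RHS]big_mkcond; apply: eq_bigr => e _.
have := hasPn hn e; rewrite mem_iota add0n ltn_ord => /(_ isT).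
by case: (w e) => //= h; rewrite ?if_same //; case: ltnP h => //= ->.
Qed.

End Carry.

(** The number of binary digits as a count of the powers of two up to [n]. Truncation at [n.+1]
    still separates the powers above [n] from the others. *)
Definition lgn (n : nat) : nat := \sum_(i < n) (cpow n.+1 2 i <= n).

Definition digT (T n j e : nat) : nat := (e %/ cpow T (lgn n) j) %% lgn n.
Definition wT (T n k e : nat) : bool :=
  all (fun j => (n %/ cpow n 2 (digT T n j e)) %% 2 == 1) (iota 0 k).
Definition sT (T n k e : nat) : nat := \sum_(j < k) digT T n j e.
Definition thrT (T n k a : nat) : bool :=
  let M := cpow T (lgn n) k in
  (0 < carry M (wT T n k) (sT T n k) a) ||
  has (fun e => wT T n k e && (a <= sT T n k e)) (iota 0 M).

Lemma cpow_min T b n : 0 < T -> 0 < b -> cpow T b n = minn (b ^ n) T.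
Proof.
move=> T0 b0; elim: n => [|n IH] /=; first by rewrite expn0; apply/esym/minn_idPl.
rewrite IH expnSr; case: (leqP (b ^ n) T) => h.
  by [].
have h1 : T <= b ^ n * b by nia.
have h2 : T <= T * b by nia.
by rewrite (minn_idPr h1) (minn_idPr h2).
Qed.

Lemma lgnE n : 0 < n -> lgn n = (trunc_log 2 n).+1.
Proof.
move=> n0; rewrite /lgn.
have hl : trunc_log 2 n < n.
  by apply: leq_trans (trunc_logP (isT : 1 < 2) n0); exact: ltn_expl.
rewrite (eq_bigr (fun i : 'I_n => nat_of_bool (i < (trunc_log 2 n).+1))); last first.
  move=> i _; rewrite cpow_min // ltnS; congr nat_of_bool.
  apply/idP/idP => h.
    rewrite trunc_log_max //; move: h; rewrite geq_min; case/orP => //; lia.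
  apply: leq_trans (geq_minl _ _) _; apply: leq_trans (trunc_logP (isT : 1 < 2) n0).
  by rewrite leq_exp2l.
move: (trunc_log 2 n).+1 hl => q.
elim: (n) => [|m IH] hq; first by rewrite big_ord0; lia.
rewrite big_ord_recr /=; case: (leqP q m) => h; first by rewrite IH // addn0.
have -> : q = m.+1 by lia.
rewrite (eq_bigr (fun _ => 1)); first by rewrite sum1_card card_ord; lia.
by move=> i _; have := ltn_ord i; lia.
Qed.

(* If lgn n > 2 ^ k then k <= log (log n), and the left-hand side is polynomial in n. *)
Lemma lgn_pow n k : 0 < n -> lgn n ^ k <= 2 ^ (k * k) * (n + n) ^ 4.
Proof.
move=> n0; rewrite lgnE //; set Lg := (trunc_log 2 n).+1.
case: (leqP Lg (2 ^ k)) => h.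
  apply: (@leq_trans (2 ^ (k * k))); last by rewrite leq_pmulr // expn_gt0 addn_gt0 n0.
  by rewrite expnM; apply: leq_expl.
apply: (@leq_trans ((n + n) ^ 4)); last by rewrite leq_pmull // expn_gt0.
set l := trunc_log 2 Lg.
have kl : k <= l by rewrite /l trunc_log_max //; exact: ltnW.
have Ll : Lg <= 2 ^ l.+1 by apply/ltnW/trunc_log_ltn.
have lL : 2 ^ l <= Lg by apply: trunc_logP.
have q4 : l.+1 * l <= 4 * 2 ^ l.
  elim: (l) => // m IH; rewrite expnS.
  have : m < 2 ^ m by exact: ltn_expl.
  move: IH; case: m => [|[|m]] // IH; nia.
apply: leq_trans (leq_expl k Ll) _; rewrite -expnM.
apply: (@leq_trans (2 ^ (Lg * 4))).
  rewrite leq_exp2l //; apply: leq_trans (leq_mul (leqnn _) kl) _; lia.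
rewrite expnM; apply: leq_expl; rewrite /Lg expnS mul2n addnn.
by rewrite leq_double; apply: trunc_logP.
Qed.

(** No truncation takes effect: the powers of [lgn n] up to the [k]-th are at most [T], and a digit
    is below [lgn n], so the power of two it selects is at most [n]. *)
Lemma thrTE T n k a : 0 < n -> lgn n ^ k <= T -> thrT T n k a = (2 ^ a <= n ^ k).
Proof.
move=> n0 hT; rewrite /thrT.
set Lg := lgn n.
have Lg0 : 0 < Lg by rewrite /Lg lgnE.
have -> : cpow T Lg k = Lg ^ k by apply: cpowE.
rewrite -carry_thr; congr (_ <= _).
have hn : n < 2 ^ Lg by rewrite /Lg lgnE //; apply: trunc_log_ltn.
rewrite (pow_sum k hn); apply: eq_bigr => e _.
have dE j : j < k -> digT T n j e = dig Lg j e.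
  move=> jk; rewrite /digT /dig cpowE //; apply: leq_trans hT.
  by rewrite leq_pexp2l // ltnW.
have -> : sT T n k e = \sum_(j < k) dig Lg j e by apply: eq_bigr => j _; apply: dE.
congr (_ * _).
have bE j : j < k -> (n %/ cpow n 2 (digT T n j e)) %% 2 = bit n (dig Lg j e).
  move=> jk; rewrite dE // /bit cpowE // ; apply: leq_trans (trunc_logP (isT : 1 < 2) n0).
  rewrite leq_exp2l // -ltnS -lgnE //; exact: ltn_pmod.
rewrite /wT; move: (nat_of_ord e) bE {dE} => {}e bE; elim: (k) bE => [|m IH] bE; first by rewrite big_ord0.
have -> : iota 0 m.+1 = rcons (iota 0 m) m by rewrite -[m.+1]addn1 iotaD add0n cats1.
rewrite all_rcons big_ord_recr /= -IH; last by move=> j jm; apply: bE; exact: ltnW.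
rewrite bE // andbC; case: (all _ _); rewrite ?mul0n // mul1n.
by rewrite /bit; have := ltn_pmod (n %/ 2 ^ dig Lg m e) (isT : 0 < 2); case: (_ %% 2) => [|[|]].
Qed.

Lemma L_lgn n : L n -> L (fun inp v => lgn (n inp v)).
Proof.
move=> hn; suff h : L (fun _ v => lgn v#0) by exact: (L_comp h (conj hn I) (fs := [:: n])).
by apply: (@L_sum (fun _ v => v#0) (fun _ v => nat_of_bool (cpow (v#1).+1 2 v#0 <= v#1))); L_tac.
Qed.
#[export] Hint Resolve L_lgn : L.

Lemma L_thrT T n k a : L T -> L n -> L k -> L a ->
  L (fun inp v => nat_of_bool (thrT (T inp v) (n inp v) (k inp v) (a inp v))).
Proof.
move=> hT hn hk ha.
have hD : forall T n j e, L T -> L n -> L j -> L e ->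
   L (fun inp v => digT (T inp v) (n inp v) (j inp v) (e inp v)).
  by move=> *; rewrite /digT; L_tac.
have hW : forall T n k e, L T -> L n -> L k -> L e ->
   L (fun inp v => nat_of_bool (wT (T inp v) (n inp v) (k inp v) (e inp v))).
  move=> T1 n1 k1 e1 h1 h2 h3 h5.
  suff h : L (fun _ v => nat_of_bool (wT v#0 v#1 v#2 v#3)).
    exact: (L_comp h (conj h1 (conj h2 (conj h3 (conj h5 I)))) (fs := [:: T1; n1; k1; e1])).
  apply: (@L_all (fun _ v => v#2) (fun _ v =>
     (v#2 %/ cpow v#2 2 (digT v#1 v#2 v#0 v#4)) %% 2 == 1)); L_tac.
have hS : forall T n k e, L T -> L n -> L k -> L e ->
   L (fun inp v => sT (T inp v) (n inp v) (k inp v) (e inp v)).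
  move=> T1 n1 k1 e1 h1 h2 h3 h5.
  suff h : L (fun _ v => sT v#0 v#1 v#2 v#3).
    exact: (L_comp h (conj h1 (conj h2 (conj h3 (conj h5 I)))) (fs := [:: T1; n1; k1; e1])).
  by apply: (@L_sum (fun _ v => v#2) (fun _ v => digT v#1 v#2 v#0 v#4)); L_tac.
suff h : L (fun _ v => nat_of_bool (thrT v#0 v#1 v#2 v#3)).
  exact: (L_comp h (conj hT (conj hn (conj hk (conj ha I)))) (fs := [:: T; n; k; a])).
pose Wv (v : seq nat) e := wT v#0 v#1 v#2 e.
pose Sv (v : seq nat) e := sT v#0 v#1 v#2 e.
pose Mv (v : seq nat) := cpow v#0 (lgn v#1) v#2.
have hM : L (fun _ v => Mv v) by rewrite /Mv; L_tac.
apply: L_or; last first.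
  apply: (@L_has (fun _ v => Mv v) (fun _ w => Wv (behead w) w#0 && (w#4 <= Sv (behead w) w#0))) => //.
  apply: L_and; first by apply: hW; rewrite /=; L_tac.
  by apply: L_leq; first L_tac; apply: hS; L_tac.
apply: L_leq; first by L_tac.
apply: (@L_rec (fun _ v => v#3) (fun _ _ => 0)
  (fun _ w => (w#0 + col (Mv (behead (behead w))) (Wv (behead (behead w))) (Sv (behead (behead w))) w#1) %/ 2)
  (fun _ v => Mv v) (fun _ v a => carry (Mv v) (Wv v) (Sv v) a)) => //; L_tac.
- apply: L_div; last by L_tac.
  apply: L_add; first by L_tac.
  apply: (@L_sum (fun _ w => Mv (behead (behead w)))
    (fun _ u => nat_of_bool (Wv (behead (behead (behead u))) u#0 && (Sv (behead (behead (behead u))) u#0 == u#2)))).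
    exact: (L_behead2 hM).
  apply: L_and; first by apply: hW; L_tac.
  by apply: L_eq; last L_tac; apply: hS; L_tac.
- exact: L_PB.
- by move=> _ v i _; apply: carry_le.
Qed.

(** * Reading the instance from the input *)

Definition xbl (inp : nat -> sym) (len p : nat) : bool := (p < len) && (symn (inp p) == 2).

Definition nm (inp : nat -> sym) (len j : nat) : nat := num (xbl inp len) len j.

Definition qp (inp : nat -> sym) (len u : nat) : nat := qpos (nm inp len) u.

Lemma L_xbl l p : L l -> L p -> L (fun inp v => nat_of_bool (xbl inp (l inp v) (p inp v))).
Proof. by move=> hl hp; rewrite /xbl; L_tac. Qed.
#[export] Hint Resolve L_xbl : L.

Lemma L_zer l p : L l -> L p -> L (fun inp v => zer (xbl inp (l inp v)) (p inp v)).
Proof.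
move=> hl hp; suff h : L (fun inp v => zer (xbl inp v#0) v#1).
  exact: (L_comp h (conj hl (conj hp I)) (fs := [:: l; p])).
by apply: (@L_sum (fun _ v => v#1) (fun inp v => nat_of_bool (~~ xbl inp v#1 v#0))); L_tac.
Qed.
#[export] Hint Resolve L_zer : L.

Lemma L_nm l j : L l -> L j -> L (fun inp v => nm inp (l inp v) (j inp v)).
Proof.
move=> hl hp; suff h : L (fun inp v => nm inp v#0 v#1).
  exact: (L_comp h (conj hl (conj hp I)) (fs := [:: l; j])).
by apply: (@L_sum (fun _ v => v#0) (fun inp v => nat_of_bool (xbl inp v#1 v#0 && (zer (xbl inp v#1) v#0 == v#2)))); L_tac.
Qed.
#[export] Hint Resolve L_nm : L.

Lemma num_le g len j : num g len j <= len.
Proof.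
rewrite /num -[X in _ <= X]card_ord -sum1_card; apply: leq_sum => i _; exact: leq_b1.
Qed.

Lemma L_qp l u : L l -> L u -> L (fun inp v => qp inp (l inp v) (u inp v)).
Proof.
move=> hl hp; suff h : L (fun inp v => qp inp v#0 v#1).
  exact: (L_comp h (conj hl (conj hp I)) (fs := [:: l; u])).
apply: (@L_rec (fun _ v => v#1) (fun _ _ => 4) (fun inp w => w#0 + (nm inp w#2 w#0).+1)
  (fun _ v => 4 + v#1 * (v#0).+1) (fun inp v u => qp inp v#0 u)) => //; L_tac.
  by apply: L_PB; L_tac.
move=> inp v i hi; apply: (@leq_trans (4 + i * (v#0).+1)); last by rewrite leq_add2l leq_mul2r hi orbT.
elim: i {hi} => // i IH; rewrite /qp /qpos /= -/(qpos _ _) -/(qp _ _ _).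
by have := num_le (xbl inp v#0) v#0 (qp inp v#0 i); rewrite -/(nm _ _ _) mulSn; lia.
Qed.
#[export] Hint Resolve L_qp : L.

Lemma L_logx b l : L l -> L (fun inp v => nat_of_bool (logx (xbl inp (l inp v)) (l inp v) b)).
Proof.
move=> hl; suff h : L (fun inp v => nat_of_bool (logx (xbl inp v#0) v#0 b)).
  exact: (L_comp h (conj hl I) (fs := [:: l])).
pose deg inp (len u : nat) := nm inp len (qp inp len u).
pose nb inp (len u i : nat) := nm inp len ((qp inp len u).+1 + i).
apply: (@L_ext (fun inp v => nat_of_bool [&& (v#0 == 0) || ~~ xbl inp v#0 (v#0).-1, 4 <= zer (xbl inp v#0) v#0,
  qp inp v#0 (nm inp v#0 0) == zer (xbl inp v#0) v#0,
  nm inp v#0 1 < nm inp v#0 0, nm inp v#0 2 < nm inp v#0 0 &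
  all (fun u => [&& deg inp v#0 u <= b,
    all (fun i => all (fun j => (i == j) || (nb inp v#0 u i != nb inp v#0 u j)) (iota 0 (deg inp v#0 u)))
      (iota 0 (deg inp v#0 u)) &
    all (fun i => nb inp v#0 u i < nm inp v#0 0) (iota 0 (deg inp v#0 u))]) (iota 0 (nm inp v#0 0))])) => //.
have hd l1 u : L l1 -> L u -> L (fun inp v => deg inp (l1 inp v) (u inp v)).
  by move=> *; rewrite /deg; L_tac.
have hn l1 u i : L l1 -> L u -> L i -> L (fun inp v => nb inp (l1 inp v) (u inp v) (i inp v)).
  by move=> *; rewrite /nb; L_tac.
do 5 (apply: L_and; first by L_tac).
apply: (@L_all (fun inp v => nm inp v#0 0) (fun inp v => [&& deg inp v#1 v#0 <= b,
    all (fun i => all (fun j => (i == j) || (nb inp v#1 v#0 i != nb inp v#1 v#0 j)) (iota 0 (deg inp v#1 v#0)))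
      (iota 0 (deg inp v#1 v#0)) &
    all (fun i => nb inp v#1 v#0 i < nm inp v#1 0) (iota 0 (deg inp v#1 v#0))])); first by L_tac.
apply: L_and; first by L_tac.
apply: L_and.
  apply: (@L_all (fun inp v => deg inp v#1 v#0) (fun inp w =>
    all (fun j => (w#0 == j) || (nb inp w#2 w#1 w#0 != nb inp w#2 w#1 j)) (iota 0 (deg inp w#2 w#1)))).
    by apply: hd; L_tac.
  apply: (@L_all (fun inp v => deg inp v#2 v#1) (fun inp w =>
    (w#1 == w#0) || (nb inp w#3 w#2 w#1 != nb inp w#3 w#2 w#0))).
    by apply: hd; L_tac.
  by apply: L_or; [L_tac|apply: L_neg; apply: L_eq; apply: hn; L_tac].
apply: (@L_all (fun inp v => deg inp v#1 v#0) (fun inp w => nb inp w#2 w#1 w#0 < nm inp w#2 0)).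
  by apply: hd; L_tac.
by apply: L_leq; [apply: L_succ; apply: hn|]; L_tac.
Qed.
#[export] Hint Resolve L_logx : L.

Section Pre.
Variables (x : seq bool) (k : nat) (ch : nat -> bool) (V : nat).
Let inp := nth Blank (enc x k).

Lemma inp_lt p : p < size x -> inp p = bsym (nth false x p).
Proof. by move=> h; rewrite /inp /enc nth_cat size_map h (nth_map false). Qed.

Lemma inp_len : inp (size x) = Sep.
Proof. by rewrite /inp /enc nth_cat size_map ltnn subnn. Qed.

Lemma inp_k i : inp (size x + i).+1 = if i < k then S1 else Blank.
Proof.
rewrite /inp /enc nth_cat size_map ltnNge leqW ?leq_addr //=.
have -> : (size x + i).+1 - size x = i.+1 by lia.
by rewrite /= nth_nseq.
Qed.

Lemma xblE : xbl inp (size x) =1 nth false x.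
Proof.
move=> p; rewrite /xbl; case: ltnP => h; last by rewrite nth_default.
by rewrite inp_lt //; case: nth.
Qed.

Lemma nmE j : nm inp (size x) j = num (nth false x) (size x) j.
Proof. exact: num_ext xblE. Qed.

(* Variable 1 receives |x|, variable 2 the parameter; variable 3 is a loop guard. *)
Definition pre : prog :=
  let g1 := PAsg 3 (fun inp v => nat_of_bool (symn (inp v#1) != 3)) in
  let g2 := PAsg 3 (fun inp v => nat_of_bool (symn (inp (v#1 + v#2).+1) == 2)) in
  PSeq (PSeq g1 (PWhile 3 (PSeq (PAsg 1 (fun _ v => (v#1).+1)) g1)))
    (PSeq g2 (PWhile 3 (PSeq (PAsg 2 (fun _ v => (v#2).+1)) g2))).

Lemma wf_pre m : 3 < m -> wf m pre.
Proof. by move=> hm /=; repeat split; try lia; L_tac. Qed.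

Lemma preE rest p o : 0 < V -> size x <= V -> k <= V ->
  pexec inp ch V pre [:: 0, 0, 0, 0 & rest] p o [:: 0, size x, k, 0 & rest] p o.
Proof.
move=> V0 xV kV.
pose I1 i := [:: 0, i, 0, nat_of_bool (symn (inp i) != 3) & rest].
pose I2 i := [:: 0, size x, i, nat_of_bool (symn (inp (size x + i).+1) == 2) & rest].
have w1 : pexec inp ch V (PWhile 3 (PSeq (PAsg 1 (fun _ v => (v#1).+1)) (PAsg 3 (fun inp v => nat_of_bool (symn (inp v#1) != 3)))))
   (I1 0) p o (I1 (size x)) p o.
  apply: (@XWhile_n inp ch V 3 _ (size x) I1 (fun _ => p) (fun _ => o)).
    move=> i hi; split; first by rewrite /= inp_lt //; case: nth.
    apply: XSeq; first by apply: XAsg => /=; lia.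
    by apply: (@XAsg _ _ _ 3 (fun inp v => nat_of_bool (symn (inp v#1) != 3)) [:: 0, i.+1, 0, _ & rest]); case: (_ != _).
  by rewrite /= inp_len.
have w2 : pexec inp ch V (PWhile 3 (PSeq (PAsg 2 (fun _ v => (v#2).+1)) (PAsg 3 (fun inp v => nat_of_bool (symn (inp (v#1 + v#2).+1) == 2)))))
   (I2 0) p o (I2 k) p o.
  apply: (@XWhile_n inp ch V 3 _ k I2 (fun _ => p) (fun _ => o)).
    move=> i hi; split; first by rewrite /= inp_k hi.
    apply: XSeq; first by apply: XAsg => /=; lia.
    by apply: (@XAsg _ _ _ 3 (fun inp v => nat_of_bool (symn (inp (v#1 + v#2).+1) == 2)) [:: 0, size x, i.+1, _ & rest]); case: (_ == _).
  by rewrite /= inp_k ltnn.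
have -> : [:: 0, size x, k, 0 & rest] = I2 k by rewrite /I2 inp_k ltnn.
apply: XSeq; apply: XSeq.
- by apply: XAsg; case: (_ != _).
- exact: w1.
- by apply: XAsg; case: (_ == _).
- by rewrite /I1 inp_len; exact: w2.
Qed.

End Pre.

(** * Counting words, and walks announced bit by bit *)

Definition words (P : pred (seq bool)) (n : nat) :=
  exists s : seq (seq bool), [/\ uniq s, s =i P & size s = n].

Lemma words0 P : P =1 pred0 -> words P 0.
Proof. by move=> h; exists [::]; split=> // w; rewrite in_nil [RHS]h. Qed.

Lemma words1 (P : pred (seq bool)) : (forall w, P w = (w == [::])) -> words P 1.
Proof. by move=> h; exists [:: [::]]; split=> // w; rewrite inE [RHS]h. Qed.

Lemma words_cons (P P0 P1 : pred (seq bool)) n0 n1 : P [::] = false ->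
  (forall w, P (false :: w) = P0 w) -> (forall w, P (true :: w) = P1 w) ->
  words P0 n0 -> words P1 n1 -> words P (n0 + n1).
Proof.
move=> h h0 h1 [s0 [u0 e0 z0]] [s1 [u1 e1 z1]].
exists (map (cons false) s0 ++ map (cons true) s1); split.
- have inj (b : bool) : injective (cons b) by move=> y z [].
  rewrite cat_uniq !(map_inj_uniq (inj _)) u0 u1 andbT /=.
  by apply/hasPn => _ /mapP [w _ ->]; apply/negP => /mapP [w' _ []].
- move=> w; rewrite mem_cat (_ : (w \in P) = P w) //; case: w => [|[] w].
  + by rewrite h; apply/norP; split; apply/negP => /mapP [].
  + have -> : true :: w \in map (cons false) s0 = false by apply/negP => /mapP [].
    by rewrite mem_map ?h1 ?e1 // => y z [].
  + have -> : false :: w \in map (cons true) s1 = false by apply/negP => /mapP [].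
    by rewrite orbF mem_map ?h0 ?e0 // => y z [].
- by rewrite size_cat !size_map z0 z1.
Qed.

Section Guessing.
Variables (b n t : nat) (deg : nat -> nat) (nbr : nat -> nat -> nat).
Hypothesis t_lt : t < n.
Hypothesis deg_le : forall u, u < n -> deg u <= b.
Hypothesis nbr_lt : forall u i, u < n -> i < deg u -> nbr u i < n.
Hypothesis b0 : 0 < b.

(* Current vertex, number of remaining steps, index of the announced successor; n stands for failure. *)
Definition gst := (nat * nat * nat)%type.

(** One test serves both bits: a 0 takes successor [i] and needs [i < deg u], a 1 promises a later
    successor and needs [i.+1 < deg u]. Failing at once on an empty promise limits each step of a
    walk to [deg u] bits. *)
Definition gstep (s : gst) (c : bool) : gst :=
  let: (u, r, i) := s in
  if i + c < deg u then (if c then (u, r, i.+1) else (nbr u i, r.-1, 0)) else (n, 0, 0).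

Fixpoint gsts (s : gst) (c : nat -> bool) (j : nat) : gst :=
  if j is j'.+1 then gstep (gsts s c j') (c j') else s.

Lemma gsts_shift s c j : gsts s c j.+1 = gsts (gstep s (c 0)) (fun i => c i.+1) j.
Proof. by elim: j => // j IH; rewrite [LHS]/= -/(gsts s c j.+1) IH. Qed.

Definition ginv (s : gst) := s.1.2 = 0 \/ s.1.1 < n /\ s.2 < b.

Lemma ginv_step s c : 0 < s.1.2 -> ginv s -> ginv (gstep s c).
Proof.
case: s => -[u r] i /= r0 [/= e|/= [un ib]]; first by rewrite e in r0.
rewrite /ginv; case: ltnP => h; last by left.
have := deg_le un; case: c h => h; rewrite /= => hd; right; split=> //; first by lia.
by apply: nbr_lt => //; lia.
Qed.

(** A bit 1 raises [i]; a bit 0 removes a block of [b] and resets [i], which was below [b]. So there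
    are at most [b] bits per remaining step. *)
Lemma ginv_lt s c : ginv s -> 0 < s.1.2 -> (gstep s c).1.2 * b - (gstep s c).2 < s.1.2 * b - s.2.
Proof.
case: s => -[u r] i /= [/= -> //|/= [un ib] r0].
case: r r0 => // r _.
have := deg_le un; case: (ltnP (i + c) (deg u)) => h hd; rewrite ?mulSn //=; last by lia.
by case: c h => /= h; rewrite ?mulSn; lia.
Qed.

Lemma gsts_end s c : ginv s -> exists N, [/\ N <= s.1.2 * b - s.2, (gsts s c N).1.2 = 0 &
  forall j, j < N -> 0 < (gsts s c j).1.2 /\ ginv (gsts s c j)].
Proof.
have [m hm] := ubnP (s.1.2 * b - s.2).
elim: m s c hm => // m IH s c hm hs.
case: (posnP s.1.2) => r0; first by exists 0; split.
have hlt := ginv_lt (c 0) hs r0.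
have [|N [N1 N2 N3]] := IH (gstep s (c 0)) (fun i => c i.+1) _ (ginv_step (c 0) r0 hs).
  by apply: leq_trans hlt _; lia.
exists N.+1; rewrite gsts_shift; split=> //; first by apply: leq_ltn_trans N1 _.
by case=> // j hj; rewrite gsts_shift; apply: N3.
Qed.

(** The walk has to end exactly with the word, as an accepting path visits precisely the cells of
    its bits. *)
Fixpoint accw (s : gst) (w : seq bool) : bool :=
  if w is c :: w' then (0 < s.1.2) && accw (gstep s c) w' else (s.1.2 == 0) && (s.1.1 == t).

Lemma accw_gsts s w N : (gsts s (ext w) N).1.2 = 0 ->
  (forall j, j < N -> 0 < (gsts s (ext w) j).1.2) ->
  accw s w = (N == size w) && ((gsts s (ext w) N).1.1 == t).
Proof.
have ext_gsts (s1 : gst) c c' j : c =1 c' -> gsts s1 c j = gsts s1 c' j.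
  by move=> e; elim: j => //= j ->; rewrite e.
elim: w s N => [|c w IH] s [|N] h0 h.
- by rewrite /= in h0 *; rewrite h0.
- by have := h 0 isT; rewrite /=; case: eqP => [->|].
- by rewrite /= in h0 *; rewrite h0.
have r0 : 0 < s.1.2 := h 0 isT.
rewrite [LHS]/= r0 andTb gsts_shift [size _]/= eqSS.
rewrite gsts_shift in h0.
rewrite (IH _ N) //.
by move=> j hj; have := h j.+1 hj; rewrite gsts_shift.
Qed.

Lemma accw_dead w : accw (n, 0, 0) w = false.
Proof. by case: w => //=; apply/negbTE; rewrite neq_ltn t_lt orbT. Qed.

Lemma words_accw adj u r : (forall u, adj u = [seq nbr u i | i <- iota 0 (deg u)]) ->
  words (accw (u, r, 0)) (wk adj t u r).
Proof.
move=> hadj; elim: r u => [|r IH] u.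
  rewrite /=; case: eqP => [->|h].
    by apply: words1 => w; case: w => [|c w] //=; rewrite eqxx.
  by apply: words0 => w; case: w => [|c w] //=; apply/eqP.
(* Generalised to the last [d] successors: a word beginning with 0 takes the first of them, one
   beginning with 1 is left to the others. *)
suff h d i : i + d = deg u -> words (accw (u, r.+1, i)) (\sum_(v <- [seq nbr u j | j <- iota i d]) wk adj t v r).
  by rewrite /= hadj; apply: h.
elim: d i => [|d IHd] i hi.
  rewrite /= big_nil; apply: words0 => w; case: w => [|c w] //=.
  by rewrite ltnNge -hi addn0 leq_addr /= accw_dead.
rewrite /= big_cons; apply: (@words_cons _ (accw (nbr u i, r, 0)) (accw (u, r.+1, i.+1))) => //.
- by move=> w; rewrite /= addn0 ifT //; lia.
- move=> w; rewrite /=; case: ltnP => h; rewrite addn1 // in h *.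
  rewrite accw_dead; case: w => [|c w] //=; rewrite ifF ?accw_dead //; lia.
- by apply: IHd; lia.
Qed.

End Guessing.

(** * Computable bounds and auxiliary loops *)

Lemma prog_computable m P f : wf m P -> 0 < m ->
  (forall k c, exists V v' p', 0 < V /\
     pexec (nth Blank (enc [::] k)) c V P (nseq m 0) 0 [::] v' p' (nseq (f k) S1)) ->
  computable f.
Proof.
move=> wP m0 h; have [M [K [_ hM]]] := prog_TM wP m0.
exists M => k c; have [V [v' [p' [V0 hx]]]] := h k c.
by have [n [h1 _ _ h4 _]] := hM _ _ _ _ _ _ _ V0 hx; exists n.
Qed.

Section Loops.
Variables (inp : nat -> sym) (ch : nat -> bool) (V : nat).

(** Exponentiation leaves the class [L] and is therefore a loop of the program. Its exponents will
    depend on the parameter only, so that they may be paid for in space. *)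
Definition pow2P : prog :=
  PSeq (PAsg 4 (fun _ _ => 1)) (PWhile 5 (PSeq (PAsg 4 (fun _ v => v#4 + v#4)) (PAsg 5 (fun _ v => (v#5).-1)))).

Lemma wf_pow2P m : 5 < m -> wf m pow2P.
Proof. by move=> hm /=; repeat split; try lia; L_tac. Qed.

Lemma pow2PE a b c d e n rest p o : 0 < V -> n <= V -> 2 ^ n <= V ->
  pexec inp ch V pow2P [:: a, b, c, d, e, n & rest] p o [:: a, b, c, d, 2 ^ n, 0 & rest] p o.
Proof.
move=> V0 nV hV; apply: XSeq; first by apply: XAsg.
pose I i := [:: a, b, c, d, 2 ^ i, n - i & rest].
have -> : [:: a, b, c, d, 2 ^ n, 0 & rest] = I n by rewrite /I subnn.
have -> : set_nth 0 [:: a, b, c, d, e, n & rest] 4 1 = I 0 by rewrite /I subn0.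
apply: (@XWhile_n inp ch V 5 _ n I (fun _ => p) (fun _ => o)); last by rewrite /= subnn.
move=> i hi; split; first by rewrite /= subn_gt0.
apply: XSeq; first apply: XAsg.
  by rewrite /= addnn -mul2n -expnS; apply: leq_trans hV; rewrite leq_exp2l.
rewrite /= addnn -mul2n -expnS.
have -> : I i.+1 = set_nth 0 [:: a, b, c, d, 2 ^ i.+1, n - i & rest] 5 (n - i).-1 by rewrite /I /= subnS.
by apply: (@XAsg _ _ _ 5 (fun _ v => (v#5).-1) [:: a, b, c, d, 2 ^ i.+1, n - i & rest]); rewrite /=; lia.
Qed.

Definition outP : prog := PWhile 5 (PSeq (POut S1) (PAsg 5 (fun _ v => (v#5).-1))).

Lemma wf_outP m : 5 < m -> wf m outP.
Proof. by move=> hm /=; repeat split; try lia; L_tac. Qed.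

Lemma outPE a b c d e n rest p o : n <= V ->
  pexec inp ch V outP [:: a, b, c, d, e, n & rest] p o [:: a, b, c, d, e, 0 & rest] p (o ++ nseq n S1).
Proof.
move=> nV.
pose I i := [:: a, b, c, d, e, n - i & rest].
pose O i := o ++ nseq i S1.
have -> : [:: a, b, c, d, e, 0 & rest] = I n by rewrite /I subnn.
have -> : [:: a, b, c, d, e, n & rest] = I 0 by rewrite /I subn0.
have {1}-> : o = O 0 by rewrite /O cats0.
apply: (@XWhile_n inp ch V 5 _ n I (fun _ => p) O); last by rewrite /= subnn.
move=> i hi; split; first by rewrite /= subn_gt0.
have -> : O i.+1 = rcons (O i) S1 by rewrite /O rcons_cat -cats1 -[i.+1]addn1 nseqD.
apply: XSeq; first exact: XOut.
have -> : I i.+1 = set_nth 0 (I i) 5 (n - i).-1 by rewrite /I /= subnS.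
by apply: (@XAsg _ _ _ 5 (fun _ v => (v#5).-1) (I i)); rewrite /=; lia.
Qed.

End Loops.

Lemma L_computable (f : nat -> nat) : L (fun _ v => f v#2) -> computable f.
Proof.
move=> hf; apply: (@prog_computable 6 (PSeq pre (PSeq (PAsg 5 (fun _ v => f v#2)) outP))) => //.
  by split; [exact: wf_pre|split; [|exact: wf_outP]].
move=> k c; exists (maxn k (f k)).+1, [:: 0; 0; k; 0; 0; 0], 0; split=> //.
apply: XSeq; first by apply: (@preE [::] k) => //; lia.
apply: XSeq; first by apply: XAsg => /=; lia.
apply: (@outPE _ _ _ 0 0 k 0 0 (f k) [::]); lia.
Qed.

(** Variable 4 will contain [2 ^ (k * k)]; the first argument of [thrT] is then the bound of
    [lgn_pow] on the number of tuples. *)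
Definition guard (b : nat) : fn := fun inp v => nat_of_bool
  (logx (xbl inp v#1) v#1 b &&
   thrT (v#4 * ((nm inp v#1 0 + nm inp v#1 0) ^ 4)) (nm inp v#1 0) v#2 (nm inp v#1 3)).

Lemma L_guard b : L (guard b).
Proof.
apply: L_and; first by L_tac.
apply: L_thrT; L_tac.
apply: L_mul; first by L_tac.
apply: (@L_ext (fun inp v => (nm inp v#1 0 + nm inp v#1 0) * ((nm inp v#1 0 + nm inp v#1 0) *
  ((nm inp v#1 0 + nm inp v#1 0) * (nm inp v#1 0 + nm inp v#1 0))))) => //.
by L_tac.
Qed.

Definition vdeg inp (v : seq nat) := nm inp v#1 (qp inp v#1 v#7).

(** Variables 7, 8 and 9 are the state of [gstep], 10 is the new bit. The outcome of the test is
    saved in 11 before the state it refers to is overwritten. *)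
Definition guess_loop : prog :=
  PWhile 8 (PSeq (PGuess 10) (PSeq
    (PAsg 11 (fun inp v => nat_of_bool (v#9 + v#10 < vdeg inp v))) (PSeq
    (PAsg 7 (fun inp v => if v#11 == 1 then (if v#10 == 1 then v#7
        else nm inp v#1 ((qp inp v#1 v#7).+1 + v#9)) else nm inp v#1 0)) (PSeq
    (PAsg 8 (fun inp v => if v#11 == 1 then (if v#10 == 1 then v#8 else (v#8).-1) else 0))
    (PAsg 9 (fun inp v => if v#11 == 1 then (if v#10 == 1 then (v#9).+1 else 0) else 0)))))).

Definition memb (b : nat) : prog :=
  PSeq pre (PSeq (PAsg 5 (fun _ v => v#2 * v#2)) (PSeq pow2P (PSeq (PAsg 6 (guard b))
    (PIf 6 (PSeq (PAsg 7 (fun inp v => nm inp v#1 1)) (PSeq (PAsg 8 (fun inp v => nm inp v#1 3))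
       (PSeq guess_loop (PAsg 0 (fun inp v => nat_of_bool (v#7 == nm inp v#1 2))))))
     PSkip)))).

Lemma wf_memb b : wf 12 (memb b).
Proof.
split; first exact: wf_pre.
split; first by split=> //; L_tac.
split; first exact: wf_pow2P.
split; first by split=> //; exact: L_guard.
by rewrite /= /vdeg; repeat split; L_tac.
Qed.

Section Member.
Variables (b : nat) (x : seq bool) (k : nat) (c : nat -> bool).
Let inp := nth Blank (enc x k).
Let V := size x + k + k * k + 2 ^ (k * k) + 2.
Let f := num (nth false x) (size x).
Let deg u := f (qpos f u).
Let nbr u i := f ((qpos f u).+1 + i).
Let valid := logx (nth false x) (size x) b && (2 ^ f 3 <= f 0 ^ k).
Notation gs := (gsts (f 0) deg nbr (f 1, f 3, 0) c).

Lemma f_le j : f j <= size x. Proof. exact: num_le. Qed.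

Lemma qpE u : qp inp (size x) u = qpos f u.
Proof. by rewrite /qp /qpos; apply: eq_iter => q; rewrite nmE. Qed.

Lemma guardE v4 rest : v4 = 2 ^ (k * k) ->
  guard b inp [:: 0, size x, k, 0, v4 & rest] = valid.
Proof.
move=> ->; rewrite /guard /= !nmE -/f /valid.
have -> : logx (xbl inp (size x)) (size x) b = logx (nth false x) (size x) b.
  rewrite /logx (zer_ext _ (xblE x k)) xblE.
  have e : num (xbl inp (size x)) (size x) =1 num (nth false x) (size x).
    by move=> j; apply: num_ext; apply: xblE.
  have eq u : qpos (num (xbl inp (size x)) (size x)) u = qpos (num (nth false x) (size x)) u.
    by rewrite /qpos; apply: eq_iter => q; rewrite e.
  do 3 congr (_ && _); rewrite ?eq ?e //.
  do 2 congr (_ && _); apply: eq_all => u; rewrite !eq !e; congr [&& _, _ & _].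
    by apply: eq_all => i; apply: eq_all => j; rewrite !e.
  by apply: eq_all => i; rewrite !e.
case: (boolP (logx _ _ _)) => //= hl; congr nat_of_bool.
have n0 : 0 < f 0.
  by move: hl; rewrite /logx -/f => /and5P [_ _ _ h _]; exact: leq_ltn_trans h.
by rewrite thrTE //; apply: lgn_pow.
Qed.

Lemma valid_props : valid -> [/\ f 2 < f 0, f 1 < f 0, (forall u, u < f 0 -> deg u <= b),
  (forall u i, u < f 0 -> i < deg u -> nbr u i < f 0) & f 3 <= k * lg (size x)].
Proof.
case/andP; rewrite /logx -/f => /and5P [_ _ _ h1 /andP [h2 /allP ha]] hp; split=> //.
- by move=> u hu; have := ha u; rewrite mem_iota => /(_ hu) /and3P [].
- move=> u i hu hi; have := ha u; rewrite mem_iota => /(_ hu) /and3P [_ _ /allP /(_ i)].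
  by rewrite mem_iota => /(_ hi).
(* Unary coding gives [f 0 <= |x| < 2 ^ lg |x|], which turns the threshold into a bound on the
   length of the walk and so on the choice bits. *)
- have h : f 0 < 2 ^ lg (size x).
    by apply: leq_ltn_trans (f_le 0) _; apply: trunc_log_ltn.
  rewrite mulnC -(@leq_exp2l 2) // expnM; apply: leq_trans hp _.
  by apply: leq_expl; exact: ltnW.
Qed.

Lemma memb_invalid : ~~ valid -> exists v, pexec inp c V (memb b) (nseq 12 0) 0 [::] v 0 [::] /\ nth 0 v 0 = 0.
Proof.
move=> nv; exists [:: 0; size x; k; 0; 2 ^ (k * k); 0; 0; 0; 0; 0; 0; 0]; split=> //.
have V0 : 0 < V by rewrite /V; lia.
apply: XSeq; first by apply: preE => //; rewrite /V; lia.
apply: XSeq; first by apply: XAsg; rewrite /V /=; lia.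
apply: XSeq; first by apply: (@pow2PE _ _ _ 0 (size x) k 0 0 (k * k)) => //; rewrite /V; lia.
apply: XSeq; first by apply: XAsg; rewrite guardE //; case: (valid).
rewrite guardE // (negbTE nv); apply: XIf; exact: XSkip.
Qed.

Lemma memb_valid : 0 < b -> valid -> exists v N, pexec inp c V (memb b) (nseq 12 0) 0 [::] v N [::] /\
  [/\ nth 0 v 0 = ((gs N).1.1 == f 2), N <= b * (k * lg (size x)), (gs N).1.2 = 0 &
   forall j, j < N -> 0 < (gs j).1.2].
Proof.
move=> b0 hv; have [t_lt s_lt deg_le nbr_lt a_le] := valid_props hv.
have [N [N1 N2 N3]] := @gsts_end b (f 0) (f 2) deg nbr t_lt deg_le nbr_lt b0 (f 1, f 3, 0) c (or_intror (conj s_lt b0)).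
(* The variables before iteration [j]; entries 10 and 11 still contain what the previous iteration
   left there. *)
pose I j : seq nat := [:: 0; size x; k; 0; 2 ^ (k * k); 0; 1; (gs j).1.1; (gs j).1.2; (gs j).2;
   (if j is j'.+1 then nat_of_bool (c j') else 0);
   (if j is j'.+1 then nat_of_bool ((gs j').2 + c j' < deg (gs j').1.1) else 0)].
have V0 : 0 < V by rewrite /V; lia.
exists (set_nth 0 (I N) 0 ((gs N).1.1 == f 2)), N; split; last first.
  split=> //; last by move=> j /N3 [].
  apply: leq_trans N1 _; rewrite /= subn0 mulnC leq_mul2l a_le; exact: orbT.
apply: XSeq; first by apply: preE => //; rewrite /V; lia.
apply: XSeq; first by apply: XAsg; rewrite /V /=; lia.
apply: XSeq; first by apply: (@pow2PE _ _ _ 0 (size x) k 0 0 (k * k)) => //; rewrite /V; lia.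
apply: XSeq; first by apply: XAsg; rewrite guardE //; case: (valid).
rewrite guardE // hv; apply: XIf => /=.
apply: XSeq; first by apply: XAsg; rewrite /= nmE; apply: leq_trans (f_le _) _; rewrite /V; lia.
rewrite /= nmE -/f.
apply: XSeq; first by apply: XAsg; rewrite /= nmE; apply: leq_trans (f_le _) _; rewrite /V; lia.
rewrite /= nmE -/f.
have hlast : pexec inp c V (PAsg 0 (fun inp v => nat_of_bool (v#7 == nm inp v#1 2))) (I N) N [::]
    (set_nth 0 (I N) 0 ((gs N).1.1 == f 2)) N [::].
  have := @XAsg inp c V 0 (fun inp v => nat_of_bool (v#7 == nm inp v#1 2)) (I N) N [::].
  rewrite [(I N)#7]/= [(I N)#1]/= nmE; apply; case: (_ == _); rewrite /V; lia.
apply: XSeq hlast.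
apply: (@XWhile_n inp c V 8 _ N I id (fun _ => [::])) => // j hj.
have [r0 inv] := N3 j hj; split=> //.
case: inv => [e|[un ib]]; first by rewrite e in r0.
have hg : gs j.+1 = gstep (f 0) deg nbr (gs j) (c j) by [].
set u := (gs j).1.1 in un *; set r := (gs j).1.2 in r0 *; set i := (gs j).2 in ib *.
have eg : gs j = (u, r, i) by rewrite /u /r /i; case: (gs j) => -[].
have r_le : r <= f 3.
  rewrite /r; elim: (j) => //= j' IH; move: IH; case: (gs j') => -[u1 r1] i1 /= h.
  by do ?[case: ifP => _] => //=; apply: leq_trans (leq_pred _) h.
have rV : r <= V by apply: leq_trans r_le _; apply: leq_trans (f_le _) _; rewrite /V; lia.
have degV : deg u <= size x by exact: f_le.
have bV (a : bool) : a <= V by case: a; rewrite /V; lia.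
apply: XSeq; first exact: XGuess.
rewrite /= -/u -/r -/i.
apply: XSeq; first by apply: XAsg; exact: bV.
rewrite /= /vdeg /= qpE nmE -/(deg u).
have fV m : f m <= V by apply: leq_trans (f_le _) _; rewrite /V; lia.
apply: XSeq; first apply: XAsg.
  rewrite /= qpE !nmE; do ?[case: ifP => _]; rewrite ?fV //.
  by apply: ltnW; apply: leq_trans un (fV 0).
rewrite /= qpE !nmE -/(nbr u i) !eqb1.
apply: XSeq; first apply: XAsg.
  by rewrite /=; do ?[case: ifP => _] => //; apply: leq_trans (leq_pred _) rV.
rewrite /= !eqb1 -/r.
have -> : I j.+1 = set_nth 0 [:: 0; size x; k; 0; 2 ^ (k * k); 0; 1;
   (if i + c j < deg u then if c j then u else nbr u i else f 0);
   (if i + c j < deg u then if c j then r else r.-1 else 0); i; nat_of_bool (c j); nat_of_bool (i + c j < deg u)]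
   9 (if i + c j < deg u then if c j then i.+1 else 0 else 0).
  rewrite /I hg eg /= .
  by case: (_ < _) => //=; case: (c j).
have -> : (if i + c j < deg u then if c j then i.+1 else 0 else 0) =
  (fun inp v => if v#11 == 1 then (if v#10 == 1 then (v#9).+1 else 0) else 0) inp
   [:: 0; size x; k; 0; 2 ^ (k * k); 0; 1;
   (if i + c j < deg u then if c j then u else nbr u i else f 0);
   (if i + c j < deg u then if c j then r else r.-1 else 0); i; nat_of_bool (c j); nat_of_bool (i + c j < deg u)].
  by rewrite /= !eqb1.
apply: XAsg; rewrite /= !eqb1; case: ifP => // h; case: ifP => // cj.
move: h; rewrite cj addn1 => h; apply: leq_trans (leq_trans (ltnW h) degV) _; rewrite /V; lia. Qed.

End Member.

Lemma trunc_logD_le n m e : n <= 2 ^ (m + e) -> trunc_log 2 n <= m + e.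
Proof.
case: (posnP n) => [->|n0 h]; first by rewrite trunc_log0.
rewrite -(@leq_exp2l 2) //; apply: leq_trans h; exact: trunc_logP.
Qed.

Lemma memb_space (x : seq bool) k :
  (trunc_log 2 (size x + k + k * k + 2 ^ (k * k) + 2).+2).+1 <= 6 * (lg (size x) + k * k).
Proof.
have h1 : size x < 2 ^ lg (size x) by apply: trunc_log_ltn.
have h2 : k * k < 2 ^ (k * k) by apply: ltn_expl.
have h3 : 0 < 2 ^ lg (size x) by rewrite expn_gt0.
have h4 : k <= k * k by case: (k) => // k'; rewrite leq_pmulr.
have : (size x + k + k * k + 2 ^ (k * k) + 2).+2 <= 2 ^ (lg (size x) + k * k + 3).
  rewrite !expnD; have : 0 < 2 ^ (k * k) by rewrite expn_gt0.
  move: (2 ^ (k * k)) (2 ^ lg (size x)) h1 h2 h3 => a c; nia.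
move/trunc_logD_le; rewrite /lg; lia.
Qed.

Theorem logreach_in b : 0 < b -> sharp_paraBeta_L (logreach b).
Proof.
move=> b0; have [M [K [ro hM]]] := prog_TM (wf_memb b) (isT : 0 < 12).
have V0 (x : seq bool) k : 0 < size x + k + k * k + 2 ^ (k * k) + 2 by lia.
pose f x := num (nth false x) (size x).
pose valid x k := logx (nth false x) (size x) b && (2 ^ f x 3 <= f x 0 ^ k).
pose gs x c := gsts (f x 0) (fun u => f x (qpos (f x) u)) (fun u i => f x ((qpos (f x) u).+1 + i)) (f x 1, f x 3, 0) c.
have hrun x k c : exists n N, [/\ halting M (cq (run M x k c n)), chp (run M x k c n) = N,
   N <= b * k * lg (size x),
   (forall n', space (run M x k c n') <= K * (6 * (lg (size x) + k * k))) &
   if valid x k then [/\ accepting M (cq (run M x k c n)) = ((gs x c N).1.1 == f x 2), (gs x c N).1.2 = 0 &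
     forall j, j < N -> 0 < (gs x c j).1.2] else accepting M (cq (run M x k c n)) = false].
  case: (boolP (valid x k)) => [hv|hv].
    have [v [N [hx [h1 h2 h3 h4]]]] := memb_valid c b0 hv.
    have [n [e1 e2 e3 e4 e5]] := hM _ _ _ _ _ _ _ (V0 x k) hx.
    exists n, N; split=> //; first by rewrite -mulnA.
      by move=> n'; apply: leq_trans (e5 n') _; rewrite leq_mul2l memb_space orbT.
    by split=> //; rewrite e2 h1; case: (_ == _).
  have [v [hx h1]] := memb_invalid c hv.
  have [n [e1 e2 e3 e4 e5]] := hM _ _ _ _ _ _ _ (V0 x k) hx.
  exists n, 0; split=> //; last by rewrite e2 h1.
  by move=> n'; apply: leq_trans (e5 n') _; rewrite leq_mul2l memb_space orbT.
exists M; split.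
  (* The summand [k * k] pays for numbers up to [2 ^ (k * k)]. *)
  exists (fun k => k * k); split; first by apply: (@L_computable (fun k => k * k)); L_tac.
  exists (K * 6) => x k c n; have [n1 [N [_ _ _ h _]]] := hrun x k c.
  by rewrite -mulnA; apply: h.
split.
  exists (fun k => b * k); split; first by apply: (@L_computable (fun k => b * k)); L_tac.
  move=> x k c n; have [n1 [N [h1 <- h2 _ _]]] := hrun x k c.
  apply: leq_trans h2; case: (leqP n n1) => hn; first exact: run_chp_le.
  by rewrite (run_halt h1 (ltnW hn)).
split=> // x k; rewrite logreachE -/(f x) -/(valid x k).
case: (boolP (valid x k)) => hv; last first.
  exists [::]; split=> //; split=> // w; split=> // hw.
  have [n [N [h1 _ _ _]]] := hrun x k (ext w); rewrite (negbTE hv) => h5.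
  by have [] := (acc_path_halt ro h1).1 hw; rewrite h5.
have [t_lt s_lt deg_le nbr_lt _] := valid_props hv.
have [s [u e z]] := @words_accw b (f x 0) (f x 2) (fun u => f x (qpos (f x) u)) (fun u i => f x ((qpos (f x) u).+1 + i))
   t_lt b0 (succs (f x)) (f x 1) (f x 3) (fun u => erefl).
exists s; split=> //; split=> // w; rewrite e.
have [n [N [h1 h2 _ _]]] := hrun x k (ext w); rewrite hv => -[h3 h4 h5].
rewrite (acc_path_halt ro h1) h3 h2.
change (accw (f x 0) (f x 2) (fun u => f x (qpos (f x) u)) (fun u i => f x ((qpos (f x) u).+1 + i)) (f x 1, f x 3, 0) w <->
  (gs x (ext w) N).1.1 == f x 2 /\ N = size w).
rewrite (accw_gsts _ h4 h5); split; first by move=> /andP [/eqP -> ->].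
by move=> [-> ->]; rewrite eqxx.
Qed.

(** * Hardness *)

Fixpoint tval (B : nat) (w : sym -> nat) (t : seq sym) : nat :=
  if t is s :: t' then w s + B * tval B w t' else 0.

Section Tval.
Variables (B : nat) (w : sym -> nat).
Hypothesis B0 : 0 < B.
Hypothesis w0 : w Blank = 0.
Hypothesis wB : forall s, w s < B.

Lemma tval_cat_blank t n : tval B w (t ++ nseq n Blank) = tval B w t.
Proof.
elim: t => [|s t IH] /=; last by rewrite IH.
by elim: n => //= n ->; rewrite w0 muln0.
Qed.

Lemma tval_lt t : tval B w t < B ^ size t.
Proof. elim: t => //= s t IH; rewrite expnS; have := wB s; nia. Qed.

Lemma tval_digit t h : (tval B w t %/ B ^ h) %% B = w (nth Blank t h).
Proof.
elim: t h => [|s t IH] h; first by rewrite nth_nil div0n mod0n w0.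
case: h => [|h] /=; first by rewrite divn1 addnC mulnC modnMDl modn_small.
by rewrite expnS divnMA addnC mulnC divnMDl // (divn_small (wB s)) addn0 IH.
Qed.

Lemma tval_set t h s :
  tval B w (set_nth Blank t h s) = tval B w t - w (nth Blank t h) * B ^ h + w s * B ^ h.
Proof.
have aux n s1 : tval B w (ncons n Blank [:: s1]) = w s1 * B ^ n.
  by elim: n => [|n IH] /=; rewrite ?muln0 ?addn0 ?muln1 // w0 IH expnS; lia.
elim: t h => [|a t IH] h.
  by rewrite set_nth_nil aux nth_nil w0.
case: h => [|h] /=; first by rewrite !muln1 addnC addKn addnC; lia.
rewrite IH expnS.
have : w (nth Blank t h) * B ^ h <= tval B w t.
  by rewrite -tval_digit; apply: leq_trans (leq_divM _ (B ^ h)); rewrite leq_mul2r leq_mod orbT.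
move: (tval B w t) (w (nth _ _ _)) (B ^ h) => X Y Z hle.
rewrite mulnDr mulnBr; move: hle => /(leq_mul (leqnn B)); lia.
Qed.

End Tval.

Definition iw (s : sym) : nat := isS1 s.

Lemma idx_valE t : idx_val t = tval 2 iw t.
Proof.
rewrite /idx_val; elim: t => [|a t IH]; first by rewrite big_ord0.
rewrite big_ord_recl /= -IH big_distrr /=; congr (_ + _); first by case: a.
by apply: eq_bigr => i _; rewrite /= /bump /= add1n expnS; case: (nth _ _ _); rewrite ?muln0.
Qed.

Fixpoint mixed (T : nat) (l : seq nat) : nat := if l is a :: l' then a + T * mixed T l' else 0.

Lemma mixed_lt T l : all (fun a => a < T) l -> mixed T l < T ^ size l.
Proof. elim: l => //= a l IH /andP [ha /IH h]; rewrite expnS; nia. Qed.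

Lemma mixed_digit T l i : all (fun a => a < T) l -> 0 < T -> (mixed T l %/ T ^ i) %% T = nth 0 l i.
Proof.
move=> hl T0; elim: l i hl => [|a l IH] i /=; first by rewrite nth_nil div0n mod0n.
move=> /andP [ha hl]; case: i => [|i] /=; first by rewrite divn1 addnC mulnC modnMDl modn_small.
by rewrite expnS divnMA addnC mulnC divnMDl // (divn_small ha) addn0 IH.
Qed.

Definition symof (n : nat) : sym := match n with 0 => Blank | 1 => S0 | 2 => S1 | _ => Sep end.

Lemma symnK s : symof (symn s) = s. Proof. by case: s. Qed.

Lemma symn_lt s : symn s < 4. Proof. by case: s. Qed.

Definition mvn (m : mv) : nat := match m with ML => 0 | MS => 1 | MR => 2 end.

(** A head at [h] is stored as [B ^ h]: the symbol under it is then a quotient followed by a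
    remainder, and a move multiplies or divides. The power 1 marks the left end, where a left move
    stays. *)
Definition movep (B m p : nat) : nat :=
  if m == 0 then (if p == 1 then 1 else p %/ B) else if m == 1 then p else p * B.

Lemma movepE B m h : 1 < B -> movep B (mvn m) (B ^ h) = B ^ move_head m h.
Proof.
move=> B1; case: m; rewrite /movep //=; last by rewrite -expnSr.
case: h => //= h; rewrite expnS mulKn; last exact: ltnW.
by rewrite ifF //; apply/negbTE; have := expn_gt0 B h; nia.
Qed.

Definition movec (m c : nat) : nat := if m == 0 then c.-1 else if m == 1 then c else c.+1.

Lemma movecE m c : movec (mvn m) c = move_head m c.
Proof. by case: m. Qed.

Section Coding.
Variable M : TM.

Definition nQ : nat := size (enum (st M)).
Definition qn (q : st M) : nat := index q (enum (st M)).
Definition nq (i : nat) : st M := nth (q0 M) (enum (st M)) i.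

Lemma qnK q : nq (qn q) = q. Proof. by rewrite /nq nth_index // mem_enum. Qed.
Lemma qn_lt q : qn q < nQ. Proof. by rewrite index_mem mem_enum. Qed.
Lemma nQ0 : 0 < nQ. Proof. exact: leq_ltn_trans (leq0n _) (qn_lt (q0 M)). Qed.

Definition dres := (st M * sym * mv * sym * mv * mv * option sym)%type.

(** The transition function as a finite table, indexed by the state and four base 4 digits for the
    symbols, whence 256; [g] selects a component of the result. *)
Definition tab (g : dres -> nat) : seq nat :=
  [seq g (delta M (nq (i %/ 256)) (symof ((i %/ 64) %% 4)) (symof ((i %/ 16) %% 4))
      (symof ((i %/ 4) %% 4)) (symof (i %% 4))) | i <- iota 0 (nQ * 256)].

Definition look g q i w x c := nth 0 (tab g) ((((q * 4 + i) * 4 + w) * 4 + x) * 4 + c).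

Lemma lookE g q i w x c :
  look g (qn q) (symn i) (symn w) (symn x) (symn c) = g (delta M q i w x c).
Proof.
have hq := qn_lt q.
rewrite /look (nth_map 0); last first.
  by rewrite size_iota; have := (symn_lt i, symn_lt w, symn_lt x, symn_lt c) => -[[[]]]; lia.
rewrite nth_iota; last first.
  by have := (symn_lt i, symn_lt w, symn_lt x, symn_lt c) => -[[[]]]; lia.
rewrite add0n; set e := _ + symn c.
have -> : e %/ 256 = qn q.
  by rewrite /e; have := (symn_lt i, symn_lt w, symn_lt x, symn_lt c) => -[[[]]]; lia.
have -> : (e %/ 64) %% 4 = symn i.
  by rewrite /e; have := (symn_lt i, symn_lt w, symn_lt x, symn_lt c) => -[[[]]]; lia.
have -> : (e %/ 16) %% 4 = symn w.
  by rewrite /e; have := (symn_lt i, symn_lt w, symn_lt x, symn_lt c) => -[[[]]]; lia.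
have -> : (e %/ 4) %% 4 = symn x.
  by rewrite /e; have := (symn_lt i, symn_lt w, symn_lt x, symn_lt c) => -[[[]]]; lia.
have -> : e %% 4 = symn c.
  by rewrite /e; have := (symn_lt i, symn_lt w, symn_lt x, symn_lt c) => -[[[]]]; lia.
by rewrite qnK !symnK.
Qed.

Lemma look_lt g q i w x c m : 0 < m -> (forall d, g d < m) -> look g q i w x c < m.
Proof.
move=> m0 h; rewrite /look; set e := _ + c; case: (ltnP e (nQ * 256)) => he.
  by rewrite (nth_map 0) ?size_iota.
by rewrite nth_default // size_map size_iota.
Qed.

Definition g_q (d : dres) := qn d.1.1.1.1.1.1.
Definition g_ws (d : dres) := symn d.1.1.1.1.1.2.
Definition g_wm (d : dres) := mvn d.1.1.1.1.2.
Definition g_is (d : dres) := symn d.1.1.1.2.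
Definition g_im (d : dres) := mvn d.1.1.2.
Definition g_cm (d : dres) := mvn d.1.2.
Definition g_os (d : dres) : nat := if d.2 is Some _ then 1 else 0.

(* Digits of a coded configuration: 0 work tape (in base 4), 1 work head h as 4^h, 2 index tape,
   3 index head as 2^h, 4 value of the index tape, 5 choice head, 6 output length mod T + 1. *)
Definition dg (T i c : nat) : nat := (c %/ nQ %/ T.+1 ^ i) %% T.+1.

Definition wsym T c := (dg T 0 c %/ dg T 1 c) %% 4.
Definition isym T c := (dg T 2 c %/ (dg T 3 c * dg T 3 c)) %% 4.
Definition csym T cb c := if dg T 5 c == 0 then 3 else cb.+1.

Definition lk g (inp : nat -> sym) T off cb c :=
  look g (c %% nQ) (symn (inp (off + dg T 4 c))) (wsym T c) (isym T c) (csym T cb c).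

(** Reduction modulo [T.+1] makes the coded step total: its value is a code in range even at numbers
    that code no configuration. *)
Definition mk (T q : nat) (l : seq nat) : nat :=
  q + nQ * mixed T.+1 [seq a %% T.+1 | a <- l].

(** The index head [2 ^ h] serves twice: it is the weight of its cell in the address, and its square
    is the weight in the base 4 contents. Contents and address are thus updated side by side. *)
Definition stp (inp : nat -> sym) T off cb c : nat :=
  mk T (lk g_q inp T off cb c)
   [:: dg T 0 c - wsym T c * dg T 1 c + lk g_ws inp T off cb c * dg T 1 c;
       movep 4 (lk g_wm inp T off cb c) (dg T 1 c);
       dg T 2 c - isym T c * (dg T 3 c * dg T 3 c) + lk g_is inp T off cb c * (dg T 3 c * dg T 3 c);
       movep 2 (lk g_im inp T off cb c) (dg T 3 c);
       dg T 4 c - (isym T c == 2) * dg T 3 c + (lk g_is inp T off cb c == 2) * dg T 3 c;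
       movec (lk g_cm inp T off cb c) (dg T 5 c);
       dg T 6 c + lk g_os inp T off cb c].

Definition cfgl (C : config M) : seq nat :=
  [:: tval 4 symn (wt C); 4 ^ wh C; tval 4 symn (itp C); 2 ^ ih C; idx_val (itp C); chp C; size (out C)].

Definition ec (T : nat) (C : config M) : nat := mk T (qn (cq C)) (cfgl C).

Lemma mk_lt T q l : q < nQ -> mk T q l < nQ * T.+1 ^ size l.
Proof.
move=> hq; rewrite /mk -(size_map (fun a => a %% T.+1)).
have : mixed T.+1 [seq a %% T.+1 | a <- l] < T.+1 ^ size [seq a %% T.+1 | a <- l].
  by apply: mixed_lt; apply/allP => _ /mapP [a _ ->]; rewrite ltn_mod.
nia.
Qed.

Lemma mk_q T q l : q < nQ -> mk T q l %% nQ = q.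
Proof. by move=> hq; rewrite /mk addnC mulnC modnMDl modn_small. Qed.

Lemma mk_dg T q l i : q < nQ -> dg T i (mk T q l) = nth 0 [seq a %% T.+1 | a <- l] i.
Proof.
move=> hq; rewrite /dg /mk addnC mulnC divnMDl ?nQ0 // (divn_small hq) addn0.
by rewrite mixed_digit //; apply/allP => _ /mapP [a _ ->]; rewrite ltn_mod.
Qed.

Lemma stp_lt inp T off cb c : stp inp T off cb c < nQ * T.+1 ^ 7.
Proof.
apply: mk_lt; apply: look_lt; first exact: nQ0.
by move=> d; apply: qn_lt.
Qed.

Lemma ec_lt T C : ec T C < nQ * T.+1 ^ 7.
Proof. by apply: mk_lt; apply: qn_lt. Qed.

Definition small (T : nat) (C : config M) :=
  [/\ wh C < size (wt C) /\ ih C < size (itp C), 4 ^ size (wt C) <= T, 4 ^ size (itp C) <= T & chp C <= T].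

Lemma small_digits T C : small T C ->
  [/\ tval 4 symn (wt C) <= T, 4 ^ wh C <= T, tval 4 symn (itp C) <= T,
      2 ^ ih C <= T /\ idx_val (itp C) <= T & chp C <= T].
Proof.
case=> -[h1 h2] h3 h4 h5.
have e24 n : 2 ^ n <= 4 ^ n by apply: leq_expl.
split=> //.
- by apply: leq_trans h3; apply/ltnW/(@tval_lt 4 symn isT erefl symn_lt).
- by apply: leq_trans h3; rewrite leq_exp2l // ltnW.
- by apply: leq_trans h4; apply/ltnW/(@tval_lt 4 symn isT erefl symn_lt).
- split; first by apply: leq_trans (e24 _) _; apply: leq_trans h4; rewrite leq_exp2l // ltnW.
  rewrite idx_valE; apply: leq_trans (leq_trans (e24 _) h4).
  by apply/ltnW/(@tval_lt 2 iw) => //; case.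
Qed.

Lemma ec_digits T C : small T C ->
  [/\ dg T 0 (ec T C) = tval 4 symn (wt C), dg T 1 (ec T C) = 4 ^ wh C,
     dg T 2 (ec T C) = tval 4 symn (itp C), dg T 3 (ec T C) = 2 ^ ih C /\ dg T 4 (ec T C) = idx_val (itp C) &
     dg T 5 (ec T C) = chp C /\ dg T 6 (ec T C) = size (out C) %% T.+1].
Proof.
move=> /small_digits [h0 h1 h2 [h3 h4] h5].
have ms a : a <= T -> a %% T.+1 = a by move=> h; rewrite modn_small.
by rewrite /ec !mk_dg ?qn_lt //= (ms _ h0) (ms _ h1) (ms _ h2) (ms _ h3) (ms _ h4) (ms _ h5).
Qed.

Lemma ec_q T C : ec T C %% nQ = qn (cq C).
Proof. by rewrite mk_q // qn_lt. Qed.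

(** On cell 0 the machine reads the marker, hence the first disjunct; elsewhere the single bit [cb]
    stands for the choice tape. *)
Lemma stp_ec (x : seq bool) (k : nat) (ch : nat -> bool) (inp : nat -> sym) T off (cb : bool) C :
  small T C -> halting M (cq C) = false ->
  inp (off + idx_val (itp C)) = nth Blank (enc x k) (idx_val (itp C)) ->
  (chp C = 0 \/ ch (chp C).-1 = cb) ->
  stp inp T off cb (ec T C) = ec T (step x k ch C).
Proof.
move=> hs nh hinp hch; have [d0 d1 d2 [d3 d4] [d5 d6]] := ec_digits hs.
have eis : symn (inp (off + dg T 4 (ec T C))) = symn (nth Blank (enc x k) (idx_val (itp C))) by rewrite d4 hinp.
have ews : wsym T (ec T C) = symn (nth Blank (wt C) (wh C)).
  by rewrite /wsym d0 d1 tval_digit // => s; apply: symn_lt.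
have p4 : 2 ^ ih C * 2 ^ ih C = 4 ^ ih C by rewrite -expnMn.
have exs : isym T (ec T C) = symn (nth Blank (itp C) (ih C)).
  by rewrite /isym d2 d3 p4 tval_digit // => s; apply: symn_lt.
have ecs : csym T cb (ec T C) = symn (choice_sym ch (chp C)).
  rewrite /csym d5; case: (chp C) hch => [|p] //= [//|->].
  by case: (cb).
have elk g : lk g inp T off cb (ec T C) = g (delta M (cq C) (nth Blank (enc x k) (idx_val (itp C)))
    (nth Blank (wt C) (wh C)) (nth Blank (itp C) (ih C)) (choice_sym ch (chp C))).
  by rewrite /lk eis ews exs ecs ec_q lookE.
rewrite /stp !elk d0 d1 d2 d3 d4 d5 d6 ews exs p4.
case: C hs nh hinp hch {d0 d1 d2 d3 d4 d5 d6 eis ews p4 exs ecs elk} => q w wh1 it ih1 p o /= hs nh hinp hch.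
rewrite nh /g_q /g_ws /g_wm /g_is /g_im /g_cm /g_os.
case: (delta _ _ _ _ _ _) => [[[[[[q' ws] wm] is_] im] cm] os] /=.
rewrite /ec /cfgl /=.
have tv (B : nat) (wt : sym -> nat) t h s m : wt Blank = 0 -> (forall s, wt s < B) -> 0 < B ->
   tval B wt (set_nth Blank t h s ++ nseq m Blank) = tval B wt t - wt (nth Blank t h) * B ^ h + wt s * B ^ h.
  by move=> *; rewrite tval_cat_blank // tval_set.
rewrite !idx_valE !tv //; try (by case); try exact: symn_lt.
rewrite !movepE // movecE.
have iwE s : (symn s == 2) = iw s :> nat by case: s.
have eo : size (if os is Some s then rcons o s else o) = size o + (if os is Some _ then 1 else 0).
  by case: (os) => [s|]; rewrite ?size_rcons ?addn1 ?addn0.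
by rewrite !iwE eo /mk /= modnDml.
Qed.

End Coding.

(** The orbit of [c0] has at most [N] elements, so a fixed point on it is met within [N] steps. *)
Lemma iter_fixed_bound N f c0 n : c0 < N -> (forall c, c < N -> f c < N) ->
  f (iter n f c0) = iter n f c0 -> iter N f c0 = iter n f c0.
Proof.
move=> c0N fN fp.
pose g (i : 'I_N) : 'I_N := Ordinal (fN i (ltn_ord i)).
pose x0 := Ordinal c0N.
have gE m : nat_of_ord (iter m g x0) = iter m f c0 by elim: m => //= m ->.
have hc : fconnect g x0 (iter n g x0) by apply: fconnect_iter.
have hi := findex_max hc; have ei := iter_findex hc.
have iN : findex g x0 (iter n g x0) <= N.
  apply: ltnW; apply: leq_trans hi _; rewrite /order; apply: leq_trans (max_card _) _.
  by rewrite card_ord.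
rewrite -(subnK iN) iterD -[iter (findex _ _ _) f c0]gE ei gE.
by elim: (N - _) => //= m ->.
Qed.

Lemma L_expc e f : L f -> L (fun inp v => f inp v ^ e).
Proof.
move=> hf; elim: e => [|e IH]; first exact: L_const.
by apply: (@L_ext (fun inp v => f inp v * f inp v ^ e)); [move=> inp v; rewrite expnS|apply: L_mul].
Qed.
#[export] Hint Resolve L_expc : L.

(** * Simulation up to the next choice cell *)

Section Sim.
Variable M : TM.

Definition hal (c : nat) : bool :=
  nth 0 [seq nat_of_bool (halting M (nq M i)) | i <- iota 0 (nQ M)] (c %% nQ M) == 1.
Definition acc (c : nat) : bool :=
  nth 0 [seq nat_of_bool (accepting M (nq M i)) | i <- iota 0 (nQ M)] (c %% nQ M) == 1.

Definition stop (T cp0 c : nat) : bool := hal c || (cp0 < dg M T 5 c).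

(* The run lasts until the choice head passes cell cp0; off is the address at which the
   simulated input starts. *)
Definition go (inp : nat -> sym) T off cp0 cb n c : nat :=
  iter n (fun c => if stop T cp0 c then c else stp M inp T off cb c) c.

Lemma hal_ec T C : hal (ec T C) = halting M (cq C).
Proof.
by rewrite /hal ec_q (nth_map 0) ?size_iota ?qn_lt // nth_iota ?qn_lt // qnK; case: halting.
Qed.

Lemma acc_ec T C : acc (ec T C) = accepting M (cq C).
Proof.
by rewrite /acc ec_q (nth_map 0) ?size_iota ?qn_lt // nth_iota ?qn_lt // qnK; case: accepting.
Qed.

Lemma stop_ec T cp0 C : small T C -> stop T cp0 (ec T C) = halting M (cq C) || (cp0 < chp C).
Proof. by move=> /ec_digits [_ _ _ _ [h _]]; rewrite /stop hal_ec h. Qed.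

Lemma go_lt inp T off cp0 cb n c : c < nQ M * T.+1 ^ 7 -> go inp T off cp0 cb n c < nQ M * T.+1 ^ 7.
Proof. by move=> h; elim: n => //= n IH; case: ifP => // _; apply: stp_lt. Qed.

Lemma go_bound inp T off cp0 cb n c : c < nQ M * T.+1 ^ 7 -> stop T cp0 (go inp T off cp0 cb n c) ->
  go inp T off cp0 cb (nQ M * T.+1 ^ 7) c = go inp T off cp0 cb n c.
Proof.
move=> hc hs; apply: iter_fixed_bound => //; last by rewrite -/(go inp T off cp0 cb n c) hs.
by move=> c1 h1; case: ifP => // _; apply: stp_lt.
Qed.

Section Real.
Variables (x : seq bool) (k : nat) (ch : nat -> bool) (inp : nat -> sym) (T off cp0 : nat) (cb : bool) (n0 : nat).
Notation run := (run M x k ch).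
Hypothesis hinp : forall i, inp (off + i) = nth Blank (enc x k) i.
Let event m := halting M (cq (run (n0 + m))) || (cp0 < chp (run (n0 + m))).
Hypothesis hch : forall m, ~~ event m -> chp (run (n0 + m)) = 0 \/ ch (chp (run (n0 + m))).-1 = cb.

Lemma go_run n : (forall m, m < n -> small T (run (n0 + m))) ->
  (forall m, m < n -> ~~ event m) ->
  go inp T off cp0 cb n (ec T (run n0)) = ec T (run (n0 + n)).
Proof.
elim: n => [|n IH] hsm h; first by rewrite addn0.
rewrite [LHS]/= -/(go inp T off cp0 cb n (ec T (run n0))) IH; first last.
- by move=> m hm; apply: h; exact: ltnW.
- by move=> m hm; apply: hsm; exact: ltnW.
have hn := h n (ltnSn n); have hs := hsm n (ltnSn n).
rewrite stop_ec // -/(event n) (negbTE hn) addnS /Defs.run iterS.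
apply: stp_ec => //; [|exact: hch].
by move: hn; rewrite negb_or => /andP [/negbTE h1 _]; exact: h1.
Qed.

Lemma go_event m : (forall m', small T (run (n0 + m'))) -> event m -> (forall m', m' < m -> ~~ event m') ->
  go inp T off cp0 cb (nQ M * T.+1 ^ 7) (ec T (run n0)) = ec T (run (n0 + m)).
Proof.
move=> hsm hm h; rewrite -(go_run (fun m _ => hsm m) h); apply: go_bound; first exact: ec_lt.
by rewrite go_run // stop_ec.
Qed.

End Real.

Lemma upd_tape_head t h s m : (upd_tape t h s m).2 < size (upd_tape t h s m).1.
Proof. by rewrite /= size_cat size_nseq size_set_nth; lia. Qed.

Lemma run_heads x k c n : wh (run M x k c n) < size (wt (run M x k c n)) /\
  ih (run M x k c n) < size (itp (run M x k c n)).
Proof.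
rewrite /run; elim: n => //= n.
case: (iter n _ _) => q w h i hi p o /= [h1 h2].
case: halting => //; case: delta => [[[[[[q' ws] wm] is_] im] cm] os].
have := upd_tape_head w h ws wm; have := upd_tape_head i hi is_ im.
by [].
Qed.

Lemma small_run x k c n S T : space (run M x k c n) <= S -> 4 ^ S <= T -> chp (run M x k c n) <= T ->
  small T (run M x k c n).
Proof.
move=> hS hT hc; split=> //; first exact: run_heads.
  by apply: leq_trans hT; rewrite leq_exp2l //; apply: leq_trans hS; rewrite leq_addr.
by apply: leq_trans hT; rewrite leq_exp2l //; apply: leq_trans hS; rewrite leq_addl.
Qed.

Lemma L_dg T i c : L T -> L c -> L (fun inp v => dg M (T inp v) i (c inp v)).
Proof. by move=> hT hc; rewrite /dg; L_tac. Qed.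
Hint Resolve L_dg : L.

Lemma L_hal c : L c -> L (fun inp v => nat_of_bool (hal (c inp v))).
Proof.
move=> hc; rewrite /hal; apply: L_eq; last by L_tac.
by apply: (@L_table _ (fun inp v => c inp v %% nQ M)); L_tac.
Qed.

Lemma L_acc c : L c -> L (fun inp v => nat_of_bool (acc (c inp v))).
Proof.
move=> hc; rewrite /acc; apply: L_eq; last by L_tac.
by apply: (@L_table _ (fun inp v => c inp v %% nQ M)); L_tac.
Qed.
Hint Resolve L_hal L_acc : L.

Lemma L_stop T cp0 c : L T -> L cp0 -> L c -> L (fun inp v => nat_of_bool (stop (T inp v) (cp0 inp v) (c inp v))).
Proof. by move=> *; rewrite /stop; L_tac. Qed.
Hint Resolve L_stop : L.

Lemma L_movep B m p : L m -> L p -> L (fun inp v => movep B (m inp v) (p inp v)).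
Proof. by move=> *; rewrite /movep; L_tac. Qed.

Lemma L_movec m p : L m -> L p -> L (fun inp v => movec (m inp v) (p inp v)).
Proof. by move=> *; rewrite /movec; L_tac. Qed.
Hint Resolve L_movep L_movec : L.

Lemma L_lk (g : dres M -> nat) T off cb c : L T -> L off -> L cb -> L c ->
  L (fun inp v => lk g inp (T inp v) (off inp v) (cb inp v) (c inp v)).
Proof.
move=> *; rewrite /lk /look; apply: (@L_table _ (fun inp v => _)).
by rewrite /wsym /isym /csym; L_tac.
Qed.

Lemma L_stp T off cb c : L T -> L off -> L cb -> L c ->
  L (fun inp v => stp M inp (T inp v) (off inp v) (cb inp v) (c inp v)).
Proof.
move=> hT ho hb hc.
have hl g := L_lk g hT ho hb hc.
have hd i := L_dg i hT hc.
have hw : L (fun inp v => wsym M (T inp v) (c inp v)) by rewrite /wsym; L_tac.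
have hi : L (fun inp v => isym M (T inp v) (c inp v)) by rewrite /isym; L_tac.
have hX X : L X -> L (fun inp v => X inp v %% (T inp v).+1) by move=> hX; L_tac.
rewrite /stp /mk /=; apply: L_add => //; apply: L_mul; first exact: L_const.
do 6 (apply: L_add; [apply: hX; L_tac|apply: L_mul; first by L_tac]).
by apply: L_add; [apply: hX; L_tac|L_tac].
Qed.

Lemma L_go T off cp0 cb n c : L T -> L off -> L cp0 -> L cb -> L n -> L c ->
  L (fun inp v => go inp (T inp v) (off inp v) (cp0 inp v) (cb inp v) (n inp v) (c inp v)).
Proof.
move=> h1 h2 h3 h4 h5 h6; suff h : L (fun inp v => go inp v#0 v#1 v#2 v#3 v#4 v#5).
  exact: (L_comp h (conj h1 (conj h2 (conj h3 (conj h4 (conj h5 (conj h6 I)))))) (fs := [:: T; off; cp0; cb; n; c])).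
apply: (@L_rec (fun _ v => v#4) (fun _ v => v#5)
  (fun inp w => if stop w#2 w#4 w#0 then w#0 else stp M inp w#2 w#3 w#5 w#0)
  (fun _ v => v#5 + nQ M * (v#0).+1 ^ 7) (fun inp v n => go inp v#0 v#1 v#2 v#3 n v#5)) => //; L_tac.
- by apply: L_if; L_tac; apply: L_stp; L_tac.
- by apply: L_PB; L_tac.
- move=> inp v i _; elim: i => [|i IH]; first by rewrite /= leq_addr.
  rewrite [go _ _ _ _ _ _ _]/=; case: ifP => // _.
  by apply: leq_trans (ltnW (stp_lt _ _ _ _ _ _)) _; rewrite leq_addl.
Qed.

End Sim.

Lemma run_chpS (M : TM) x k c n : chp (run M x k c n.+1) <= (chp (run M x k c n)).+1.
Proof.
rewrite [run _ _ _ _ n.+1]/run iterS -/(run _ _ _ _ _).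
case: (run M x k c n) => q w h i hi p o /=; case: halting => //=.
case: delta => [[[[[[q' ws] wm] is_] im] cm] os] /=.
by case: cm => //=; apply: leq_trans (leq_pred p) _.
Qed.

(** * The graph of a machine on a fixed input *)

Section Graph.
Variables (M : TM) (inp : nat -> sym) (T : nat).

Definition nN : nat := nQ M * T.+1 ^ 7.
Definition fin (v : nat) : nat := go M inp T 0 (dg M T 5 (v %/ 2)) (v %% 2) nN (v %/ 2).
Definition pend (v : nat) : bool := dg M T 5 (v %/ 2) < dg M T 5 (fin v).
Definition accv (v : nat) : bool := hal M (fin v) && acc M (fin v).
(* Vertices below tgt are 2 * (coded configuration) + (bit in the current choice cell). *)
Definition tgt : nat := 2 * nN.

(** When a run neither halts nor leaves its choice cell, [fin] is a code that is not halting and has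
    the same choice position; both tests fail and the vertex is a dead end. *)
Definition gsucc (v : nat) : seq nat :=
  if v == tgt then [:: tgt]
  else if pend v then [:: 2 * fin v; 2 * fin v + 1]
  else if accv v then [:: tgt] else [::].

Fixpoint accg (v : nat) (w : seq bool) : bool :=
  if w is b :: w' then pend v && accg (2 * fin v + b) w' else ~~ pend v && accv v.

Lemma fin_lt v : v < tgt -> fin v < nN.
Proof. by move=> h; apply: go_lt; rewrite ltn_divLR // mulnC. Qed.

Lemma wk_tgt l : wk gsucc tgt tgt l = 1.
Proof. by elim: l => [|l IH] /=; rewrite /gsucc eqxx // big_seq1. Qed.

(** A walk of length [l] spends one edge per choice bit, one to enter [tgt] and the rest on the loop
    there: the word determines the walk, and the entering edge makes the inequality strict. *)
Lemma words_accg v l : v < tgt ->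
  words (fun w => (size w < l) && accg v w) (wk gsucc tgt v l).
Proof.
elim: l v => [|l IH] v hv.
  by rewrite /= (ltn_eqF hv); apply: words0 => w.
rewrite /= /gsucc (ltn_eqF hv); have hf := fin_lt hv.
case: (boolP (pend v)) => hp.
  rewrite !big_cons big_nil addn0.
  apply: (@words_cons _ (fun w => (size w < l) && accg (2 * fin v) w) (fun w => (size w < l) && accg (2 * fin v + 1) w)).
  - by rewrite /= hp.
  - by move=> w; rewrite /= hp ltnS addn0.
  - by move=> w; rewrite /= hp ltnS.
  - by apply: IH; rewrite /tgt; lia.
  - by apply: IH; rewrite /tgt; lia.
case: ifP => ha.
  rewrite big_seq1 wk_tgt; apply: words1 => w.
  by case: w => [|b w] /=; rewrite ?hp ?ha ?(negbTE hp) ?andbF.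
rewrite big_nil; apply: words0 => w.
by case: w => [|b w] /=; rewrite ?ha ?(negbTE hp) ?andbF.
Qed.

End Graph.

Section RealGraph.
Variables (M : TM) (x : seq bool) (k T : nat).
Let inp := nth Blank (enc x k).
Hypothesis ro : read_once M.
Hypothesis hsm : forall c n, small T (run M x k c n).

Section From.
Variables (c : nat -> bool) (n0 : nat) (bt : bool).
Let C := run M x k c n0.
Let j := chp C.
Hypothesis hj : j = 0 \/ c j.-1 = bt.
Let v := 2 * ec T C + bt.
Let event m := halting M (cq (run M x k c (n0 + m))) || (j < chp (run M x k c (n0 + m))).

Lemma v_div : v %/ 2 = ec T C.
Proof. by rewrite /v mulnC divnMDl // divn_small ?addn0 //; case: bt. Qed.

Lemma v_mod : v %% 2 = bt.
Proof. by rewrite /v mulnC modnMDl modn_small //; case: bt. Qed.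

Lemma dg5 c1 n : dg M T 5 (ec T (run M x k c1 n)) = chp (run M x k c1 n).
Proof. by have [_ _ _ _ []] := ec_digits (hsm c1 n). Qed.

Lemma event_ch m : ~~ event m -> chp (run M x k c (n0 + m)) = 0 \/ c (chp (run M x k c (n0 + m))).-1 = bt.
Proof.
rewrite negb_or -leqNgt => /andP [_ h].
suff -> : chp (run M x k c (n0 + m)) = j by [].
by apply/eqP; rewrite eqn_leq h; apply: run_chp_le => //; rewrite leq_addr.
Qed.

Lemma fin_go : fin M inp T v = go M inp T 0 j bt (nN M T) (ec T C).
Proof. by rewrite /fin v_div v_mod dg5. Qed.

Lemma fin_event m : event m -> (forall m', m' < m -> ~~ event m') -> fin M inp T v = ec T (run M x k c (n0 + m)).
Proof.
move=> hm h; rewrite fin_go; apply: (@go_event M x k c inp T 0 j bt n0) => //.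
exact: event_ch.
Qed.

Lemma fin_cases :
  (exists m, [/\ event m, forall m', m' < m -> ~~ event m' & fin M inp T v = ec T (run M x k c (n0 + m))]) \/
  (forall m, ~~ event m) /\ fin M inp T v = ec T (run M x k c (n0 + nN M T)).
Proof.
have least m : event m -> exists m', [/\ event m', forall m'', m'' < m' -> ~~ event m'' & fin M inp T v = ec T (run M x k c (n0 + m'))].
  move=> hm; case: (ex_minnP (ex_intro event m hm)) => m' h1 h2.
  have h3 m'' : m'' < m' -> ~~ event m'' by move=> h; apply/negP => /h2; rewrite leqNgt h.
  by exists m'; split=> //; apply: fin_event.
case: (boolP (has event (iota 0 (nN M T).+1))) => [/hasP [m _ /least]|/hasPn hn]; first by left.
have hn' m : m <= nN M T -> ~~ event m by move=> h; apply: hn; rewrite mem_iota.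
have hf : fin M inp T v = ec T (run M x k c (n0 + nN M T)).
  rewrite fin_go; apply: (@go_run M x k c inp T 0 j bt n0) => //; first exact: event_ch.
  by move=> m /ltnW /hn'.
(* If an event came later, [fin] would be the stopped code of that event; but it is also the code
   after [nN M T] steps, which is not stopped. *)
right; split=> // m; apply/negP => /least [m' [h1 h2 h3]].
have := hn' _ (leqnn _); rewrite /event -(stop_ec j (hsm _ _)) -hf h3 (stop_ec j (hsm _ _)).
by rewrite -/(event m') h1.
Qed.

Lemma pend_fin n : fin M inp T v = ec T (run M x k c n) -> pend M inp T v = (j < chp (run M x k c n)).
Proof. by rewrite /pend => ->; rewrite v_div !dg5. Qed.

Lemma accv_fin n : fin M inp T v = ec T (run M x k c n) ->
  accv M inp T v = halting M (cq (run M x k c n)) && accepting M (cq (run M x k c n)).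
Proof. by rewrite /accv => ->; rewrite hal_ec acc_ec. Qed.

End From.

(** The induction moves the starting time [n0] to the entry into the next cell. The current bit is
    carried by [bt], and [w] consists of the bits in the cells after cell [j], hence the shift by
    [j]. *)
Lemma accg_run w c n0 (bt : bool) : let j := chp (run M x k c n0) in
  (j = 0 \/ c j.-1 = bt) -> (forall i, c (j + i) = nth false w i) ->
  accg M inp T (2 * ec T (run M x k c n0) + bt) w <->
  exists m, let R := run M x k c (n0 + m) in
    [/\ halting M (cq R), accepting M (cq R) & chp R = j + size w].
Proof.
elim: w n0 bt => [|b w IH] n0 bt j hj hw.
all: case: (fin_cases hj) => [[m [em hm hf]]|[hm hf]]; last first.
1,3: have hp := pend_fin hf; have ha := accv_fin hf; have := hm (nN M T);
  rewrite negb_or => /andP [/negbTE h1 /negbTE h2]; rewrite /= hp ?ha ?h1 h2 /=; split=> // -[m [h3 _ _]];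
  by have := hm m; rewrite h3.
all: have hp := pend_fin hf; have ha := accv_fin hf; rewrite [accg _ _ _ _ _]/= hp ?ha.
all: have ge m0 : halting M (cq (run M x k c (n0 + m0))) -> m <= m0 by
  move=> h; rewrite leqNgt; apply/negP => /hm; rewrite h.
all: case: (ltnP j (chp (run M x k c (n0 + m)))) => hlt.
- split=> // -[m0 [/ge h1 _ h2]]; move: hlt; rewrite addn0 in h2; rewrite -h2 ltnNge.
  by rewrite run_chp_le // leq_add2l.
- have h0 : halting M (cq (run M x k c (n0 + m))) by move: em; rewrite ltnNge hlt orbF.
  have ec0 : chp (run M x k c (n0 + m)) = j.
    by apply/eqP; rewrite eqn_leq hlt; apply: run_chp_le => //; rewrite leq_addr.
  rewrite h0 /= addn0; split=> [h|[m0 [h1 h2 h3]]]; first by exists m.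
  by move: h2; rewrite (run_halt h0) // leq_add2l; apply: ge.
(* The choice head moves by at most one cell per step, so at the first event it has just entered the
   next cell. *)
- have ej : chp (run M x k c (n0 + m)) = j.+1.
    case: m em hm hf hp ha ge hlt => [|m] em hm hf hp ha ge hlt; first by rewrite addn0 ltnn in hlt.
    apply/eqP; rewrite eqn_leq hlt andbT; have := hm m (ltnSn m).
    rewrite negb_or -leqNgt => /andP [_ h]; rewrite addnS; apply: leq_trans (run_chpS _ _ _ _ _) _.
    exact: h.
  rewrite hf /= IH; last first.
  + by move=> i; rewrite ej addSnnS hw.
  + by right; rewrite ej /= -[j]addn0 hw.
  rewrite ej; split=> -[m0 [h1 h2 h3]].
    by exists (m + m0); rewrite addnA; split=> //; rewrite h3 addSnnS.
  exists (m0 - m); rewrite -addnA subnKC; last exact: ge.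
  by split=> //; rewrite h3 addSnnS.
- have h0 : halting M (cq (run M x k c (n0 + m))) by move: em; rewrite ltnNge hlt orbF.
  split=> // -[m0 [h1 h2 h3]]; move: h3; rewrite (run_halt h0); last by rewrite leq_add2l; apply: ge.
  by move=> h3; rewrite h3 in hlt; move: hlt => /=; lia.
Qed.

(** The run starts on the marker, where no bit is read; the start vertex is given bit 0. *)
Lemma accg_acc_path w :
  accg M inp T (2 * ec T (init M)) w <-> acc_path M x k w.
Proof.
have := @accg_run w (ext w) 0 false (or_introl erefl) (fun i => erefl); rewrite addn0 => ->.
split=> [[m [h1 h2 h3]]|].
  by apply/(acc_path_halt ro h1).
by case=> n [h1 [h2 [h3 h4]]]; exists n; split=> //; case: (proj1 (acc_path_halt ro h1) (ex_intro _ n (conj h1 (conj h2 (conj h3 h4))))).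
Qed.

End RealGraph.

(** * The query instance *)

Definition ubits (l : seq nat) : seq bool := flatten [seq rcons (nseq m true) false | m <- l].

Lemma ubits_cat l l' : ubits (l ++ l') = ubits l ++ ubits l'.
Proof. by rewrite /ubits map_cat flatten_cat. Qed.

Lemma dec_nats_ubits l : dec_nats (ubits l) 0 = Some l.
Proof.
elim: l => //= m l IH; rewrite /ubits [flatten _]/= cat_rcons -/(ubits l) -[in RHS](add0n m).
by elim: m 0 => [|m IHm] m0 /=; [rewrite IH addn0|rewrite IHm addnS].
Qed.

Lemma parse_adj_flatten (adj : seq (seq nat)) :
  parse_adj (size adj) (flatten [seq size l :: l | l <- adj]) = Some adj.
Proof.
elim: adj => //= l adj IH.
by rewrite size_cat leq_addr take_size_cat // drop_size_cat // IH.
Qed.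

Definition graph_nats (sc : nat -> seq nat) (n : nat) : seq nat :=
  flatten [seq size l :: l | l <- [seq sc v | v <- iota 0 n]].

Lemma wk_ext adj adj' n t s r : s < n -> (forall u, u < n -> adj u = adj' u) ->
  (forall u v, u < n -> v \in adj u -> v < n) -> wk adj t s r = wk adj' t s r.
Proof.
move=> sn e h; elim: r s sn => //= r IH s sn; rewrite -e //.
by apply: eq_big_seq => v hv; apply: IH; apply: h hv.
Qed.

Lemma logreach_graph b k sc n s t a : s < n -> t < n ->
  (forall v, v < n -> [&& size (sc v) <= b, uniq (sc v) & all (fun u => u < n) (sc v)]) ->
  2 ^ a <= n ^ k ->
  logreach b (ubits ([:: n; s; t; a] ++ graph_nats sc n)) k = wk sc t s a.
Proof.
move=> sn tn hsc ha; rewrite /logreach /decode dec_nats_ubits /=.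
set adj := [seq sc v | v <- iota 0 n].
have sz : n = size adj by rewrite size_map size_iota.
rewrite {1}sz parse_adj_flatten sn tn /= ifT; last first.
  by rewrite all_map; apply/allP => v; rewrite mem_iota => /hsc.
rewrite ha.
have nthE u : u < n -> nth [::] adj u = sc u.
  by move=> hu; rewrite (nth_map 0) ?size_iota // nth_iota.
rewrite num_walks_wk //; last first.
  by move=> u hu; rewrite nthE //; case/and3P: (hsc u hu) => _ -> ->.
apply: (@wk_ext _ _ n) => // u v hu; rewrite nthE // => hv.
by case/and3P: (hsc u hu) => _ _ /allP; apply.
Qed.

Section Reduced.
Variables (M : TM) (x : seq bool) (k T f2 : nat).
Let inp := nth Blank (enc x k).
Hypothesis ro : read_once M.
Hypothesis hsm : forall c n, small T (run M x k c n).
Hypothesis hch : forall c n, chp (run M x k c n) <= f2 * lg (size x).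
Hypothesis hT : size x <= T.

Definition red_a : nat := f2 * lg (size x) + 1.
Definition red_y : seq bool :=
  ubits ([:: (tgt M T).+1; 2 * ec T (init M); tgt M T; red_a] ++ graph_nats (gsucc M inp T) (tgt M T).+1).

Lemma red_ok b s : 1 < b -> uniq s -> (forall w, w \in s <-> acc_path M x k w) ->
  logreach b red_y f2.+1 = size s.
Proof.
move=> b1 us hs.
have it : 2 * ec T (init M) < tgt M T by rewrite /tgt; have := ec_lt T (init M); rewrite -/(nN M T); lia.
rewrite /red_y logreach_graph //; first last.
(* With [n] vertices and [n >= 2 ^ lg |x|], the length [red_a] satisfies [2 ^ red_a <= n ^ f2 * n].
   This is what [size x <= T] provides. *)
- have h2 : 2 ^ lg (size x) <= (tgt M T).+1.
    apply: (@leq_trans (2 * T.+1)).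
      rewrite /lg expnS leq_mul2l /=; case: (posnP (size x)) => [->|h]; first by rewrite trunc_log0.
      by apply: leq_trans (trunc_logP (isT : 1 < 2) h) _; apply: leqW.
    apply: leqW; rewrite /tgt leq_mul2l /nN /=; apply: leq_trans (leq_pmull _ (nQ0 M)).
    by rewrite -[X in X <= _]expn1 leq_pexp2l.
  rewrite /red_a addn1 expnSr [X in _ <= X]expnSr; apply: leq_mul.
    by rewrite mulnC expnM; apply: leq_expl.
  by apply: leq_trans h2; rewrite -[X in X <= _]expn1 leq_exp2l.
- move=> v hv; rewrite /gsucc; case: eqP => [_|/eqP hne] /=; first by rewrite ltnSn; lia.
  have hf : fin M inp T v < nN M T by apply: fin_lt; lia.
  case: ifP => _ /=; last by case: ifP => _ //=; rewrite ltnSn; lia.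
  rewrite inE /tgt; have -> : (2 * fin M inp T v == 2 * fin M inp T v + 1) = false by lia.
  by rewrite b1 /=; lia.
- by lia.
have [s' [us' es' <-]] := words_accg inp red_a it.
apply/perm_size/uniq_perm => // w.
rewrite es' (_ : (w \in _) = (size w < red_a) && accg M inp T (2 * ec T (init M)) w) //.
have hacc := accg_acc_path ro hsm w.
apply/idP/andP => [hw|[_ /hacc /hs] //].
(* An accepting path has at most [f2 * lg |x|] bits, so the restriction on the length loses none. *)
have hp := (hs w).1 hw; split; last exact/hacc.
by case: hp => n [_ [_ [_ [m [_ <-]]]]]; rewrite /red_a addn1 ltnS.
Qed.

End Reduced.

Definition icode (M : TM) (T : nat) : nat := mk M T (qn (q0 M)) [:: 0; 1; 0; 1; 0; 0; 0].

Lemma icodeE M T : icode M T = ec T (init M).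
Proof. by rewrite /icode /ec /cfgl /= idx_valE. Qed.

Lemma L_icode M T : L T -> L (fun inp v => icode M (T inp v)).
Proof. by move=> hT; rewrite /icode /mk /=; L_tac. Qed.
#[export] Hint Resolve L_icode : L.
#[export] Hint Extern 2 (L (fun inp v => nat_of_bool (hal _ _))) => (apply: L_hal) : L.
#[export] Hint Extern 2 (L (fun inp v => nat_of_bool (acc _ _))) => (apply: L_acc) : L.
#[export] Hint Extern 2 (L (fun inp v => go _ _ _ _ _ _ _ _)) => (apply: L_go) : L.
#[export] Hint Extern 2 (L (fun inp v => dg _ _ _ _)) => (apply: L_dg) : L.

(** * Running the machines of the resource bounds *)

Section SimP.
Variables (M : TM) (f : nat -> nat).
Hypothesis hM : forall k c, exists n,
  halting M (cq (run M [::] k c n)) /\ out (run M [::] k c n) = nseq (f k) S1.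

Lemma halts k : exists n, halting M (cq (run M [::] k (fun _ => false) n)).
Proof. by have [n []] := hM k (fun _ => false); exists n. Qed.

(** All values of the simulation are bounded in terms of this running time, which thereby becomes
    part of the space bound of the reduction. *)
Definition ftime (k : nat) : nat := ex_minn (halts k).

Lemma ftime_halt k : halting M (cq (run M [::] k (fun _ => false) (ftime k))).
Proof. by rewrite /ftime; case: ex_minnP. Qed.

Lemma ftime_min k n : n < ftime k -> ~~ halting M (cq (run M [::] k (fun _ => false) n)).
Proof.
rewrite /ftime; case: ex_minnP => m _ h hn; apply/negP => /h.
by rewrite leqNgt hn.
Qed.

Lemma ftime_out k : out (run M [::] k (fun _ => false) (ftime k)) = nseq (f k) S1.
Proof.
have [n [h1 <-]] := hM k (fun _ => false); congr out.
case: (leqP n (ftime k)) => h; first by rewrite (run_halt h1 h).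
by rewrite (run_halt (ftime_halt k) (ltnW h)).
Qed.

Lemma run_growth x k c n : let C := run M x k c n in
  [/\ size (wt C) <= n.+1, size (itp C) <= n.+1, wh C <= n /\ ih C <= n, chp C <= n & size (out C) <= n].
Proof.
elim: n => [|n]; first by [].
rewrite [run _ _ _ _ n.+1]/run iterS -/(run _ _ _ _ _).
case: (run M x k c n) => q w h i hi p o /= [h1 h2 [h3 h4] h5 h6].
case: ifP => _ /=; first by split; try split; lia.
case: delta => [[[[[[q' ws] wm] is_] im] cm] os] /=.
have mh m a : a <= n -> move_head m a <= n.+1 by case: m => /=; lia.
rewrite !size_cat !size_nseq !size_set_nth.
have := mh wm _ h3; have := mh im _ h4; have := mh cm _ h5.
split=> //; try split=> //; try lia.
by case: os => [s|]; rewrite ?size_rcons; lia.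
Qed.

(** The simulated input [enc [::] k] is the tail of [enc x k] from address [|x|] on, so it is read
    in place at offset [v#1]. With [v#10] as limit for the choice head only halting stops the run;
    all choice bits are 0. *)
Definition simc (inp : nat -> sym) (v : seq nat) : nat :=
  go M inp v#10 v#1 v#10 0 v#7 (icode M v#10).

Lemma L_simc : L simc.
Proof. by rewrite /simc; L_tac. Qed.

(* The base of the code has to exceed 4 to the number of steps, which is not known in advance: the
   simulation is restarted for 0, 1, 2, ... steps. *)
Definition simP : prog :=
  let g := PAsg 3 (fun inp v => nat_of_bool (~~ hal M (simc inp v))) in
  PSeq (PAsg 7 (fun _ _ => 0)) (PSeq (PAsg 10 (fun _ _ => 16)) (PSeq g (PSeq
    (PWhile 3 (PSeq (PAsg 7 (fun _ v => (v#7).+1)) (PSeq (PAsg 10 (fun _ v => v#10 * 4)) g)))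
    (PAsg 6 (fun inp v => dg M v#10 6 (simc inp v)))))).

Lemma wf_simP m : 10 < m -> wf m simP.
Proof.
have h := L_simc; have h' : L (fun inp v => nat_of_bool (~~ hal M (simc inp v))).
  by apply: L_neg; apply: L_hal.
by move=> hm /=; repeat split; try lia; try (by L_tac); apply: L_dg; L_tac.
Qed.

Section SimPE.
Variables (x : seq bool) (k : nat) (ch : nat -> bool) (V : nat).
Let inp := nth Blank (enc x k).
Let run' := run M [::] k (fun _ => false).

Lemma inp_off i : inp (size x + i) = nth Blank (enc [::] k) i.
Proof.
case: i => [|i]; first by rewrite addn0 /inp inp_len.
by rewrite addnS /inp inp_k /= nth_nseq.
Qed.

Lemma small_growth n : small (4 ^ n.+2) (run' n).
Proof.
have [h1 h2 _ h3 _] := run_growth [::] k (fun _ => false) n.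
split; first exact: run_heads.
- by rewrite leq_exp2l //; exact: leqW h1.
- by rewrite leq_exp2l //; exact: leqW h2.
- by apply: leq_trans h3 _; apply: ltnW; apply: leq_trans (ltn_expl n (isT : 1 < 4)) _; rewrite leq_exp2l // !leqW.
Qed.

Lemma small_growth_le n m : m <= n -> small (4 ^ n.+2) (run' m).
Proof.
move=> hm; have [h1 h2 h3 h4] := small_growth m.
have e : 4 ^ m.+2 <= 4 ^ n.+2 by rewrite leq_exp2l.
by split=> //; apply: leq_trans e.
Qed.

Lemma simc_run a c n rest v3 v4 v5 v6 v8 v9 : n <= ftime k ->
  simc inp [:: a, size x, c, v3, v4, v5, v6, n, v8, v9, 4 ^ n.+2 & rest] = ec (4 ^ n.+2) (run' n).
Proof.
move=> hn; rewrite /simc /= icodeE.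
apply: (@go_run M [::] k (fun _ => false) inp (4 ^ n.+2) (size x) (4 ^ n.+2) false 0 inp_off).
- by right.
- by move=> m hm; apply: small_growth_le; exact: ltnW.
- move=> m hm; rewrite add0n negb_or (ftime_min (leq_trans hm hn)) -leqNgt /=.
  by case: (small_growth_le (ltnW hm)).
Qed.

Lemma simPE v4 v5 v6 v7 v8 v9 v10 rest p o : ftime k <= V -> 4 ^ (ftime k).+2 <= V ->
  pexec inp ch V simP [:: 0, size x, k, 0, v4, v5, v6, v7, v8, v9, v10 & rest] p o
    [:: 0, size x, k, 0, v4, v5, f k, ftime k, v8, v9, 4 ^ (ftime k).+2 & rest] p o.
Proof.
move=> tV eV.
have V16 : 16 <= V by apply: leq_trans eV; rewrite !expnS mulnA; have := expn_gt0 4 (ftime k); lia.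
have bV (b : bool) : b <= V by case: b; lia.
pose I n := [:: 0, size x, k, nat_of_bool (~~ halting M (cq (run' n))), v4, v5, v6, n, v8, v9, 4 ^ n.+2 & rest].
pose g : fn := fun inp v => nat_of_bool (~~ hal M (simc inp v)).
have gE n v3 : n <= ftime k -> g inp [:: 0, size x, k, v3, v4, v5, v6, n, v8, v9, 4 ^ n.+2 & rest] = ~~ halting M (cq (run' n)).
  by move=> hn; rewrite /g simc_run // hal_ec.
have hw : pexec inp ch V (PWhile 3 (PSeq (PAsg 7 (fun _ v => (v#7).+1)) (PSeq (PAsg 10 (fun _ v => v#10 * 4)) (PAsg 3 g)))) (I 0) p o (I (ftime k)) p o.
  apply: (@XWhile_n inp ch V 3 _ (ftime k) I (fun _ => p) (fun _ => o)); last by rewrite /= ftime_halt.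
  move=> i hi; split; first by rewrite /= ftime_min.
  apply: XSeq; first by apply: XAsg => /=; exact: leq_trans tV.
  apply: XSeq; first by apply: XAsg => /=; rewrite -expnSr; apply: leq_trans eV; rewrite leq_exp2l.
  have := @XAsg inp ch V 3 g [:: 0, size x, k, nat_of_bool (~~ halting M (cq (run' i))), v4, v5, v6, i.+1, v8, v9, 4 ^ i.+3 & rest] p o.
  rewrite gE // => h; have {h} := h (bV _).
  by rewrite [set_nth _ _ 3 _]/= [set_nth _ _ _ _]/= -expnSr.
apply: XSeq; first by apply: XAsg.
apply: XSeq; first by apply: XAsg => /=; exact: V16.
apply: XSeq.
  have := @XAsg inp ch V 3 g [:: 0, size x, k, 0, v4, v5, v6, 0, v8, v9, 4 ^ 2 & rest] p o.
  by rewrite gE // => h; exact: (h (bV _)).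
apply: XSeq hw _.
have -> : [:: 0, size x, k, 0, v4, v5, f k, ftime k, v8, v9, 4 ^ (ftime k).+2 & rest] = set_nth 0 (I (ftime k)) 6 (f k).
  by rewrite /I /= ftime_halt.
have hdg : dg M (4 ^ (ftime k).+2) 6 (simc inp (I (ftime k))) = f k.
  rewrite simc_run //; have [_ _ _ _ [_ ->]] := ec_digits (small_growth (ftime k)).
  have [_ _ _ _ ho] := run_growth [::] k (fun _ => false) (ftime k).
  rewrite modn_small; first by rewrite ftime_out size_nseq.
  rewrite ltnS; apply: leq_trans ho _; apply: ltnW; apply: leq_trans (ltn_expl _ (isT : 1 < 4)) _.
  by rewrite leq_exp2l //; lia.
have h := @XAsg inp ch V 6 (fun inp v => dg M v#10 6 (simc inp v)) (I (ftime k)) p o.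
rewrite [(I _)#10]/= hdg in h; apply: h.
rewrite -(size_nseq (f k) S1) -ftime_out; have [_ _ _ _ ho] := run_growth [::] k (fun _ => false) (ftime k).
exact: leq_trans ho tV.
Qed.

End SimPE.
End SimP.

(** * The reduction program *)

Definition emit (g : fn) : prog := PSeq (PAsg 5 g) (PSeq outP (POut S0)).

Lemma wf_emit g m : 5 < m -> L g -> wf m (emit g).
Proof. by move=> hm hg /=; repeat split; try lia; L_tac. Qed.

Lemma emitE inp ch V g a b c d e n rest p o y : g inp [:: a, b, c, d, e, n & rest] = y -> y <= V ->
  pexec inp ch V (emit g) [:: a, b, c, d, e, n & rest] p o [:: a, b, c, d, e, 0 & rest] p
    (o ++ map bsym (ubits [:: y])).
Proof.
move=> <- hV; apply: XSeq; first exact: XAsg.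
apply: XSeq; first by apply: (@outPE _ _ _ a b c d e).
have -> : o ++ map bsym (ubits [:: g inp [:: a, b, c, d, e, n & rest]]) =
   rcons (o ++ nseq (g inp [:: a, b, c, d, e, n & rest]) S1) S0.
  by rewrite /ubits /= cats0 map_rcons map_nseq rcons_cat.
exact: XOut.
Qed.

Lemma lgE (x : seq bool) : lg (size x) = maxn 1 (lgn (size x)).
Proof.
rewrite /lg; case: (posnP (size x)) => [->|h]; last by rewrite lgnE //; lia.
by rewrite trunc_log0 /lgn big_ord0.
Qed.

Section Reduction.
Variables (M M1 M2 : TM) (f1 f2 : nat -> nat) (c1 : nat).
Hypothesis h1 : forall k c, exists n,
  halting M1 (cq (run M1 [::] k c n)) /\ out (run M1 [::] k c n) = nseq (f1 k) S1.
Hypothesis h2 : forall k c, exists n,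
  halting M2 (cq (run M2 [::] k c n)) /\ out (run M2 [::] k c n) = nseq (f2 k) S1.
Notation t1 := (ftime h1).
Notation t2 := (ftime h2).

(** [simP] overwrites variables 3, 6, 7 and 10, so the results for [M2] are saved in 8 and 9 before
    [M1] is simulated. *)
Definition prelude : prog :=
  PSeq pre (PSeq (simP M2) (PSeq (PAsg 8 (fun _ v => v#6)) (PSeq (PAsg 9 (fun _ v => v#7)) (simP M1)))).

Lemma wf_prelude : wf 12 prelude.
Proof.
split; first exact: wf_pre.
split; first exact: wf_simP.
by split; [split=> //; L_tac|split; [split=> //; L_tac|exact: wf_simP]].
Qed.

Definition vinit (x : seq bool) (k : nat) : seq nat :=
  [:: 0; size x; k; 0; 0; 0; f1 k; t1 k; f2 k; t2 k; 4 ^ (t1 k).+2; 0].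

Lemma f_le_time (M0 : TM) (f : nat -> nat) (h : forall k c, exists n,
  halting M0 (cq (run M0 [::] k c n)) /\ out (run M0 [::] k c n) = nseq (f k) S1) k : f k <= ftime h k.
Proof.
rewrite -(size_nseq (f k) S1) -(ftime_out h).
by have [_ _ _ _] := run_growth M0 [::] k (fun _ => false) (ftime h k).
Qed.

Lemma preludeE x k ch V p o : size x <= V -> k <= V -> t1 k <= V -> t2 k <= V ->
  4 ^ (t1 k).+2 <= V -> 4 ^ (t2 k).+2 <= V ->
  pexec (nth Blank (enc x k)) ch V prelude (nseq 12 0) p o (vinit x k) p o.
Proof.
move=> hx hk ht1 ht2 he1 he2.
have V0 : 0 < V by apply: leq_trans he1; rewrite expn_gt0.
apply: XSeq; first by apply: (@preE x k).
apply: XSeq; first exact: (@simPE M2 f2 h2 x k ch V 0 0 0 0 0 0 0 [:: 0]).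
apply: XSeq; first by apply: XAsg => /=; apply: leq_trans (f_le_time h2 k) ht2.
apply: XSeq; first exact: XAsg.
exact: (@simPE M1 f1 h1 x k ch V 0 0 (f2 k) (t2 k) (f2 k) (t2 k) (4 ^ (t2 k).+2) [:: 0]).
Qed.

(** This settles both computability claims of the reduction: for the space bound, running times
    included, and for the parameter of the query. *)
Lemma prelude_computable (g : seq nat -> nat) (F : nat -> nat) : L (fun _ v => g v) ->
  (forall k, F k = g (vinit [::] k)) -> computable F.
Proof.
move=> hg hF; apply: (@prog_computable 12 (PSeq prelude (PSeq (PAsg 5 (fun _ v => g v)) outP))) => //.
  by split; [exact: wf_prelude|split; [|exact: wf_outP]].
move=> k c; exists (k + t1 k + t2 k + 4 ^ (t1 k).+2 + 4 ^ (t2 k).+2 + F k).+1.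
exists (set_nth 0 (vinit [::] k) 5 0), 0; split=> //.
apply: XSeq; first by apply: preludeE => //; lia.
apply: (@XSeq _ _ _ _ _ _ _ _ (set_nth 0 (vinit [::] k) 5 (F k))).
  rewrite [in X in pexec _ _ _ _ _ _ _ X]hF; apply: (@XAsg _ _ _ 5 (fun _ v => g v)); rewrite -hF; lia.
apply: (@outPE _ _ _ 0 0 k 0 0 (F k)); lia.
Qed.

(** The first two factors make room for the tape codes, where [v#4] is the part depending on the
    parameter. The others cover the choice positions and the input length. *)
Definition T0f : fn := fun _ v => (2 * v#1 + 2) ^ c1 * v#4 * (v#8).+1 * (v#1).+1.

Definition szf : fn := fun inp v => size (gsucc M inp v#10 v#11).
Definition s0f : fn := fun inp v => nth 0 (gsucc M inp v#10 v#11) 0.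
Definition s1f : fn := fun inp v => nth 0 (gsucc M inp v#10 v#11) 1.

Lemma L_nN T : L T -> L (fun inp v => nN M (T inp v)).
Proof. by move=> hT; rewrite /nN; L_tac. Qed.
Hint Resolve L_nN : L.

Lemma L_tgt T : L T -> L (fun inp v => tgt M (T inp v)).
Proof. by move=> hT; rewrite /tgt; L_tac. Qed.
Hint Resolve L_tgt : L.

Lemma L_fin : L (fun inp v => fin M inp v#10 v#11).
Proof. by rewrite /fin; apply: L_go; L_tac. Qed.

Lemma L_pend : L (fun inp v => nat_of_bool (pend M inp v#10 v#11)).
Proof.
have h := L_fin; rewrite /pend; apply: L_leq; [apply: L_succ|]; apply: L_dg; L_tac.
Qed.

Lemma L_accv : L (fun inp v => nat_of_bool (accv M inp v#10 v#11)).
Proof. by have h := L_fin; rewrite /accv; apply: L_and; [apply: L_hal|apply: L_acc]. Qed.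

(** The class consists of functions with values in the naturals, so the successor list is observed
    through [g], its length or one entry, and [g] is pushed into the branches. *)
Lemma gsucc_if (g : seq nat -> nat) : (forall inp v, g (gsucc M inp v#10 v#11) =
   if v#11 == tgt M v#10 then g [:: tgt M v#10] else
   if pend M inp v#10 v#11 then g [:: 2 * fin M inp v#10 v#11; 2 * fin M inp v#10 v#11 + 1]
   else if accv M inp v#10 v#11 then g [:: tgt M v#10] else g [::]).
Proof. by move=> inp v; rewrite /gsucc; do ![case: ifP => _]. Qed.

Lemma L_szf : L szf.
Proof.
apply: L_ext; first by move=> inp v; rewrite /szf gsucc_if.
have := L_pend; have := L_accv; move=> ha hp; apply: L_if; first by L_tac.
  exact: (L_const 1).
apply: L_if; [exact: hp|exact: (L_const 2)|].
by apply: L_if; [exact: ha|exact: (L_const 1)|exact: (L_const 0)].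
Qed.

Lemma L_s0f : L s0f.
Proof.
apply: L_ext; first by move=> inp v; rewrite /s0f (gsucc_if (fun s => nth 0 s 0)).
have := L_pend; have := L_accv; have := L_fin; move=> hf ha hp; apply: L_if; first by L_tac.
  by rewrite /=; L_tac.
by rewrite /=; L_tac.
Qed.

Lemma L_s1f : L s1f.
Proof.
apply: L_ext; first by move=> inp v; rewrite /s1f (gsucc_if (fun s => nth 0 s 1)).
have := L_pend; have := L_accv; have := L_fin; move=> hf ha hp; apply: L_if; first by L_tac.
  exact: (L_const 0).
by rewrite /=; L_tac.
Qed.

Definition vertexP : prog :=
  PSeq (emit szf) (PSeq (PAsg 5 (fun inp v => nat_of_bool (0 < szf inp v)))
  (PSeq (PIf 5 (emit s0f) PSkip) (PSeq (PAsg 5 (fun inp v => nat_of_bool (1 < szf inp v)))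
  (PIf 5 (emit s1f) PSkip)))).

Definition redP : prog :=
  PSeq prelude (PSeq (PAsg 5 (fun _ v => c1 * v#6)) (PSeq pow2P (PSeq (PAsg 10 T0f)
  (PSeq (emit (fun _ v => (tgt M v#10).+1)) (PSeq (emit (fun _ v => 2 * icode M v#10))
  (PSeq (emit (fun _ v => tgt M v#10)) (PSeq (emit (fun _ v => v#8 * maxn 1 (lgn v#1) + 1))
  (PSeq (PAsg 11 (fun _ _ => 0)) (PSeq (PAsg 3 (fun _ _ => 1))
  (PSeq (PWhile 3 (PSeq vertexP (PSeq (PAsg 11 (fun _ v => (v#11).+1))
      (PAsg 3 (fun _ v => nat_of_bool (v#11 < (tgt M v#10).+1))))))
  (PSeq (POut Sep) (PSeq (PAsg 5 (fun _ v => (v#8).+1)) outP)))))))))))).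

Lemma wf_redP : wf 12 redP.
Proof.
have := L_szf; have := L_s0f; have := L_s1f => e2 e1 e0.
split; first exact: wf_prelude.
split; first by split=> //; L_tac.
split; first exact: wf_pow2P.
split; first by split=> //; rewrite /T0f; L_tac.
do 4 (split; first by apply: wf_emit => //; L_tac).
do 2 (split; first by split=> //; L_tac).
split.
  split=> //; split; last by do ![split=> //]; L_tac.
  split; first exact: wf_emit.
  split; first by split=> //; L_tac.
  split; first by split=> //; split=> //; exact: wf_emit.
  split; first by split=> //; L_tac.
  by split=> //; split=> //; exact: wf_emit.
by split=> //; split; [split=> //; L_tac|exact: wf_outP].
Qed.

Section RedE.
Variables (x : seq bool) (k : nat) (ch : nat -> bool).
Let inp := nth Blank (enc x k).
Definition redT : nat := (2 * size x + 2) ^ c1 * 2 ^ (c1 * f1 k) * (f2 k).+1 * (size x).+1.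
Definition redV : nat := size x + k + t1 k + t2 k + 4 ^ (t1 k).+2 + 4 ^ (t2 k).+2 + c1 * f1 k +
  2 ^ (c1 * f1 k) + redT + tgt M redT + f2 k * lg (size x) + f2 k + 4.

Definition rv (v3 v5 u : nat) : seq nat :=
  [:: 0; size x; k; v3; 2 ^ (c1 * f1 k); v5; f1 k; t1 k; f2 k; t2 k; redT; u].

Lemma emit_rv g v3 v5 u p o y : g inp (rv v3 v5 u) = y -> y <= redV ->
  pexec inp ch redV (emit g) (rv v3 v5 u) p o (rv v3 0 u) p (o ++ map bsym (ubits [:: y])).
Proof. exact: emitE. Qed.

Lemma asg_rv5 g v3 v5 u p o y : g inp (rv v3 v5 u) = y -> y <= redV ->
  pexec inp ch redV (PAsg 5 g) (rv v3 v5 u) p o (rv v3 y u) p o.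
Proof. by move=> <- h; apply: XAsg. Qed.

Lemma ubits_cons a l : ubits (a :: l) = ubits [:: a] ++ ubits l.
Proof. by rewrite -ubits_cat. Qed.

Lemma vertexPE v3 u p o : u <= tgt M redT ->
  pexec inp ch redV vertexP (rv v3 0 u) p o (rv v3 0 u) p
    (o ++ map bsym (ubits (size (gsucc M inp redT u) :: gsucc M inp redT u))).
Proof.
move=> hu; set l := gsucc _ _ _ _.
have hl : size l <= 2 /\ (forall i, nth 0 l i <= tgt M redT).
  rewrite /l /gsucc; case: eqP => [_|/eqP hne]; first by split=> // -[|[|i]].
  have hf : fin M inp redT u < nN M redT by apply: fin_lt; lia.
  by do ![case: ifP => _]; split=> // -[|[|i]]; rewrite /tgt /= ?nth_nil; lia.
have [l2 ln] := hl.
have bV (b : bool) : b <= redV by case: b; rewrite /redV; lia.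
have hz v5 : szf inp (rv v3 v5 u) = size l by [].
have hV i : nth 0 l i <= redV by apply: leq_trans (ln i) _; rewrite /redV; lia.
rewrite ubits_cons map_cat catA.
apply: XSeq; first by apply: (emit_rv _ _ (hz 0)); rewrite /redV; lia.
move: (o ++ map bsym (ubits [:: size l])) => o1.
have hs0 w5 : s0f inp (rv v3 w5 u) = nth 0 l 0 by [].
have hs1 w5 : s1f inp (rv v3 w5 u) = nth 0 l 1 by [].
clearbody l.
apply: XSeq; first by apply: (@asg_rv5 _ _ _ _ _ _ (nat_of_bool (0 < size l))); [rewrite hz|apply: bV].
apply: (@XSeq _ _ _ _ _ _ _ _ (rv v3 0 u) p (o1 ++ map bsym (ubits (take 1 l)))).
  apply: XIf; rewrite [nth 0 _ 5]/=; case: (l) hs0 hV => [|a l'] hs0 hV /=.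
    by rewrite cats0; exact: XSkip.
  by rewrite take0; apply: emit_rv; [exact: hs0|exact: (hV 0)].
apply: XSeq; first by apply: (@asg_rv5 _ _ _ _ _ _ (nat_of_bool (1 < size l))); [rewrite hz|apply: bV].
apply: XIf; rewrite [nth 0 _ 5]/=.
move: hs1 hV l2; case: (l) => [|a [|b [|c l']]] hs hV l2 //=.
- exact: XSkip.
- exact: XSkip.
- rewrite (ubits_cons a [:: b]) map_cat catA; apply: emit_rv; [exact: hs|exact: (hV 1)].
Qed.

Lemma redPE : exists v, pexec inp ch redV redP (nseq 12 0) 0 [::] v 0
  (enc (red_y M x k redT (f2 k)) (f2 k).+1).
Proof.
have hle : size x <= redV /\ k <= redV /\ t1 k <= redV /\ t2 k <= redV /\ 4 ^ (t1 k).+2 <= redV /\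
  4 ^ (t2 k).+2 <= redV /\ c1 * f1 k <= redV /\ 2 ^ (c1 * f1 k) <= redV /\ redT <= redV.
  by rewrite /redV; do ![split]; lia.
case: hle => [v1 [v2 [v3 [v4 [v5 [v6 [v7 [v8 v9]]]]]]]].
have hN : (tgt M redT).+1 <= redV by rewrite /redV; lia.
have ha : f2 k * lg (size x) + 1 <= redV by rewrite /redV; lia.
have hf2 : (f2 k).+1 <= redV by rewrite /redV; lia.
pose n := (tgt M redT).+1.
pose hd := [:: n; 2 * icode M redT; tgt M redT; red_a x (f2 k)].
(* The output once the header and the adjacency lists of the first [i] vertices are written. *)
pose O i := map bsym (ubits (hd ++ graph_nats (gsucc M inp redT) i)).
pose I i := rv (i < n) 0 i.
have hw : pexec inp ch redV (PWhile 3 (PSeq vertexP (PSeq (PAsg 11 (fun _ v => (v#11).+1))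
      (PAsg 3 (fun _ v => nat_of_bool (v#11 < (tgt M v#10).+1)))))) (I 0) 0 (O 0) (I n) 0 (O n).
  apply: (@XWhile_n inp ch redV 3 _ n I (fun _ => 0) O); last by rewrite /= ltnn.
  move=> i hi; split; first by rewrite /= hi.
  apply: (@XSeq _ _ _ _ _ _ _ _ (I i) 0 (O i.+1)).
    have -> : O i.+1 = O i ++ map bsym (ubits (size (gsucc M inp redT i) :: gsucc M inp redT i)).
      rewrite /O -map_cat -ubits_cat -catA; congr (map _ (ubits (_ ++ _))).
      by rewrite /graph_nats -[i.+1]addn1 iotaD !map_cat flatten_cat /= add0n cats0.
    exact: vertexPE.
  apply: XSeq; first by apply: XAsg => /=; apply: leq_trans hN.
  have -> : I i.+1 = set_nth 0 (rv (i < n) 0 i.+1) 3 (i.+1 < n) by [].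
  by apply: (@XAsg _ _ _ 3 (fun _ v => nat_of_bool (v#11 < (tgt M v#10).+1)) (rv (i < n) 0 i.+1)); case: (_ < _) => /=; lia.
exists (rv 0 0 n).
apply: XSeq; first exact: preludeE.
apply: XSeq; first exact: XAsg.
apply: XSeq; first by apply: (@pow2PE inp ch redV 0 (size x) k 0 0 (c1 * f1 k)) => //; apply: leq_trans v8; rewrite expn_gt0.
apply: (@XSeq _ _ _ _ _ _ _ _ (rv 0 0 0) 0 [::]).
  have -> : rv 0 0 0 = set_nth 0 [:: 0, size x, k, 0, 2 ^ (c1 * f1 k), 0 & [:: f1 k; t1 k; f2 k; t2 k; 4 ^ (t1 k).+2; 0]] 10 redT by [].
  exact: (@XAsg _ _ _ 10 T0f [:: 0, size x, k, 0, 2 ^ (c1 * f1 k), 0 & [:: f1 k; t1 k; f2 k; t2 k; 4 ^ (t1 k).+2; 0]]).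
have hic : 2 * icode M redT <= redV.
  by apply: leq_trans (ltnW hN); rewrite /tgt leq_mul2l /= icodeE ltnW // /nN; apply: ec_lt.
have hO : O 0 = ([::] ++ map bsym (ubits [:: n])) ++ map bsym (ubits [:: 2 * icode M redT]) ++
   map bsym (ubits [:: tgt M redT]) ++ map bsym (ubits [:: red_a x (f2 k)]).
  by rewrite /O /graph_nats cats0 -!map_cat -!ubits_cat.
apply: XSeq; first by apply: (@emit_rv (fun _ v => (tgt M v#10).+1) 0 0 0 0 [::] n).
apply: XSeq; first by apply: (@emit_rv (fun _ v => 2 * icode M v#10) 0 0 0 0 _ (2 * icode M redT)).
apply: XSeq; first by apply: (@emit_rv (fun _ v => tgt M v#10) 0 0 0 0 _ (tgt M redT)) => //; apply: ltnW.
apply: XSeq.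
  apply: (@emit_rv (fun _ v => v#8 * maxn 1 (lgn v#1) + 1) 0 0 0 0 _ (red_a x (f2 k))) => //.
  by rewrite /red_a lgE.
rewrite -!catA; rewrite -!catA in hO; rewrite -hO.
apply: XSeq; first exact: XAsg.
apply: XSeq; first by apply: XAsg; lia.
apply: XSeq hw _.
apply: XSeq; first exact: XOut.
apply: (@XSeq _ _ _ _ _ _ _ _ (rv 0 (f2 k).+1 n)).
  by rewrite /I ltnn; apply: (@asg_rv5 (fun _ v => (v#8).+1)).
rewrite /enc -cat_rcons (_ : red_y M x k redT (f2 k) = ubits (hd ++ graph_nats (gsucc M inp redT) n)).
  exact: outPE.
by rewrite /red_y /hd icodeE.
Qed.

End RedE.
End Reduction.

(** * The size of the codes and the space of the reduction *)

Lemma size_lg (x : seq bool) : (size x).+1 <= 2 ^ lg (size x) <= 2 * size x + 2.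
Proof.
rewrite /lg trunc_log_ltn //= expnS; case: (posnP (size x)) => [->|h]; first by rewrite trunc_log0.
by have := trunc_logP (isT : 1 < 2) h; lia.
Qed.

(** Tapes are coded in base 4, which doubles the exponent of 2 and explains [2 * a1]; [2 ^ lg |x|]
    is replaced by the larger [2 * |x| + 2], which needs no logarithm. *)
Lemma redT_ge (f1 f2 : nat -> nat) a1 (x : seq bool) k (T := redT f1 f2 (2 * a1) x k) :
  4 ^ (a1 * (lg (size x) + f1 k)) <= T /\ f2 k * lg (size x) <= T /\ size x <= T.
Proof.
have /andP [g1 g2] := size_lg x.
have e1 : 4 ^ (a1 * (lg (size x) + f1 k)) = (2 ^ lg (size x)) ^ (2 * a1) * 2 ^ (2 * a1 * f1 k).
  by rewrite (_ : 4 = 2 ^ 2) // -!expnM -expnD; congr (2 ^ _); lia.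
have p1 : 0 < (2 * size x + 2) ^ (2 * a1) by rewrite expn_gt0 addn2.
have p2 : 0 < 2 ^ (2 * a1 * f1 k) by rewrite expn_gt0.
have l1 : lg (size x) <= (size x).+1.
  rewrite /lg ltnS; case: (posnP (size x)) => [->|h]; first by rewrite trunc_log0.
  by apply: ltnW; apply: leq_trans (trunc_logP (isT : 1 < 2) h); apply: ltn_expl.
rewrite /T /redT; split; last split.
- rewrite e1; apply: (@leq_trans ((2 * size x + 2) ^ (2 * a1) * 2 ^ (2 * a1 * f1 k))).
    by rewrite leq_mul2r leq_expl ?orbT.
  by rewrite -[X in _ <= X]mulnA leq_pmulr.
- rewrite -[X in _ <= X]mulnA; apply: leq_trans (leq_pmull _ _); last by rewrite muln_gt0 p1.
  by apply: leq_mul => //; apply: leqnSn.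
- by apply: leq_trans (leqnSn _) _; rewrite leq_pmull // !muln_gt0 p1 p2.
Qed.

Section Bounds.
Variables (M M1 M2 : TM) (f1 f2 : nat -> nat) (a1 : nat).
Hypothesis h1 : forall k c, exists n,
  halting M1 (cq (run M1 [::] k c n)) /\ out (run M1 [::] k c n) = nseq (f1 k) S1.
Hypothesis h2 : forall k c, exists n,
  halting M2 (cq (run M2 [::] k c n)) /\ out (run M2 [::] k c n) = nseq (f2 k) S1.
Variables (x : seq bool) (k : nat).
Notation t1 := (ftime h1 k).
Notation t2 := (ftime h2 k).
Let X := lg (size x) + (k + f1 k + f2 k + t1 + t2).
Notation T := (redT f1 f2 (2 * a1) x k).

(** Every value is at most [2 ^ (e * X)] for a constant [e], and products add such constants. [T.+1]
    needs [c], so seven digits and the state of a code need at most [7 * c + nQ M]. *)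
Lemma redV_bound : (redV M (2 * a1) h1 h2 x k).+2 <= 2 ^ ((7 * (12 * a1 + 3) + nQ M + 16) * X).
Proof.
set c := 12 * a1 + 3.
have X1 : 0 < X by rewrite /X /lg; lia.
have up e y : y <= 2 ^ (e * X) -> forall e', e <= e' -> y <= 2 ^ (e' * X).
  by move=> h e' he; apply: leq_trans h _; rewrite leq_exp2l // leq_mul2r he orbT.
have lin y : y <= X -> y.+1 <= 2 ^ (1 * X) by move=> h; rewrite mul1n; apply: leq_ltn_trans h (ltn_expl _ _).
have ex e y : y <= e * X -> 2 ^ y <= 2 ^ (e * X) by move=> h; rewrite leq_exp2l.
have ml e e' y y' : y <= 2 ^ (e * X) -> y' <= 2 ^ (e' * X) -> y * y' <= 2 ^ ((e + e') * X).
  by move=> hy hy'; rewrite mulnDl expnD leq_mul.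
have /andP [g1 g2] := size_lg x.
have bx : (size x).+1 <= 2 ^ (1 * X).
  by apply: leq_trans g1 _; rewrite leq_exp2l // mul1n /X; lia.
have bT : T <= 2 ^ ((6 * a1 + 2) * X).
  have b1 : (2 * size x + 2) ^ (2 * a1) <= 2 ^ (4 * a1 * X).
    have : 2 * size x + 2 <= 2 ^ (2 * X).
      have : 2 * (size x).+1 <= 2 ^ ((1 + 1) * X) by apply: ml => //; rewrite -[X in X <= _]expn1 leq_exp2l // mul1n.
      by move=> h; apply: leq_trans h; lia.
    by move=> h; apply: leq_trans (leq_expl _ h) _; rewrite -expnM leq_exp2l //; lia.
  have b2 : 2 ^ (2 * a1 * f1 k) <= 2 ^ (2 * a1 * X) by rewrite leq_exp2l // leq_mul2l /X; lia.
  have b3 : (f2 k).+1 <= 2 ^ (1 * X) by apply: lin; rewrite /X; lia.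
  apply: up (ml _ _ _ _ (ml _ _ _ _ (ml _ _ _ _ b1 b2) b3) bx) _ _; lia.
have bT1 : T.+1 <= 2 ^ (c * X).
  have : T.+1 <= 2 * 2 ^ ((6 * a1 + 2) * X) by have := expn_gt0 2 ((6 * a1 + 2) * X); lia.
  move/leq_trans; apply; rewrite -expnS leq_exp2l //.
  have : (6 * a1 + 2) * X + X <= c * X by rewrite -mulSnr leq_mul2r /c; lia.
  lia.
have bt : tgt M T <= 2 ^ ((7 * c + nQ M + 1) * X).
  have b1 : T.+1 ^ 7 <= 2 ^ (7 * c * X).
    by apply: leq_trans (leq_expl _ bT1) _; rewrite -expnM leq_exp2l //; lia.
  have b2 : nQ M <= 2 ^ (nQ M * X).
    by apply: ltnW; apply: leq_trans (ltn_expl _ (isT : 1 < 2)) _; rewrite leq_exp2l // leq_pmulr.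
  have b3 : 2 <= 2 ^ (1 * X) by rewrite -[X in X <= _]expn1 leq_exp2l // mul1n.
  by rewrite /tgt /nN; apply: up (ml _ _ _ _ b3 (ml _ _ _ _ b2 b1)) _ _; lia.
set E := 7 * c + nQ M + 12.
have bE y e : y <= 2 ^ (e * X) -> e <= E -> y <= 2 ^ (E * X) by move=> h he; apply: up h _ he.
have l1 y : y <= X -> y <= 2 ^ (E * X) by move=> h; apply: bE (ltnW (lin _ h)) _; rewrite /E; lia.
have s1 : size x <= 2 ^ (E * X) by apply: bE (ltnW bx) _; rewrite /E; lia.
have s2 : k <= 2 ^ (E * X) by apply: l1; rewrite /X; lia.
have s3 : t1 <= 2 ^ (E * X) by apply: l1; rewrite /X; lia.
have s4 : t2 <= 2 ^ (E * X) by apply: l1; rewrite /X; lia.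
have p4 t : t <= X -> 4 ^ t.+2 <= 2 ^ (E * X).
  move=> ht; apply: (bE _ 6); last by rewrite /E; lia.
  by rewrite (_ : 4 = 2 ^ 2) // -expnM; apply: ex; lia.
have s5 : 4 ^ t1.+2 <= 2 ^ (E * X) by apply: p4; rewrite /X; lia.
have s6 : 4 ^ t2.+2 <= 2 ^ (E * X) by apply: p4; rewrite /X; lia.
have fX : 2 * a1 * f1 k <= 2 * a1 * X by rewrite leq_mul2l /X; lia.
have s8 : 2 ^ (2 * a1 * f1 k) <= 2 ^ (E * X) by apply: bE (ex _ _ fX) _; rewrite /E /c; lia.
have s7 : 2 * a1 * f1 k <= 2 ^ (E * X) by apply: leq_trans s8; apply/ltnW/ltn_expl.
have s9 : T <= 2 ^ (E * X) by apply: bE bT _; rewrite /E /c; lia.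
have s10 : tgt M T <= 2 ^ (E * X) by apply: bE bt _; rewrite /E /c; lia.
have s12 : f2 k <= 2 ^ (E * X) by apply: l1; rewrite /X; lia.
have s11 : f2 k * lg (size x) <= 2 ^ (E * X).
  apply: (bE _ (1 + 1)); last by rewrite /E; lia.
  by apply: ml; apply: ltnW; apply: lin; rewrite /X; lia.
(* The twelve non-constant summands of [redV] count once each and the constants are worth at most
   four more, which makes 16 copies of the largest bound. *)
have : 2 ^ 4 * 2 ^ (E * X) <= 2 ^ ((7 * c + nQ M + 16) * X).
  rewrite -expnD leq_exp2l // (_ : 7 * c + nQ M + 16 = E + 4); last by rewrite /E; lia.
  by rewrite mulnDl addnC leq_add2l; lia.
apply: leq_trans; rewrite /redV.
have s0 : 6 <= 2 ^ (E * X) * 4.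
  have : 2 ^ 1 <= 2 ^ (E * X) by rewrite leq_exp2l // muln_gt0 X1 andbT /E; lia.
  lia.
lia.
Qed.

End Bounds.

Theorem logreach_hard b G : 1 < b -> sharp_paraBeta_L G -> plog_pars_reduces G (logreach b).
Proof.
move=> b1 [M [[f1 [[M1 h1] [a1 hspace]]] [[f2 [[M2 h2] hchp]] [ro hG]]]].
have [M' [K [ro' hM']]] := prog_TM (wf_redP M M1 M2 (2 * a1)) (isT : 0 < 12).
have V0 x k : 0 < redV M (2 * a1) h1 h2 x k by rewrite /redV; lia.
have hrun x k c : exists n, [/\ halting M' (cq (run M' x k c n)), chp (run M' x k c n) = 0,
   out (run M' x k c n) = enc (red_y M x k (redT f1 f2 (2 * a1) x k) (f2 k)) (f2 k).+1 &
   forall n', space (run M' x k c n') <= K * (trunc_log 2 (redV M (2 * a1) h1 h2 x k).+2).+1].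
  have [v hx] := @redPE M M1 M2 f1 f2 (2 * a1) h1 h2 x k c.
  by have [n [e1 _ e2 e3 e4]] := hM' _ _ _ _ _ _ _ (V0 x k) hx; exists n.
exists M'; split.
  (* The running times occur because simulating the machines of the bounds stores numbers up to
     [4 ^ t.+2] for a running time [t]. *)
  exists (fun k => k + f1 k + f2 k + ftime h1 k + ftime h2 k); split.
    by apply: (@prelude_computable M1 M2 f1 f2 h1 h2 (fun v => v#2 + v#6 + v#8 + v#7 + v#9)) => //; L_tac.
  exists (K * (7 * (12 * a1 + 3) + nQ M + 17)) => x k c n.
  have [n1 [_ _ _ /(_ n) hs]] := hrun x k c; apply: leq_trans hs _.
  rewrite -mulnA leq_mul2l; apply/orP; right.
  have := @redV_bound M M1 M2 f1 f2 a1 h1 h2 x k; rewrite -[X in 2 ^ X]addn0 => /trunc_logD_le.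
  set X := lg _ + _; have X1 : 0 < X by rewrite /X /lg; lia.
  have -> : 7 * (12 * a1 + 3) + nQ M + 17 = 7 * (12 * a1 + 3) + nQ M + 16 + 1 by lia.
  by rewrite addn0 => hh; rewrite mulnDl mul1n -addn1; apply: leq_add.
split.
  move=> x k c n; have [n1 [e1 e2 _ _]] := hrun x k c.
  apply/eqP; rewrite -leqn0 -e2; case: (leqP n n1) => hn; first exact: run_chp_le.
  by rewrite (run_halt e1 (ltnW hn)).
exists (fun k => (f2 k).+1); split.
  by apply: (@prelude_computable M1 M2 f1 f2 h1 h2 (fun v => (v#8).+1)) => //; L_tac.
move=> x k; have [n [e1 _ e3 _]] := hrun x k (fun _ => false).
exists n, (red_y M x k (redT f1 f2 (2 * a1) x k) (f2 k)), (f2 k).+1; split=> //; split=> //; split=> //.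
have [s [us [hs ->]]] := hG x k.
have [g1 [g2 g3]] := redT_ge f1 f2 a1 x k.
apply/esym/red_ok => // c m.
apply: (small_run (hspace x k c m)) => //.
exact: leq_trans (hchp x k c m) g2.
Qed.

Theorem theorem13 (b : nat) :
  2 <= b -> complete sharp_paraBeta_L plog_pars_reduces (logreach b).
Proof.
move=> b2; split; first exact/logreach_in/ltnW.
by move=> G; apply: logreach_hard.
Qed.
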